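(* Let either $n \geq 3$ and $1 < p < \infty$, or $n \geq 4$ and $p=1$, and let $\Phi$ map $\mathcal{P}_o^n$ to $C_p(\mathbb{R}^n)$. Assume that $\Phi P$ is non-negative and $(\Phi P)^{1/p}$ is sublinear for every $P \in \mathcal{P}_o^n$. Then $\Phi$ is an $\mathrm{SL}(n)$ covariant valuation if and only if there exist constants $a_1,b_1,c_1,c_2 \geq 0$ such that $$\Phi P = c_1 h_{M_p^+ P}^p + c_2 h_{M_p^- P}^p + a_1 h_P^p + b_1 h_{-P}^p$$ for every $P \in \mathcal{P}_o^n$.
   Context: $\mathcal{P}_o^n$ is the set of convex polytopes in $\mathbb{R}^n$ containing the origin. $C_p(\mathbb{R}^n)$ is the set of continuous functions $f:\mathbb{R}^n\to\mathbb{R}$ with $f(\lambda x)=\lambda^pf(x)$ for $\lambda\ge0$. A function $g$ is sublinear if $g(\lambda x)=\lambda g(x)$ for $\lambda\ge0$ and $g(x+y)\le g(x)+g(y)$. A map $\Phi:\mathcal{P}_o^n\to C_p(\mathbb{R}^n)$ is a valuation if $\Phi(K\cup L)+\Phi(K\cap L)=\Phi(K)+\Phi(L)$ whenever $K,L,K\cup L,K\cap L\in\mathcal{P}_o^n$; it is $\mathrm{SL}(n)$ covariant if $\Phi(\phi K)(x)=\Phi(K)(\phi^tx)$ for all $\phi\in\mathrm{SL}(n)$. $h_K$ is the support function of $K$; $h_{M_p^\pm K}(x)=\left(\int_K(\max\{\pm x\cdot y,0\})^p\,dy\right)^{1/p}$ (Lebesgue measure on $\mathbb{R}^n$). *)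

(* Defs.v *)
From HB Require Import structures.
From mathcomp Require Import all_boot all_order all_algebra.
From mathcomp Require Import all_classical all_reals all_analysis.
Set Implicit Arguments. Unset Strict Implicit. Unset Printing Implicit Defensive.
Import Order.TTheory GRing.Theory Num.Theory.
Import numFieldNormedType.Exports.
Local Open Scope classical_set_scope.
Local Open Scope ring_scope.

Section Defs.
Variable R : realType.

Definition dotv n (x y : 'cV[R]_n) : R := \sum_(i < n) x i 0 * y i 0.

Definition conv_hull n (s : seq 'cV[R]_n) : set 'cV[R]_n :=
  [set x | exists w : 'I_(size s) -> R,
     (forall i, 0 <= w i) /\ \sum_(i < size s) w i = 1 /\
     x = \sum_(i < size s) w i *: s`_i].

Definition polytope_o n (P : set 'cV[R]_n) : Prop :=
  (exists s : seq 'cV[R]_n, P = conv_hull s) /\ P 0.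

Definition supp_fun n (K : set 'cV[R]_n) (x : 'cV[R]_n) : R :=
  sup [set dotv x y | y in K].

Definition cons_cV n (t : R) (y : 'cV[R]_n) : 'cV[R]_n.+1 :=
  \col_(i < n.+1) match unlift ord0 i with None => t | Some j => y j 0 end.

(* Lebesgue integral over R^n of a non-negative function, defined as the
   iterated one-dimensional Lebesgue integral (Tonelli). *)
Fixpoint lebesgue_int_n (n : nat) : ('cV[R]_n -> \bar R) -> \bar R :=
  match n return ('cV[R]_n -> \bar R) -> \bar R with
  | 0 => fun f => f 0
  | n'.+1 => fun f =>
      (\int[@lebesgue_measure R]_t lebesgue_int_n (fun y => f (cons_cV t y)))%E
  end.

Definition supp_Mp_plus n (p : R) (K : set 'cV[R]_n) (x : 'cV[R]_n) : R :=
  powR (fine (lebesgue_int_n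
    (fun y => (\1_K y * powR (Num.max (dotv x y) 0) p)%:E))) p^-1.
Definition supp_Mp_minus n (p : R) (K : set 'cV[R]_n) (x : 'cV[R]_n) : R :=
  powR (fine (lebesgue_int_n
    (fun y => (\1_K y * powR (Num.max (- dotv x y) 0) p)%:E))) p^-1.

Definition Cp n (p : R) (f : 'cV[R]_n -> R) : Prop :=
  continuous f /\ forall (l : R) x, 0 <= l -> f (l *: x) = powR l p * f x.

Definition sublinear n (g : 'cV[R]_n -> R) : Prop :=
  (forall (l : R) x, 0 <= l -> g (l *: x) = l * g x) /\
  (forall x y, g (x + y) <= g x + g y).

Definition is_valuation n (Phi : set 'cV[R]_n -> 'cV[R]_n -> R) : Prop :=
  forall K L, polytope_o K -> polytope_o L -> polytope_o (K `|` L) ->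
    polytope_o (K `&` L) ->
    forall x, Phi (K `|` L) x + Phi (K `&` L) x = Phi K x + Phi L x.

Definition SL_covariant n (Phi : set 'cV[R]_n -> 'cV[R]_n -> R) : Prop :=
  forall (phi : 'M[R]_n), \det phi = 1 -> forall K, polytope_o K ->
    forall x, Phi ((fun y => phi *m y) @` K) x = Phi K (phi^T *m x).

End Defs.

(* Main.v *)
(* On simplices conv(0, v_1, ..., v_d) with free v_i and d < n, SL(n) covariance makes the value
   of a valuation Z at x a function G of the dots x.v_i, and cutting an edge turns additivity into
   a functional equation for G.  Subtracting from Phi the terms a h_P^p + b h_{-P}^p given by its
   values on segments leaves a Z with G vanishing on segments, governed by the two numbers G(1,0)
   and G(-1,0).  Nonnegativity and convexity of Phi force these to be 0 (this is where p > 1 or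
   n >= 4 enters), so Z is simple.  A simple Z is determined by its values on n-simplices with at
   most one nonzero dot: there it is, like the moment functions, a multiple of the volume, and
   subtracting the right multiples of the two moment functions leaves 0. *)
Require Import Defs.
From HB Require Import structures.
From mathcomp Require Import all_boot all_order all_algebra.
From mathcomp Require Import all_classical all_reals all_analysis.
From mathcomp Require Import measurable_realfun perm zify ring lra.
Set Implicit Arguments. Unset Strict Implicit. Unset Printing Implicit Defensive.
Import Order.TTheory GRing.Theory Num.Theory.
Import numFieldNormedType.Exports.
Local Open Scope classical_set_scope.
Local Open Scope ring_scope.

(** * Convex cones and polytopes *)

(** The obstacle is the top dimension. Fewer than n free vectors, not all orthogonal to x, extend by
    vectors orthogonal to x to a frame of determinant 1, so only their dots matter; n free vectors
    also carry a determinant. When two of the n dots agree, one vertex can slide in a direction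
    orthogonal to x, and the value becomes an additive function of the volume; nonnegativity of Phi
    bounds it below, so it is linear. Such volume terms also arise when convexity is tested on
    simplices spanned by 3 or 4 vectors; shrinking one vector by a factor e -> 0 removes them.
    Convexity along the dots (1,0), (1,1/2), (1,1) gives G(1,0) <= 0 only when 2^-p < 1/2; for p = 1
    a bipyramid spanning four dimensions takes over, whence n >= 4. No triangulation is used to pass
    from simplices to polytopes: only the property of vanishing is carried through hyperplane cuts,
    until simplices remain. Since the integral is an iterated one, covariance of the moment
    functions rests on a change of variables formula, obtained by factoring matrices into triangular
    ones. *)

Section ConvexHulls.
Variable R : realType.

Section Dot.
Variable n : nat.
Implicit Types x y z : 'cV[R]_n.

Lemma dotvC x y : dotv x y = dotv y x.
Proof. by apply: eq_bigr => i _; rewrite mulrC. Qed.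

Lemma dotvDr x y z : dotv x (y + z) = dotv x y + dotv x z.
Proof. by rewrite -big_split; apply: eq_bigr => i _; rewrite mxE mulrDr. Qed.

Lemma dotvZr a x y : dotv x (a *: y) = a * dotv x y.
Proof. by rewrite mulr_sumr; apply: eq_bigr => i _; rewrite mxE mulrCA. Qed.

Lemma dotvDl x y z : dotv (x + y) z = dotv x z + dotv y z.
Proof. by rewrite dotvC dotvDr !(dotvC z). Qed.

Lemma dotvZl a x y : dotv (a *: x) y = a * dotv x y.
Proof. by rewrite dotvC dotvZr dotvC. Qed.

Lemma dotvNr x y : dotv x (- y) = - dotv x y.
Proof. by rewrite -scaleN1r dotvZr mulN1r. Qed.

Lemma dotvNl x y : dotv (- x) y = - dotv x y.
Proof. by rewrite dotvC dotvNr dotvC. Qed.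

Lemma dotv0r x : dotv x 0 = 0.
Proof. by rewrite -(scale0r x) dotvZr mul0r. Qed.

Lemma dotv0l x : dotv 0 x = 0.
Proof. by rewrite dotvC dotv0r. Qed.

Lemma dotv_sumr x (I : Type) (r : seq I) (P : pred I) (F : I -> 'cV[R]_n) :
  dotv x (\sum_(i <- r | P i) F i) = \sum_(i <- r | P i) dotv x (F i).
Proof. by apply: (big_morph (dotv x)); [exact: dotvDr|exact: dotv0r]. Qed.

Lemma dotv_mul (A : 'M[R]_n) x y : dotv x (A *m y) = dotv (A^T *m x) y.
Proof.
rewrite /dotv.
under eq_bigr => i _ do rewrite mxE mulr_sumr.
under [RHS]eq_bigr => i _ do rewrite mxE mulr_suml.
rewrite exchange_big; apply: eq_bigr => i _; apply: eq_bigr => j _.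
by rewrite mxE mulrA (mulrC (x _ _)).
Qed.

Lemma dotv_delta x i : dotv x (delta_mx i 0) = x i 0.
Proof.
rewrite /dotv (bigD1 i) //= big1 => [|j ji]; rewrite !mxE ?eqxx ?mulr1 ?addr0 //.
by rewrite (negbTE ji) mulr0.
Qed.

Lemma dotv_self_eq0 x : dotv x x = 0 -> x = 0.
Proof.
move=> /eqP; rewrite psumr_eq0 => [/allP h|i _]; last by rewrite -expr2 sqr_ge0.
apply/colP => i; have := h i (mem_index_enum _).
by rewrite mxE mulf_eq0 orbb => /eqP.
Qed.

End Dot.

Definition convex n (C : set 'cV[R]_n) := forall x y (t : R),
  0 <= t -> t <= 1 -> C x -> C y -> C ((1 - t) *: x + t *: y).

Definition conic n (C : set 'cV[R]_n) :=
  [/\ C 0, forall x y, C x -> C y -> C (x + y) &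
      forall a x, 0 <= a -> C x -> C (a *: x)].

(** Recursion on the generators makes adding one generator the projection of a single coefficient,
    which is the step of Fourier-Motzkin elimination; [cone_weights] recovers the usual description
    by weights. *)
Fixpoint cone n (s : seq 'cV[R]_n) (x : 'cV[R]_n) : Prop :=
  if s is v :: s' then exists2 a : R, 0 <= a & cone s' (x - a *: v) else x = 0.

Section Cones.
Variable n : nat.
Implicit Types (x y v g : 'cV[R]_n) (s t : seq 'cV[R]_n).

Lemma cone_conic s : conic (cone s).
Proof.
elim: s => [|v s [c0 cD cZ]] /=.
  by split=> [|x y -> ->|a x _ ->] //; rewrite ?addr0 ?scaler0.
split.
- by exists 0; rewrite ?scale0r ?subr0.
- move=> x y [a a0 xa] [b b0 yb]; exists (a + b); first exact: addr_ge0.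
  by rewrite scalerDl opprD addrACA; apply: cD.
- move=> a x a0 [b b0 xb]; exists (a * b); first exact: mulr_ge0.
  by rewrite -scalerA -scalerBr; apply: cZ.
Qed.

Lemma cone0 s : cone s 0. Proof. by case: (cone_conic s). Qed.
Lemma coneD s x y : cone s x -> cone s y -> cone s (x + y).
Proof. by case: (cone_conic s) => _ + _; apply. Qed.
Lemma coneZ s a x : 0 <= a -> cone s x -> cone s (a *: x).
Proof. by case: (cone_conic s) => _ _; apply. Qed.

Lemma cone_mem s v : v \in s -> cone s v.
Proof.
elim: s => //= u s ih; rewrite inE => /orP[/eqP ->|/ih sv].
  by exists 1; rewrite ?scale1r ?subrr //; apply: cone0.
by exists 0; rewrite ?scale0r ?subr0.
Qed.

Lemma cone_min s (C : set 'cV[R]_n) : conic C ->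
  (forall v, v \in s -> C v) -> forall x, cone s x -> C x.
Proof.
move=> [C0 CD CZ]; elim: s => [|v s ih] sC x /=; first by move->.
move=> [a a0 /ih h]; rewrite -(subrK (a *: v) x); apply: CD.
  by apply: h => u us; apply: sC; rewrite inE us orbT.
by apply: CZ => //; apply: sC; rewrite inE eqxx.
Qed.

Lemma cone_sub s t : (forall v, v \in s -> cone t v) -> forall x, cone s x -> cone t x.
Proof. exact: (cone_min (cone_conic t)). Qed.

Lemma cone_cat s t x : cone (s ++ t) x <-> exists p m, [/\ cone s p, cone t m & x = p + m].
Proof.
split.
  elim: s x => [|v s ih] x /=; first by exists 0, x; rewrite add0r.
  move=> [a a0 /ih[p [m [ps mt e]]]].
  exists (p + a *: v), m; split=> //; first by exists a => //; rewrite addrK.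
  by rewrite addrAC -e subrK.
move=> [p [m [ps mt ->]]]; apply: coneD.
  by apply: cone_sub ps => v vs; apply: cone_mem; rewrite mem_cat vs.
by apply: cone_sub mt => v vs; apply: cone_mem; rewrite mem_cat vs orbT.
Qed.

Lemma conic_halfspace g : conic [set x | dotv g x <= 0].
Proof.
split=> /= [|x y gx gy|a x a0 gx]; rewrite ?dotv0r ?dotvDr ?dotvZr //.
  by rewrite -(addr0 0) lerD.
by rewrite mulr_ge0_le0.
Qed.

(** Each [h] positive at [v] bounds [a] from below, each [h] negative at [v] bounds it from above. A
    suitable [a] exists when every lower bound is at most every upper bound: these are the pairs of
    [P] and [N]. The lower bound 0 turns each upper bound into [dotv h x <= 0], hence the negative
    [h] are kept too. *)
Lemma fourier_motzkin (hs : seq 'cV[R]_n) v : exists hs' : seq 'cV[R]_n, forall x,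
  (exists2 a : R, 0 <= a & forall h, h \in hs -> dotv h (x - a *: v) <= 0) <->
  (forall h, h \in hs' -> dotv h x <= 0).
Proof.
pose N := [seq h <- hs | dotv h v < 0]; pose P := [seq h <- hs | 0 < dotv h v].
exists ([seq h <- hs | dotv h v <= 0] ++
        [seq (- dotv q v) *: p + dotv p v *: q | p <- P, q <- N]) => x.
have dB h a : dotv h (x - a *: v) = dotv h x - a * dotv h v.
  by rewrite dotvDr dotvNr dotvZr.
split=> [[a a0 ha] h|H].
  rewrite mem_cat => /orP[|/allpairsP[[p q] /= [pP qN ->]]].
    rewrite mem_filter => /andP[hv hin]; have := ha _ hin; rewrite dB.
    have : a * dotv h v <= 0 by rewrite mulr_ge0_le0.
    lra.
  move: pP qN; rewrite !mem_filter => /andP[pv pin] /andP[qv qin].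
  have := ha _ pin; have := ha _ qin; rewrite !dB dotvDl !dotvZl => hq hp.
  have -> : - dotv q v * dotv p x + dotv p v * dotv q x =
    (- dotv q v) * (dotv p x - a * dotv p v) + dotv p v * (dotv q x - a * dotv q v) by ring.
  by rewrite -(addr0 0) lerD // pmulr_rle0 // oppr_gt0.
(* The largest of the lower bounds, 0 included. *)
pose a := \big[Num.max/0]_(h <- P) (dotv h x / dotv h v).
exists a; first by rewrite /a; elim/big_rec: _ => // h y _ y0; rewrite le_max y0 orbT.
move=> h hin; rewrite dB subr_le0.
have [hv|hv|hv] := ltgtP (dotv h v) 0; last first.
- have := H h; rewrite hv mulr0; apply.
  by rewrite mem_cat mem_filter hin hv lexx.
- rewrite -ler_pdivrMr //.
  have : h \in P by rewrite mem_filter hv hin.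
  rewrite /a; elim: (P) => // q r ih; rewrite inE big_cons le_max => /orP[/eqP ->|/ih ->].
    by rewrite lexx.
  by rewrite orbT.
- rewrite -ler_ndivlMr // /a.
  have : forall p, p \in P -> p \in P by [].
  elim: {-2}(P) => [|p r ih] rP.
    rewrite big_nil ler_ndivlMr // mul0r; apply: H.
    by rewrite mem_cat mem_filter hin ltW.
  rewrite big_cons ge_max ih => [|q qr]; last by apply: rP; rewrite inE qr orbT.
  rewrite andbT.
  have pP : p \in P by apply: rP; rewrite inE eqxx.
  have pv : 0 < dotv p v by move: pP; rewrite mem_filter => /andP[].
  have := H ((- dotv h v) *: p + dotv p v *: h).
  rewrite mem_cat; set b := (X in _ || X).
  have -> : b.
    by apply/allpairsP; exists (p, h); rewrite /= pP; split=> //; rewrite mem_filter hv.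
  rewrite orbT dotvDl !dotvZl => /(_ isT) e.
  by rewrite ler_pdivrMr // mulrAC ler_ndivlMr //; lra.
Qed.

(** Weyl's theorem: the cone {0} is cut out by the coordinates and their opposites, and each
    generator is then added by one elimination. *)
Lemma cone_halfspaces s : exists hs : seq 'cV[R]_n,
  forall x, cone s x <-> forall h, h \in hs -> dotv h x <= 0.
Proof.
elim: s => [|v s [hs ih]].
  exists ([seq delta_mx i 0 | i : 'I_n] ++ [seq - delta_mx i 0 | i : 'I_n]) => x /=.
  split=> [-> h _|h]; first by rewrite dotv0r.
  apply/colP => i; rewrite mxE; apply/eqP; rewrite eq_le -(dotv_delta x) dotvC; apply/andP; split.
    by apply: h; rewrite mem_cat; apply/orP; left; apply/mapP; exists i; rewrite ?mem_enum.
  rewrite -oppr_le0 -dotvNl; apply: h; rewrite mem_cat; apply/orP; right.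
  by apply/mapP; exists i; rewrite ?mem_enum.
have [hs' h'] := fourier_motzkin hs v; exists hs' => x; rewrite -h' /=.
by split=> -[a a0 /ih]; exists a.
Qed.

(** The new generators are those on the side [dotv g v <= 0], and for each pair on opposite sides
    the point where their plane sector meets the hyperplane. The description of the members of [t]
    is there for [polytope_o_half], which needs them at positive height. *)
Lemma cone_cut s g : exists2 t : seq 'cV[R]_n,
  (forall v, v \in t -> v \in s \/ exists a b p m, [/\ 0 < a, 0 <= b, p \in s, m \in s & v = a *: m + b *: p]) &
  forall x, cone t x <-> cone s x /\ dotv g x <= 0.
Proof.
pose sp := [seq v <- s | 0 < dotv g v]; pose sm := [seq v <- s | dotv g v <= 0].
pose t := sm ++ [seq dotv g p *: m + (- dotv g m) *: p | p <- sp, m <- sm].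
exists t => [v|x].
  rewrite mem_cat => /orP[|/allpairsP[[p m] /= [pP mN ->]]].
    by rewrite mem_filter => /andP[_]; left.
  move: pP mN; rewrite !mem_filter => /andP[pv pin] /andP[qv qin]; right.
  by exists (dotv g p), (- dotv g m), p, m; rewrite oppr_ge0.
split.
  move=> xt; split.
    apply: cone_sub xt => v; rewrite mem_cat => /orP[|/allpairsP[[p m] /= [pP mN ->]]].
      by rewrite mem_filter => /andP[_ /cone_mem].
    move: pP mN; rewrite !mem_filter => /andP[pv pin] /andP[qv qin].
    by apply: coneD; apply: coneZ; rewrite ?oppr_ge0 // ?ltW //; apply: cone_mem.
  apply: (cone_min (conic_halfspace g)) xt => v /=.
  rewrite mem_cat => /orP[|/allpairsP[[p m] /= [_ _ ->]]].
    by rewrite mem_filter => /andP[].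
  by rewrite dotvDr !dotvZr; lra.
move=> [xs gx].
have {}xs : cone (sp ++ sm) x.
  apply: cone_sub xs => v vs; apply: cone_mem; rewrite mem_cat !mem_filter vs !andbT.
  by rewrite orbC; case: leP.
have [p [m [psp msm xpm]]] := (iffLR (cone_cat _ _ _)) xs.
have mt : cone t m by apply: cone_sub msm => v vs; apply: cone_mem; rewrite mem_cat vs.
have gm : dotv g m <= 0.
  by apply: (cone_min (conic_halfspace g)) msm => v; rewrite mem_filter => /andP[].
(* The second half holds because the generators in [sp] are strictly positive; it disposes of the
   case [dotv g m = 0], where [p] must vanish. *)
have [gp gp0] : 0 <= dotv g p /\ (dotv g p = 0 -> p = 0).
  apply: (@cone_min sp [set q | 0 <= dotv g q /\ (dotv g q = 0 -> q = 0)]) psp.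
    split=> /= [|y z [y0 y1] [z0 z1]|a y a0 [y0 y1]].
    - by rewrite dotv0r.
    - rewrite dotvDr; split=> [|e]; first exact: addr_ge0.
      have ey : dotv g y = 0 by lra.
      have ez : dotv g z = 0 by lra.
      by rewrite (y1 ey) (z1 ez) addr0.
    - rewrite dotvZr; split=> [|/eqP]; first exact: mulr_ge0.
      by rewrite mulf_eq0 => /orP[/eqP ->|/eqP /y1 ->]; rewrite ?scale0r ?scaler0.
  move=> v; rewrite mem_filter => /andP[gv _] /=; split; first exact: ltW.
  by move=> e; rewrite e ltxx in gv.
(* The expression is bilinear in [(p, m)], so it suffices to check it on generators, one argument at
   a time. *)
have bil : cone t (dotv g p *: m + (- dotv g m) *: p).
  apply: (@cone_min sp [set q | cone t (dotv g q *: m + (- dotv g m) *: q)]) psp.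
    split=> /= [|y z hy hz|a y a0 hy].
    - by rewrite dotv0r scale0r scaler0 addr0; apply: cone0.
    - by rewrite dotvDr scalerDl scalerDr addrACA; apply: coneD.
    - rewrite dotvZr -scalerA [X in _ + X]scalerA (mulrC _ a) -scalerA -scalerDr.
      exact: coneZ.
  move=> q qsp.
  apply: (@cone_min sm [set w | cone t (dotv g q *: w + (- dotv g w) *: q)]) msm.
    split=> /= [|y z hy hz|a y a0 hy].
    - by rewrite dotv0r oppr0 scale0r scaler0 addr0; apply: cone0.
    - by rewrite dotvDr opprD scalerDl scalerDr addrACA; apply: coneD.
    - rewrite dotvZr -mulrN -scalerA [X in X + _]scalerA (mulrC _ a) -scalerA -scalerDr.
      exact: coneZ.
  move=> w wsm /=; apply: cone_mem; rewrite mem_cat; apply/orP; right.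
  by apply/allpairsP; exists (q, w).
rewrite xpm dotvDr in gx *.
have [gm0|gm0] := eqVneq (dotv g m) 0.
  have gp1 : dotv g p = 0 by lra.
  by rewrite (gp0 gp1) add0r.
have {}gm0 : 0 < - dotv g m by rewrite oppr_gt0 lt_neqAle gm0.
(* All of [p] is absorbed into the combination lying on the hyperplane; what is left of [m] has a
   nonnegative coefficient exactly because [dotv g (p + m) <= 0]. *)
have -> : p + m = (- dotv g m)^-1 *: (dotv g p *: m + (- dotv g m) *: p)
               + (1 - dotv g p / - dotv g m) *: m.
  rewrite scalerDr !scalerA mulVf ?gt_eqF // scale1r mulrC scalerBl scale1r.
  by rewrite addrAC [_ *: m + _]addrC subrK addrC.
apply: coneD; apply: coneZ => //; first by rewrite invr_ge0 ltW.
by rewrite subr_ge0 ler_pdivrMr // mul1r; lra.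
Qed.

End Cones.

End ConvexHulls.

(** * Polytopes as slices of cones *)

Section Polytopes.
Variable R : realType.

Section Homogenization.
Variable n : nat.
Implicit Types (x y v g : 'cV[R]_n) (z : 'cV[R]_n.+1).

Definition tail_cV z : 'cV[R]_n := \col_i z (lift ord0 i) 0.

Lemma cons_cV_tail z : cons_cV (z 0 0) (tail_cV z) = z.
Proof.
by apply/colP => i; rewrite mxE; case: unliftP => [j ->|->]; rewrite ?mxE.
Qed.

Lemma cons_cV0 (a : R) x : cons_cV a x 0 0 = a.
Proof. by rewrite mxE unlift_none. Qed.

Lemma cons_cV_lift (a : R) x i : cons_cV a x (lift ord0 i) 0 = x i 0.
Proof. by rewrite mxE liftK. Qed.

Lemma tail_cons_cV (a : R) x : tail_cV (cons_cV a x) = x.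
Proof. by apply/colP => i; rewrite mxE cons_cV_lift. Qed.

Lemma cons_cV_inj (a b : R) x y : cons_cV a x = cons_cV b y -> a = b /\ x = y.
Proof.
move=> e; split; first by rewrite -(cons_cV0 a x) e cons_cV0.
by rewrite -(tail_cons_cV a x) e tail_cons_cV.
Qed.

Lemma cons_cVD (a b : R) x y : cons_cV a x + cons_cV b y = cons_cV (a + b) (x + y).
Proof. by apply/colP => i; rewrite !mxE; case: unliftP => [j _|_]; rewrite ?mxE. Qed.

Lemma cons_cVZ (a b : R) x : a *: cons_cV b x = cons_cV (a * b) (a *: x).
Proof. by apply/colP => i; rewrite !mxE; case: unliftP => [j _|_]; rewrite ?mxE. Qed.

Lemma cons_cVB (a b : R) x y : cons_cV a x - cons_cV b y = cons_cV (a - b) (x - y).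
Proof. by rewrite -!(scaleN1r (cons_cV _ _)) cons_cVZ cons_cVD !scaleN1r mulN1r. Qed.

Lemma cons_cV00 : cons_cV 0 (0 : 'cV[R]_n) = 0.
Proof. by rewrite -(scale0r (cons_cV 0 0)) cons_cVZ scaler0 mul0r. Qed.

Lemma dotv_cons (a b : R) x y : dotv (cons_cV a x) (cons_cV b y) = a * b + dotv x y.
Proof.
rewrite /dotv big_ord_recl !cons_cV0; congr (_ + _).
by apply: eq_bigr => i _; rewrite !cons_cV_lift.
Qed.

Lemma cone_weights (s : seq 'cV[R]_n) x : cone s x <->
  exists2 w : 'I_(size s) -> R, (forall i, 0 <= w i) &
    x = \sum_(i < size s) w i *: s`_i.
Proof.
elim: s x => [|v s ih] x /=.
  split=> [->|[w _]]; last by rewrite big_ord0.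
  by exists (fun=> 0); rewrite // big_ord0.
split=> [[a a0 /ih[w w0 e]]|[w w0 ->]].
  exists (fun i => if unlift ord0 i is Some j then w j else a).
    by move=> i; case: unliftP.
  rewrite big_ord_recl unlift_none /=.
  under eq_bigr => i _ do rewrite liftK.
  by rewrite -e addrC subrK.
exists (w ord0); first exact: w0.
apply/ih; exists (w \o lift ord0) => [i|]; first exact: w0.
by rewrite big_ord_recl /= addrC addKr.
Qed.

End Homogenization.

Section Hulls.
Variable n : nat.
Implicit Types (x y v g : 'cV[R]_n) (s : seq 'cV[R]_n).

(** The first coordinate of the lifted combination is the sum of the weights, so height 1 encodes
    their normalization. *)
Lemma conv_hullE s x : conv_hull s x <-> cone (map (cons_cV 1) s) (cons_cV 1 x).
Proof.
rewrite cone_weights /conv_hull /=.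
have sumE m (w : 'I_m -> R) : (m <= size s)%N ->
    \sum_(i < m) w i *: (map (cons_cV 1) s)`_i
    = cons_cV (\sum_(i < m) w i) (\sum_(i < m) w i *: s`_i).
  move=> ms; elim/big_ind3: _ => [|a b c a1 b1 c1 -> ->|i _].
  - by rewrite cons_cV00.
  - by rewrite cons_cVD.
  - by rewrite (nth_map 0) ?(leq_trans _ ms) // cons_cVZ mulr1.
rewrite size_map; split=> [[w [w0 [w1 ->]]]|[w w0]].
  by exists w => //; rewrite sumE // w1.
by rewrite sumE // => /cons_cV_inj[w1 ->]; exists w.
Qed.

Lemma conv_hull_mem s v : v \in s -> conv_hull s v.
Proof. by move=> vs; apply/conv_hullE/cone_mem/map_f. Qed.

Lemma conv_hull_convex s : convex (conv_hull s).
Proof.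
move=> x y t t0 t1 /conv_hullE xs /conv_hullE ys; apply/conv_hullE.
have -> : cons_cV 1 ((1 - t) *: x + t *: y)
    = (1 - t) *: cons_cV 1 x + t *: cons_cV 1 y.
  by rewrite !cons_cVZ cons_cVD !mulr1 subrK.
by apply: coneD; apply: coneZ; rewrite // subr_ge0.
Qed.

Lemma conv_hull_min s (C : set 'cV[R]_n) : convex C ->
  (forall v, v \in s -> C v) -> conv_hull s `<=` C.
Proof.
move=> convC sC x /conv_hullE xs.
(* The cone over [C]; the alternative [a = 0] provides the apex without requiring a point of [C]. *)
pose K := [set z | exists a y, [/\ 0 <= a, a = 0 \/ C y & z = cons_cV a (a *: y)]].
suff : K (cons_cV 1 x) by case=> a [y [_ [->|Cy] /cons_cV_inj[a1 ->]]]; [lra|rewrite -a1 scale1r].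
apply: cone_min xs => [|_ /mapP[v vs ->]]; last first.
  by exists 1, v; split; [|right; apply: sC|rewrite scale1r].
split=> [|_ _ [a [y [a0 ay ->]]] [b [z [b0 bz ->]]]|c _ c0 [a [y [a0 ay ->]]]].
- by exists 0, 0; split; [|left|rewrite scaler0 cons_cV00].
- rewrite cons_cVD.
  have [a0'|an0] := eqVneq a 0.
    by exists b, z; split=> //; rewrite a0' add0r scale0r add0r.
  have [b0'|bn0] := eqVneq b 0.
    by exists a, y; split=> //; rewrite b0' addr0 scale0r addr0.
  have ab : a + b != 0 by rewrite paddr_eq0 // (negbTE an0).
  have ab0 : 0 < a + b by rewrite lt_neqAle eq_sym ab addr_ge0.
  exists (a + b), ((1 - b / (a + b)) *: y + (b / (a + b)) *: z); split.
  + exact: addr_ge0.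
  + case: ay => [e|Cy]; first by rewrite e eqxx in an0.
    case: bz => [e|Cz]; first by rewrite e eqxx in bn0.
    right; apply: convC => //; first by rewrite divr_ge0 // ltW.
    by rewrite ler_pdivrMr // mul1r lerDr.
  + rewrite scalerDr !scalerA mulrBr mulr1 [_ * (b / _)]mulrC divfK //.
    by rewrite addrK.
- exists (c * a), y; rewrite cons_cVZ scalerA; split=> //; first exact: mulr_ge0.
  by case: ay => [->|]; [left; rewrite mulr0|right].
Qed.

Lemma convex_halfspace g (b : R) : convex [set y | dotv g y <= b].
Proof. by move=> x y t t0 t1 /= gx gy; rewrite dotvDr !dotvZr; nra. Qed.

Lemma conv_hull_bounded s g : exists M : R, forall x, conv_hull s x -> dotv g x <= M.
Proof.
exists (\big[Num.max/0]_(v <- s) dotv g v); apply: conv_hull_min.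
  exact: convex_halfspace.
move=> v /=; elim: s => // u s ih; rewrite inE big_cons le_max.
by move=> /orP[/eqP ->|/ih ->]; rewrite ?lexx ?orbT.
Qed.

Lemma conv_hull_eq_mem s t : s =i t -> conv_hull s = conv_hull t.
Proof.
move=> st; apply/seteqP; split; apply: conv_hull_min; try exact: conv_hull_convex.
  by move=> v vs; apply: conv_hull_mem; rewrite -st.
by move=> v vs; apply: conv_hull_mem; rewrite st.
Qed.

End Hulls.

Lemma conv_hull_image n m (A : 'M[R]_(m, n)) (s : seq 'cV[R]_n) :
  (fun y => A *m y) @` conv_hull s = conv_hull (map (mulmx A) s).
Proof.
apply/seteqP; split=> [_ /= [y ys <-]|].
  pose C := [set y | conv_hull (map (mulmx A) s) (A *m y)].
  apply: (@conv_hull_min _ s C) ys => [x z t t0 t1 /= Cx Cz|v vs].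
    by rewrite /C /= mulmxDr -!scalemxAr; apply: conv_hull_convex.
  exact/conv_hull_mem/map_f.
apply: conv_hull_min => [_ _ t t0 t1 [x xs <-] [y ys <-]|_ /mapP[v vs ->]].
  exists ((1 - t) *: x + t *: y); first exact: conv_hull_convex.
  by rewrite mulmxDr -!scalemxAr.
by exists v => //; apply: conv_hull_mem.
Qed.

Section Polytopes.
Variable n : nat.
Implicit Types (x y v g : 'cV[R]_n) (s : seq 'cV[R]_n) (P : set 'cV[R]_n).

Lemma polytope_o_image (A : 'M[R]_n) P : polytope_o P ->
  polytope_o ((fun y => A *m y) @` P).
Proof.
move=> [[s ->] P0]; split; first by exists (map (mulmx A) s); rewrite conv_hull_image.
by exists 0 => //; rewrite mulmx0.
Qed.

(** The halfspaces of the lifted cone, restricted to height 1: the height coefficient moves to the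
    right-hand side, which is nonnegative because the origin satisfies the inequality. *)
Lemma polytope_o_halfspaces P : polytope_o P -> exists2 hs : seq ('cV[R]_n * R),
  (forall h, h \in hs -> 0 <= h.2) &
  P = [set y | forall h, h \in hs -> dotv h.1 y <= h.2].
Proof.
move=> [[s e] P0]; have [hs hsE] := cone_halfspaces (map (cons_cV 1) s).
pose ks := [seq (tail_cV h, - h 0 0) | h <- hs].
have PE y : P y <-> forall h, h \in ks -> dotv h.1 y <= h.2.
  rewrite e conv_hullE hsE; split=> [H _ /mapP[h hin ->] /=|H h hin].
    by have := H _ hin; rewrite -[in dotv h _](cons_cV_tail h) dotv_cons mulr1; lra.
  have := H _ (map_f _ hin); rewrite -[in dotv h _](cons_cV_tail h) dotv_cons mulr1 /=; lra.
exists ks; last by apply/seteqP; split=> y /PE.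
by move=> h hin; have := (PE 0).1 P0 _ hin; rewrite dotv0r.
Qed.

Definition halfspace g : set 'cV[R]_n := [set y | dotv g y <= 0].

(** Cut the cone over [P] by [(0, g)] and rescale the new generators back to height 1. This is
    possible because each of them has positive height, as the form given by [cone_cut] shows. *)
Lemma polytope_o_half P g : polytope_o P -> polytope_o (P `&` halfspace g).
Proof.
move=> [[s e] P0]; split; last by split=> //; rewrite /halfspace /= dotv0r.
have [t tg tE] := cone_cut (map (cons_cV 1) s) (cons_cV 0 g).
have tpos (v : 'cV[R]_n.+1) : v \in t -> 0 < v 0 0.
  move=> /tg[/mapP[u _ ->]|[a [b [_ [_ [a0 b0 /mapP[u _ ->] /mapP[w _ ->] ->]]]]]].
    by rewrite cons_cV0.
  by rewrite !cons_cVZ cons_cVD cons_cV0 !mulr1 ltr_wpDr.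
pose slice (z : 'cV[R]_n.+1) := (z 0 0)^-1 *: tail_cV z.
exists (map slice t).
suff H x : (P `&` halfspace g) x <-> conv_hull (map slice t) x.
  by apply/seteqP; split=> x /H.
rewrite conv_hullE /halfspace /setI /= e conv_hullE.
have <- : dotv (cons_cV 0 g) (cons_cV 1 x) = dotv g x by rewrite dotv_cons mul0r add0r.
rewrite -tE; split; apply: cone_sub.
  move=> z zt; have z0 := tpos _ zt.
  have -> : z = z 0 0 *: cons_cV 1 (slice z).
    by rewrite cons_cVZ mulr1 scalerA mulfV ?lt0r_neq0 // scale1r cons_cV_tail.
  by apply: coneZ; [exact: ltW|apply/cone_mem/map_f/map_f].
move=> _ /mapP[_ /mapP[z zt ->] ->]; have z0 := tpos _ zt.
have -> : cons_cV 1 (slice z) = (z 0 0)^-1 *: cons_cV (z 0 0) (tail_cV z).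
  by rewrite cons_cVZ mulVf ?lt0r_neq0.
rewrite cons_cV_tail.
by apply: coneZ; [rewrite invr_ge0 ltW|exact: cone_mem].
Qed.

Lemma polytope_o_ray P u : polytope_o P -> (forall t : R, 0 <= t -> P (t *: u)) -> u = 0.
Proof.
move=> [[s ->] _] h; have [M hM] := conv_hull_bounded s u.
apply: dotv_self_eq0; apply/eqP; apply: contraT => uu.
have {}uu : 0 < dotv u u.
  by rewrite lt_neqAle eq_sym uu sumr_ge0 // => i _; rewrite -expr2 sqr_ge0.
have M0 : 0 <= M by have := hM _ (h 0 (lexx _)); rewrite scale0r dotv0r.
have := hM _ (h ((M + 1) / dotv u u) _); rewrite dotvZr divfK ?gt_eqF // => H.
have : M + 1 <= M by apply: H; rewrite divr_ge0 ?ltW //; lra.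
lra.
Qed.

End Polytopes.

End Polytopes.

(** * Simplices and dissection of polytopes *)

Section Simplices.
Variables (R : realType) (n : nat).
Implicit Types (x y v g u : 'cV[R]_n) (s : seq 'cV[R]_n) (P : set 'cV[R]_n).

Definition simplex s : set 'cV[R]_n := conv_hull (0 :: s).

Lemma polytope_o_simplex s : polytope_o (simplex s).
Proof. by split; [exists (0 :: s)|apply: conv_hull_mem; rewrite inE eqxx]. Qed.

Lemma simplex_eq_mem s t : s =i t -> simplex s = simplex t.
Proof. by move=> st; apply: conv_hull_eq_mem => x; rewrite !inE st. Qed.

Lemma simplex_image (A : 'M[R]_n) s :
  (fun y => A *m y) @` simplex s = simplex (map (mulmx A) s).
Proof. by rewrite conv_hull_image /= mulmx0. Qed.

Lemma simplex_mem s v : v \in s -> simplex s v.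
Proof. by move=> vs; apply: conv_hull_mem; rewrite inE vs orbT. Qed.

Lemma simplex0 s : simplex s 0.
Proof. by apply: conv_hull_mem; rewrite inE eqxx. Qed.

Lemma simplex_min s (C : set 'cV[R]_n) : convex C -> C 0 ->
  (forall v, v \in s -> C v) -> simplex s `<=` C.
Proof. by move=> cC C0 sC; apply: conv_hull_min => // v; rewrite inE => /orP[/eqP ->|/sC]. Qed.

Lemma simplex_sub s t : (forall v, v \in s -> simplex t v) -> simplex s `<=` simplex t.
Proof. by apply: simplex_min; [exact: conv_hull_convex|exact: simplex0]. Qed.

(** If [x] has coefficients [c], [d] on [v1], [v2], remove as many copies of [a *: v1 + b *: v2] as
    the smaller of [c / a] and [d / b]: one of the two vectors disappears, and the removed copies
    lie in [cone s]. *)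
Lemma cone_split (s : seq 'cV[R]_n) v1 v2 (a b : R) x : 0 < a -> 0 < b ->
  cone s (a *: v1 + b *: v2) -> cone [:: v1, v2 & s] x ->
  cone (v1 :: s) x \/ cone (v2 :: s) x.
Proof.
move=> a0 b0 w [c c0 [d d0 h]].
have [le|/ltW le] := leP (d * a) (c * b).
  left; exists (c - d * a / b); first by rewrite subr_ge0 ler_pdivrMr.
  have -> : x - (c - d * a / b) *: v1
      = (x - c *: v1 - d *: v2) + (d / b) *: (a *: v1 + b *: v2).
    by apply/colP => i; rewrite !mxE; field; rewrite gt_eqF.
  by apply: coneD => //; apply: coneZ => //; rewrite divr_ge0 // ltW.
right; exists (d - c * b / a); first by rewrite subr_ge0 ler_pdivrMr.
have -> : x - (d - c * b / a) *: v2
    = (x - c *: v1 - d *: v2) + (c / a) *: (a *: v1 + b *: v2).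
  by apply/colP => i; rewrite !mxE; field; rewrite gt_eqF.
by apply: coneD => //; apply: coneZ => //; rewrite divr_ge0 // ltW.
Qed.

End Simplices.

Section SimplexCut.
Variables (R : realType) (n : nat).
Implicit Types (x y v g u : 'cV[R]_n) (s : seq 'cV[R]_n) (P : set 'cV[R]_n).

Lemma simplexE s x : simplex s x <->
  cone (cons_cV 1 0 :: map (cons_cV 1) s) (cons_cV 1 x).
Proof. by rewrite /simplex conv_hullE. Qed.

Section TwoSimplices.
Variables (s : seq 'cV[R]_n) (v1 v2 : 'cV[R]_n) (l : R).
Hypotheses (l0 : 0 < l) (l1 : l < 1).
Hypothesis ws : simplex s ((1 - l) *: v1 + l *: v2).

Lemma simplex_cutU : simplex (v1 :: s) `|` simplex (v2 :: s) = simplex [:: v1, v2 & s].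
Proof.
apply/seteqP; split=> x.
  by case; apply: simplex_sub => v vs; apply: simplex_mem; move: vs; rewrite !inE;
    case/orP=> ->; rewrite ?orbT.
have E t y : cone (map (cons_cV 1) t ++ [:: cons_cV 1 (0 : 'cV[R]_n)]) (cons_cV 1 y) <-> simplex t y.
  by rewrite simplexE; split; apply: cone_sub => v vs; apply: cone_mem;
    move: vs; rewrite inE mem_cat mem_seq1 orbC.
rewrite -(E [:: v1, v2 & s]) => /= /cone_split h.
have : cone (map (cons_cV 1) s ++ [:: cons_cV 1 0])
    ((1 - l) *: cons_cV 1 v1 + l *: cons_cV 1 v2).
  by rewrite !cons_cVZ cons_cVD !mulr1 subrK E.
by move=> /h; rewrite subr_gt0 -(E (v1 :: s)) -(E (v2 :: s)) => /(_ l1 l0).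
Qed.

(** Evaluate [g] on a common point: with coefficient [a] on [v1] and [b] on [v2], it equals both
    [a * dotv g v1 <= 0] and [b * dotv g v2 >= 0], so [a] vanishes. *)
Lemma simplex_cutI g : dotv g v1 < 0 -> 0 < dotv g v2 ->
  (forall v, v \in s -> dotv g v = 0) ->
  simplex (v1 :: s) `&` simplex (v2 :: s) = simplex s.
Proof.
move=> g1 g2 gs; apply/seteqP; split=> x; last first.
  by move=> sx; split; apply: simplex_sub sx => v vs; apply: simplex_mem; rewrite inE vs orbT.
have E t y : cone (map (cons_cV 1) t ++ [:: cons_cV 1 (0 : 'cV[R]_n)]) (cons_cV 1 y) <-> simplex t y.
  by rewrite simplexE; split; apply: cone_sub => v vs; apply: cone_mem;
    move: vs; rewrite inE mem_cat mem_seq1 orbC.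
rewrite /setI /= -(E (v1 :: s)) -(E (v2 :: s)) -(E s) /=.
set S := _ ++ _ => -[[a a0 ha] [b b0 hb]].
have Sg (z : 'cV[R]_n.+1) : cone S z -> dotv (cons_cV 0 g) z <= 0 /\ dotv (cons_cV 0 (- g)) z <= 0.
  move=> h; split; apply: (cone_min (conic_halfspace _)) h => w;
    rewrite mem_cat mem_seq1 => /orP[/mapP[v vs ->]|/eqP ->];
    by rewrite /= dotv_cons ?dotvNl ?dotv0r ?gs // mul0r addr0 ?oppr0.
have [] := Sg _ ha; have [] := Sg _ hb.
rewrite !cons_cVZ !cons_cVB !dotv_cons !mul0r !add0r !dotvNl !dotvDr !dotvNr !dotvZr => h1 h2 h3 h4.
have a1 : a = 0.
  apply/eqP; rewrite eq_le a0 andbT leNgt; apply/negP => ap.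
  have : a * dotv g v1 < 0 by rewrite pmulr_rlt0.
  have : 0 <= b * dotv g v2 by rewrite mulr_ge0 // ltW.
  lra.
by move: ha; rewrite a1 scale0r subr0.
Qed.

End TwoSimplices.
End SimplexCut.

(** * From vanishing on simplices to vanishing on polytopes *)

Section Decomposition.
Variables (R : realType) (n : nat).
Implicit Types (x y v g u f : 'cV[R]_n) (s gs hs fs : seq 'cV[R]_n) (P : set 'cV[R]_n).
Implicit Type pr : seq ('cV[R]_n * 'cV[R]_n).

(** Inequalities whose boundary misses the origin are normalized to right-hand side 1 and kept apart
    from the homogeneous ones, since the two kinds are eliminated by different inductions. *)
Definition hpoly fs gs : set 'cV[R]_n :=
  [set y | (forall f, f \in fs -> dotv f y <= 1) /\ (forall g, g \in gs -> dotv g y <= 0)].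

Lemma eq_hpoly fs gs hs : gs =i hs -> hpoly fs gs = hpoly fs hs.
Proof.
by move=> e; apply/seteqP; split=> y [h1 h2]; split=> // g ig; apply: h2; rewrite ?e -?e // e.
Qed.

Lemma hpoly_half fs gs g : hpoly fs gs `&` halfspace g = hpoly fs (g :: gs).
Proof.
apply/seteqP; split=> [y [[h1 h2] h3]|y [h1 h2]]; split=> //.
- by move=> h; rewrite inE => /orP[/eqP ->|/h2].
- by split=> // h hg; apply: h2; rewrite inE hg orbT.
- by apply: h2; rewrite inE eqxx.
Qed.

Lemma convex_hpoly fs gs : convex (hpoly fs gs).
Proof.
move=> x y t t0 t1 [x1 x2] [y1 y2]; split=> f ff; apply: convex_halfspace => //=; auto.
Qed.

(* [dual pr]: the functionals [q.2] are minus the dual basis of the [q.1]. *)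
Fixpoint dual pr : Prop := if pr is (u, g) :: pr' then
  [/\ dotv g u = -1, forall q, q \in pr' -> dotv g q.1 = 0 /\ dotv q.2 u = 0 & dual pr']
  else True.

Lemma dual_free pr (c : 'cV[R]_n -> R) : (forall q, q \in pr -> c q.1 != 0) ->
  dual pr -> free [seq c q.1 *: q.1 | q <- pr].
Proof.
elim: pr => [|[u g] pr ih] c0 /=; first by rewrite nil_free.
move=> [gu gp dp]; rewrite free_cons ih //; last by move=> q qp; apply: c0; rewrite inE qp orbT.
rewrite andbT; apply/negP => h; have e := @coord_span _ _ _ (in_tuple _) _ h.
have : dotv g (c u *: u) = 0.
  rewrite e dotv_sumr big1 // => i _; rewrite dotvZr.
  have /mapP[q qp ->] := mem_nth 0 (ltn_ord i).
  by rewrite dotvZr (gp _ qp).1 !mulr0.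
by rewrite dotvZr gu mulrN1 => /eqP; rewrite oppr_eq0 (negbTE (c0 (u, g) (mem_head _ _))).
Qed.

(** Biorthogonal projection, one pair at a time; the signs come from [dotv q.2 q.1 = -1]. *)
Lemma dual_coord pr x : dual pr ->
  exists y, [/\ forall q, q \in pr -> dotv q.2 y = 0,
    x = y + \sum_(q <- pr) (- dotv q.2 x) *: q.1 &
    forall h, (forall q, q \in pr -> dotv h q.1 = 0) -> dotv h y = dotv h x].
Proof.
elim: pr => [|[u g] pr ih] /=; first by exists x; split=> //; rewrite big_nil addr0.
move=> [gu gp dp]; have [y [y1 y2 y3]] := ih dp.
exists (y + dotv g x *: u); split=> [q||h hh].
- rewrite inE dotvDr dotvZr => /orP[/eqP -> /=|qp].
    by rewrite gu y3 ?mulrN1 ?subrr // => q' /gp[].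
  by rewrite (gp _ qp).2 y1 // mulr0 addr0.
- by rewrite big_cons /= addrA scaleNr addrK.
- rewrite dotvDr dotvZr (hh (u, g) (mem_head _ _)) mulr0 addr0 y3 // => q qp.
  by apply: hh; rewrite inE qp orbT.
Qed.

Lemma dual_diag pr q q' : dual pr -> q \in pr -> q' \in pr -> dotv q.2 q'.1 <= 0.
Proof.
elim: pr => [//|[u g] pr ih] /= [gu gp dp].
rewrite !inE => /orP[/eqP -> /=|qp] /orP[/eqP -> /=|qp']; last exact: ih.
- by rewrite gu lerN10.
- by rewrite (gp _ qp').1.
- by rewrite (gp _ qp).2.
Qed.

Lemma free_size s : free s -> (size s <= n)%N.
Proof.
move=> /eqP <-; apply: leq_trans (dimvS (subvf _)) _.
by rewrite dimvf /dim /= muln1.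
Qed.

Variable Z : set 'cV[R]_n -> R.
Hypothesis Z_cut : forall P g, polytope_o P -> Z (P `&` halfspace g) = 0 ->
  Z (P `&` halfspace (- g)) = 0 -> Z (P `&` halfspace g `&` halfspace (- g)) = 0 -> Z P = 0.
Hypothesis Z_simplex : forall s, free s -> Z (simplex s) = 0.

(** On the side where [h1 - h2 <= 0], the inequality for [h1] follows from that for [h2]; this is
    the gain of cutting along differences. *)
Lemma hpoly_drop fs (h1 h2 : 'cV[R]_n) gs :
  hpoly fs [:: h1, h2, h1 - h2 & gs] = hpoly fs [:: h2, h1 - h2 & gs].
Proof.
apply/seteqP; split=> y [y1 y2]; split=> // g.
  by move=> hg; apply: y2; rewrite inE hg orbT.
rewrite inE => /orP[/eqP ->|]; last exact: y2.
have := y2 _ (mem_head _ _); have := y2 (h1 - h2).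
by rewrite !inE eqxx orbT => /(_ isT); rewrite dotvDl dotvNl; lra.
Qed.

(** By the last hypothesis nothing of the cone is left after projecting along [pr], so it is spanned
    by the vectors [q.1]. Boundedness makes [f] positive on them, and the vertices are their
    multiples with [f = 1]. *)
Lemma hpoly_simplex f pr hs : dual pr ->
  (forall h q, h \in hs -> q \in pr -> dotv h q.1 = 0) ->
  (forall u, (forall g, g \in map snd pr ++ hs -> dotv g u <= 0) -> dotv f u <= 0 -> u = 0) ->
  (forall u, (forall q, q \in pr -> dotv q.2 u = 0) ->
     (forall h, h \in hs -> dotv h u <= 0) -> u = 0) ->
  exists2 s, free s & hpoly [:: f] (map snd pr ++ hs) = simplex s.
Proof.
move=> dp hp fpos D0.
have uC q : q \in pr -> forall g, g \in map snd pr ++ hs -> dotv g q.1 <= 0.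
  move=> qp g; rewrite mem_cat => /orP[/mapP[q' qp' ->]|hg]; first exact: (dual_diag dp).
  by rewrite hp.
have un0 q : q \in pr -> q.1 != 0.
  elim: (pr) dp => [//|[u g] r ih] /= [gu gp dr]; rewrite inE => /orP[/eqP -> /=|]; last exact: ih.
  by apply/eqP => u0; move: gu; rewrite u0 dotv0r => /eqP; rewrite eq_sym oppr_eq0 oner_eq0.
have fu q : q \in pr -> 0 < dotv f q.1.
  move=> qp; rewrite ltNge; apply/negP => /(fpos _ (uC _ qp)) /eqP.
  by rewrite (negbTE (un0 _ qp)).
exists [seq (dotv f q.1)^-1 *: q.1 | q <- pr].
  by apply: (@dual_free _ (fun u => (dotv f u)^-1)) => // q qp; rewrite invr_eq0 gt_eqF ?fu.
apply/seteqP; split.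
  move=> x [fx gx]; have [y [y1 y2 y3]] := dual_coord x dp.
  have y0 : y = 0.
    apply: D0 => // h hh; rewrite y3 => [|q qp]; last exact: hp.
    by apply: gx; rewrite mem_cat hh orbT.
  rewrite y0 add0r in y2.
  apply/simplexE.
  have -> : cons_cV 1 x = (1 - dotv f x) *: cons_cV 1 0 +
      \sum_(q <- pr) (- dotv q.2 x * dotv f q.1) *: cons_cV 1 ((dotv f q.1)^-1 *: q.1).
    have -> : \sum_(q <- pr) (- dotv q.2 x * dotv f q.1) *: cons_cV 1 ((dotv f q.1)^-1 *: q.1)
        = cons_cV (dotv f x) x.
      rewrite [in RHS]y2 dotv_sumr big_seq [in RHS]big_seq [X in cons_cV _ X]big_seq.
      elim/big_ind3: _ => [|a b c a1 b1 c1 -> ->|q qp]; first by rewrite cons_cV00.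
        by rewrite cons_cVD.
      by rewrite cons_cVZ mulr1 dotvZr scalerA mulfK ?gt_eqF ?fu.
    by rewrite cons_cVZ cons_cVD mulr1 subrK scaler0 add0r.
  apply: coneD.
    apply: coneZ; last by apply: cone_mem; rewrite mem_head.
    by rewrite subr_ge0 fx ?mem_head.
  rewrite big_seq; elim/big_rec: _ => [|q z qp zc]; first exact: cone0.
  apply: coneD => //; apply: coneZ.
    apply: mulr_ge0; last by rewrite ltW // fu.
    rewrite oppr_ge0; apply: gx.
    by rewrite mem_cat map_f.
  apply: cone_mem; rewrite inE; apply/orP; right; apply: map_f.
  exact: (map_f (fun q => (dotv f q.1)^-1 *: q.1)).
apply: simplex_min; first exact: convex_hpoly.
  by split=> g _; rewrite dotv0r.
move=> _ /mapP[q qp ->]; split=> g.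
  by rewrite mem_seq1 => /eqP ->; rewrite dotvZr mulVf // gt_eqF ?fu.
by move=> hg; rewrite dotvZr mulr_ge0_le0 //; [rewrite invr_ge0 ltW // fu|exact: uC].
Qed.

Local Ltac shuffle y h1 h2 pr :=
  case: (y == h1); case: (y == h2); case: (y \in map snd pr);
  case: (y == h1 - h2); rewrite ?orbT ?orbF //=;
  case: (y == - (h1 - h2)); case: (y == h2 - h1); rewrite ?orbT ?orbF.

(* Induction on the number n - size pr of directions not yet split off: for u in the recession
   cone of [hs] annihilated by [pr], rescale the functionals negative at u to be -1 there and cut along their
   differences; every piece carries a single such functional, dual to u. *)
Lemma Z_hpoly f pr hs : dual pr ->
  (forall h q, h \in hs -> q \in pr -> dotv h q.1 = 0) ->
  polytope_o (hpoly [:: f] (map snd pr ++ hs)) -> Z (hpoly [:: f] (map snd pr ++ hs)) = 0.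
Proof.
(* The strict bound makes the base case contradictory: [m = 0] would mean more than [n] free
   vectors. *)
have [m] : {m | (n < m + size pr)%N} by exists n.+1; lia.
elim: m pr hs => [|m ihm] pr hs.
  rewrite add0n => + dp; rewrite ltnNge -(size_map (fun q => 1 *: q.1) pr).
  by rewrite free_size // (@dual_free _ (fun=> 1)) // => q _; rewrite oner_neq0.
move=> nm dp hp.
have fpos hs' : polytope_o (hpoly [:: f] (map snd pr ++ hs')) ->
    forall u, (forall g, g \in map snd pr ++ hs' -> dotv g u <= 0) -> dotv f u <= 0 -> u = 0.
  move=> po u gu fu; apply: (polytope_o_ray po) => t t0; split=> g.
    rewrite mem_seq1 => /eqP ->; rewrite dotvZr (le_trans _ ler01) //.
    by rewrite mulr_ge0_le0.
  by move=> /gu gu'; rewrite dotvZr mulr_ge0_le0.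
have [[u [u0 uq uh]]|nou] := pselect (exists u, [/\ u != 0,
    forall q, q \in pr -> dotv q.2 u = 0 & forall h, h \in hs -> dotv h u <= 0]); last first.
  move=> po; have [|s fs ->] := hpoly_simplex dp hp (fpos _ po); last exact: Z_simplex.
  by move=> u uq uh; apply/eqP; apply: contraT => u0; exfalso; apply: nou; exists u.
pose norm h := (- dotv h u)^-1 *: h.
pose hA := [seq norm h | h <- hs & dotv h u < 0].
pose hB := [seq h <- hs | dotv h u == 0].
have -> : hpoly [:: f] (map snd pr ++ hs) = hpoly [:: f] (map snd pr ++ hA ++ hB).
  apply/seteqP; split=> y [y1 y2]; split=> // g; rewrite !mem_cat.
    move=> /orP[gp|/orP[/mapP[h + ->]|]].
    - by apply: y2; rewrite mem_cat gp.
    - rewrite mem_filter => /andP[hu hh]; rewrite dotvZl mulr_ge0_le0 //.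
        by rewrite invr_ge0 oppr_ge0 ltW.
      by apply: y2; rewrite mem_cat hh orbT.
    - by rewrite mem_filter => /andP[_ hh]; apply: y2; rewrite mem_cat hh orbT.
  move=> /orP[gp|hg]; first by apply: y2; rewrite mem_cat gp.
  have := uh _ hg; rewrite le_eqVlt => /orP[gu|gu].
    by apply: y2; rewrite !mem_cat mem_filter gu hg !orbT.
  have : dotv (norm g) y <= 0.
    apply: y2; rewrite !mem_cat; apply/orP; right; apply/orP; left.
    by apply: map_f; rewrite mem_filter gu.
  by rewrite dotvZl pmulr_rle0 // invr_gt0 oppr_gt0.
have : forall h, h \in hB -> dotv h u = 0 /\ forall q, q \in pr -> dotv h q.1 = 0.
  move=> h; rewrite mem_filter => /andP[/eqP -> hh]; split=> // q; exact: hp.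
have : forall h, h \in hA -> dotv h u = -1 /\ forall q, q \in pr -> dotv h q.1 = 0.
  move=> _ /mapP[h + ->]; rewrite mem_filter => /andP[hu hh]; split=> [|q qp].
    by rewrite dotvZl invrN mulNr mulVf // lt_eqF.
  by rewrite dotvZl hp // mulr0.
have [k] : {k | (size hA <= k)%N} by exists (size hA).
(* If all homogeneous functionals vanish at [u], then [u] and [- u] are both recession directions of
   the cone, and [f] is nonpositive at one of them: the polytope would contain a ray. *)
have ray hB' : (forall h, h \in hB' -> dotv h u = 0) ->
    polytope_o (hpoly [:: f] (map snd pr ++ hB')) -> False.
  move=> hBu po; have uC g : g \in map snd pr ++ hB' -> dotv g u = 0.
    by rewrite mem_cat => /orP[/mapP[q /uq + ->]|/hBu].
  have fu : 0 < dotv f u.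
    rewrite ltNge; apply/negP => /(fpos _ po) h.
    by move/eqP: u0; apply; apply: h => g /uC ->.
  move/eqP: u0; apply; apply/eqP; rewrite -oppr_eq0; apply/eqP.
  apply: (fpos _ po) => [g /uC gu|]; first by rewrite dotvNr gu oppr0.
  by rewrite dotvNr oppr_le0 ltW.
elim: k hA hB => [|k ihk] [|h1 [|h2 r]] hB //= szA hAP hBP po.
- by case: (ray hB) => // h /hBP[].
- by case: (ray hB) => // h /hBP[].
(* A single functional is nonzero at [u]: the pair [(u, h1)] joins the dual system and the outer
   induction applies. *)
- have [h1u h1p] := hAP h1 (mem_head _ _).
  have E : hpoly [:: f] (map snd pr ++ h1 :: hB) = hpoly [:: f] (map snd ((u, h1) :: pr) ++ hB).
    by apply: eq_hpoly => y /=; rewrite inE !mem_cat inE orbCA.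
  rewrite E; apply: ihm; rewrite -?E //=; first by rewrite -addSnnS.
    by split=> // q qp; rewrite h1p ?uq.
  move=> h q hh; rewrite inE => /orP[/eqP -> /=|]; first by case: (hBP _ hh).
  by case: (hBP _ hh) => _; apply.
(* Both functionals are -1 at [u], so their difference vanishes there and on [pr]. The cut therefore
   only enlarges [hB], while each piece loses [h1] or [h2] from [hA]. *)
- have hgP g : g \in h1 - h2 :: hB ->
      dotv g u = 0 /\ (forall q, q \in pr -> dotv g q.1 = 0).
    rewrite inE => /orP[/eqP ->|/hBP //].
    have [e1 e1'] := hAP h1 (mem_head _ _).
    have [e2 e2'] : dotv h2 u = -1 /\ forall q, q \in pr -> dotv h2 q.1 = 0.
      by apply: hAP; rewrite !inE eqxx orbT.
    split=> [|q qp]; rewrite dotvDl dotvNl ?e1 ?e2 ?subrr //.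
    by rewrite e1' // e2' // subrr.
  have hoP (g : 'cV[R]_n) : dotv g u = 0 /\ (forall q, q \in pr -> dotv g q.1 = 0) ->
      dotv (- g) u = 0 /\ (forall q, q \in pr -> dotv (- g) q.1 = 0).
    by move=> [e1 e2]; split=> [|q qp]; rewrite dotvNl ?e1 ?e2 ?oppr0.
  have piece (S : set 'cV[R]_n) h ex : h \in [:: h1; h2] ->
      (forall g, g \in ex -> g \in [:: h1 - h2; - (h1 - h2)]) ->
      S = hpoly [:: f] (map snd pr ++ (h :: r) ++ (ex ++ hB)) ->
      polytope_o S -> Z S = 0.
    move=> hh exP -> poS; apply: ihk => //.
      move=> g; rewrite inE => /orP[/eqP ->|gr]; apply: hAP.
        by move: hh; rewrite !inE => /orP[] ->; rewrite ?orbT.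
      by rewrite !inE gr !orbT.
    move=> g; rewrite mem_cat => /orP[/exP|/hBP //].
    have h12 := hgP _ (mem_head _ _).
    by rewrite !inE => /orP[/eqP ->|/eqP ->] //; apply: hoP.
  have b1 : h1 \in [:: h1; h2] by rewrite mem_head.
  have b2 : h2 \in [:: h1; h2] by rewrite !inE eqxx orbT.
  have drop12 hs' : hpoly [:: f] (h1 - h2 :: map snd pr ++ [:: h1, h2 & hs'])
      = hpoly [:: f] (map snd pr ++ (h2 :: (h1 - h2 :: hs'))).
    rewrite (@eq_hpoly _ _ [:: h1, h2, h1 - h2 & map snd pr ++ hs']).
      rewrite hpoly_drop; apply: eq_hpoly => y.
      by rewrite !(inE, mem_cat); shuffle y h1 h2 pr.
    by move=> y; rewrite !(inE, mem_cat); shuffle y h1 h2 pr.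
  have drop21 : hpoly [:: f] (- (h1 - h2) :: map snd pr ++ [:: h1, h2 & r ++ hB])
      = hpoly [:: f] (map snd pr ++ (h1 :: (- (h1 - h2) :: r ++ hB))).
    rewrite opprB (@eq_hpoly _ _ [:: h2, h1, h2 - h1 & map snd pr ++ r ++ hB]).
      rewrite hpoly_drop; apply: eq_hpoly => y.
      by rewrite !(inE, mem_cat); shuffle y h1 h2 pr.
    by move=> y; rewrite !(inE, mem_cat); shuffle y h1 h2 pr.
  apply: (Z_cut (g := h1 - h2)) => //.
  + apply: (piece _ h2 [:: h1 - h2]) => //; last exact: polytope_o_half.
      by move=> g; rewrite !inE => ->.
    rewrite hpoly_half drop12; apply: eq_hpoly => y.
    by rewrite !(inE, mem_cat); shuffle y h1 h2 pr.
  + apply: (piece _ h1 [:: - (h1 - h2)]) => //; last exact: polytope_o_half.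
      by move=> g; rewrite !inE => ->; rewrite orbT.
    rewrite hpoly_half drop21; apply: eq_hpoly => y.
    by rewrite !(inE, mem_cat); shuffle y h1 h2 pr.
  + apply: (piece _ h2 [:: h1 - h2; - (h1 - h2)]) => //; last by do 2!apply: polytope_o_half.
    rewrite hpoly_half drop12 hpoly_half; apply: eq_hpoly => y.
    by rewrite !(inE, mem_cat); shuffle y h1 h2 pr.
Qed.

(* Cutting along differences f1 - f2 leaves pieces with a single inequality f <= 1. *)
Lemma Z_polytope P : polytope_o P -> Z P = 0.
Proof.
move=> po; have [hs hs0 hsE] := polytope_o_halfspaces po.
have [fs [gs PE]] : exists fs gs, P = hpoly fs gs.
  exists [seq h.2^-1 *: h.1 | h <- hs & h.2 != 0], [seq h.1 | h <- hs & h.2 == 0].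
  rewrite hsE; apply/seteqP; split=> y.
    move=> H; split=> _ /mapP[h + ->]; rewrite mem_filter => /andP[h2 hin].
      have h20 : 0 < h.2 by rewrite lt_neqAle eq_sym h2 hs0.
      by rewrite dotvZl mulrC ler_pdivrMr // mul1r H.
    by rewrite -(eqP h2) H.
  move=> [H1 H2] h hin; have [h2|h2] := eqVneq h.2 0.
    by rewrite h2; apply: H2; apply: map_f; rewrite mem_filter h2 eqxx.
  have h20 : 0 < h.2 by rewrite lt_neqAle eq_sym h2 hs0.
  have := H1 (h.2^-1 *: h.1); rewrite dotvZl mulrC ler_pdivrMr // mul1r; apply.
  by apply: (map_f (fun h : 'cV[R]_n * R => h.2^-1 *: h.1)); rewrite mem_filter h2.
rewrite PE {hs hs0 hsE} in po *.
have [k] : {k | (size fs <= k)%N} by exists (size fs).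
elim: k fs gs po {PE} => [|k ihk] [|f1 [|f2 r]] gs po //=; rewrite ?ltnS => szf.
(* The trivial inequality [0 <= 1] supplies the functional [f] that [Z_hpoly] expects. *)
- have E : hpoly [::] gs = hpoly [:: 0] (map snd ([::] : seq ('cV[R]_n * 'cV[R]_n)) ++ gs).
    apply/seteqP; split=> y [y1 y2]; split=> // f.
    by rewrite mem_seq1 => /eqP ->; rewrite dotv0l.
  by rewrite E; apply: Z_hpoly; rewrite -?E.
- have E : hpoly [::] gs = hpoly [:: 0] (map snd ([::] : seq ('cV[R]_n * 'cV[R]_n)) ++ gs).
    apply/seteqP; split=> y [y1 y2]; split=> // f.
    by rewrite mem_seq1 => /eqP ->; rewrite dotv0l.
  by rewrite E; apply: Z_hpoly; rewrite -?E.
- exact: (@Z_hpoly f1 [::] gs).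
- have drop (g1 g2 : 'cV[R]_n) gs' : hpoly [:: g1, g2 & r] (g1 - g2 :: gs')
      = hpoly (g2 :: r) (g1 - g2 :: gs').
    apply/seteqP; split=> y [y1 y2]; split=> // g.
      by move=> hg; apply: y1; rewrite inE hg orbT.
    rewrite inE => /orP[/eqP ->|]; last exact: y1.
    have := y1 _ (mem_head _ _); have := y2 _ (mem_head _ _).
    by rewrite dotvDl dotvNl; lra.
  have swap gs' : hpoly [:: f1, f2 & r] gs' = hpoly [:: f2, f1 & r] gs'.
    by apply/seteqP; split=> y [y1 y2]; split=> // g hg; apply: y1; move: hg; rewrite !inE orbCA.
  have po1 := polytope_o_half (f1 - f2) po.
  have po2 := polytope_o_half (- (f1 - f2)) po.
  have po3 := polytope_o_half (- (f1 - f2)) po1.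
  move: po1 po2 po3; rewrite !hpoly_half opprB => po1 po2 po3.
  apply: (Z_cut (g := f1 - f2)) => //; rewrite !hpoly_half ?opprB.
  + by rewrite drop; apply: ihk => //; rewrite -drop.
  + by rewrite swap drop; apply: ihk => //; rewrite -drop -swap.
  + by rewrite swap drop; apply: ihk => //; rewrite -drop -swap.
Qed.

End Decomposition.

(** * Frames with prescribed dots *)

Section Frames.
Variables (R : realType) (n : nat).
Implicit Types (x y v g u w : 'cV[R]_n) (s t l : seq 'cV[R]_n).

Lemma free_replace s v w r (c : R) : free (v :: s) -> r \in << s >>%VS -> c != 0 ->
  w = c *: v + r -> free (w :: s).
Proof.
rewrite !free_cons => /andP[vs ->] rs c0 ->; rewrite andbT; apply: contra vs => ws.
by rewrite -(scalerK c0 v) rpredZ // -(addrK r (c *: v)) rpredB.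
Qed.

Lemma perm_swap2 (T : eqType) (a b : T) (r : seq T) : perm_eq [:: a, b & r] [:: b, a & r].
Proof. by apply/permPl; apply: (perm_catCA [:: a] [:: b] r). Qed.

Lemma free_replace2 s v1 v2 (a b : R) : free [:: v1, v2 & s] -> b != 0 ->
  free [:: v1, a *: v1 + b *: v2 & s].
Proof.
move=> fs b0; rewrite (perm_free (perm_swap2 _ _ _)).
apply: (@free_replace _ v2 _ (a *: v1) b) => //.
- by rewrite (perm_free (perm_swap2 _ _ _)).
- by rewrite rpredZ // memv_span // mem_head.
- by rewrite addrC.
Qed.

(** A list shorter than [n] is padded with zero columns (the default of [nth]), hence has
    determinant 0. *)
Definition cols l : 'M[R]_n := \matrix_(i, j) (l`_j) i 0.

Lemma mul_cols l (w : 'cV[R]_n) : cols l *m w = \sum_j w j 0 *: l`_j.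
Proof.
apply/colP => i; rewrite mxE summxE; apply: eq_bigr => j _.
by rewrite !mxE mulrC.
Qed.

Lemma trcols_mul l x j : ((cols l)^T *m x) j 0 = dotv x l`_j.
Proof. by rewrite mxE; apply: eq_bigr => i _; rewrite !mxE mulrC. Qed.

Lemma mul_mx_cols (A : 'M[R]_n) l : A *m cols l = cols (map (mulmx A) l).
Proof.
apply/matrixP => i j; rewrite !mxE.
have -> : [seq A *m i | i <- l]`_j = A *m l`_j.
  have [lt|ge] := ltnP j (size l); first by rewrite (nth_map 0).
  by rewrite !nth_default ?size_map // mulmx0.
by rewrite mxE; apply: eq_bigr => k _; rewrite !mxE.
Qed.

Lemma free_cols l : size l = n -> free l = (cols l \in unitmx).
Proof.
move=> sl; rewrite unitmxE unitfE; apply/idP/idP => [fl|/eqP d0].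
  rewrite -det_tr; apply/negP => /det0P[v v0 e].
  case/eqP: v0; apply/rowP => j; rewrite !mxE.
  have lE : l = tval (tcast sl (in_tuple l)) by rewrite val_tcast.
  have ft : free (tcast sl (in_tuple l)) by rewrite -lE.
  have /freeP/(_ (fun j => v 0 j)) h := ft; apply: h; rewrite -lE.
  have := congr1 trmx e; rewrite trmx_mul trmxK trmx0 mul_cols => e'.
  rewrite -[RHS]e'.
  by apply: eq_bigr => k _; rewrite mxE.
have lE : l = tval (tcast sl (in_tuple l)) by rewrite val_tcast.
rewrite lE; apply/freeP => k; rewrite -lE => e j.
have u : cols l \in unitmx by rewrite unitmxE unitfE; apply/eqP.
have : cols l *m (\col_j k j) = 0.
  by rewrite mul_cols -[RHS]e; apply: eq_bigr => i _; rewrite mxE.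
by move=> /(congr1 (mulmx (invmx (cols l)))) /colP/(_ j); rewrite mulKmx // mulmx0 !mxE.
Qed.

Lemma free_det l : size l = n -> free l = (\det (cols l) != 0).
Proof. by move=> sl; rewrite free_cols // unitmxE unitfE. Qed.

Lemma free_extend s : free s -> exists t, size (s ++ t) = n /\ free (s ++ t).
Proof.
move=> fs; pose U := (<< s >>^C)%VS; exists (vbasis U).
have sU : <<vbasis U>>%VS = U by apply/span_basis/vbasisP.
rewrite size_cat size_tuple; split.
  rewrite dimv_compl (eqP fs) dimvf /dim /= muln1 subnKC //.
  exact: free_size.
rewrite cat_free fs (basis_free (vbasisP U)) directvEgeq /= sU.
by rewrite addv_complf dimv_compl subnKC // dimvS // subvf.
Qed.

Lemma dual_functional s (c : nat -> R) : free s ->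
  exists g, forall i, (i < size s)%N -> dotv g s`_i = c i.
Proof.
move=> /free_extend[t [st ft]]; rewrite (free_cols st) -unitmx_tr in ft.
exists (invmx (cols (s ++ t))^T *m \col_j c j) => i si.
have i_n : (i < n)%N by move: st; rewrite size_cat; lia.
have := trcols_mul (s ++ t) (invmx (cols (s ++ t))^T *m \col_j c j) (Ordinal i_n).
by rewrite mulKVmx // mxE /= nth_cat si.
Qed.

Lemma det_cols_lin s t (a b : R) u v : size (s ++ u :: t) = n ->
  \det (cols (s ++ a *: u + b *: v :: t))
    = a * \det (cols (s ++ u :: t)) + b * \det (cols (s ++ v :: t)).
Proof.
rewrite size_cat /= => sz; have k_n : (size s < n)%N by lia.
pose k := Ordinal k_n.
rewrite -[LHS]det_tr -(det_tr (cols (s ++ u :: t))) -(det_tr (cols (s ++ v :: t))).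
have skip i : (size s <= lift k i)%N -> (size s < lift k i)%N.
  move=> le; rewrite ltn_neqAle le andbT; apply/eqP => e.
  by have := neq_lift k i; rewrite -(inj_eq val_inj) -[val (lift k i)]e eqxx.
apply: (@determinant_multilinear _ _ _ _ _ k).
- by apply/rowP => i; rewrite !mxE !nth_cat /= ltnn subnn /= !mxE.
- apply/matrixP => i j; rewrite !mxE !nth_cat; case: ltnP => // le.
  by rewrite -(subnSK (skip i le)).
- apply/matrixP => i j; rewrite !mxE !nth_cat; case: ltnP => // le.
  by rewrite -(subnSK (skip i le)).
Qed.

Lemma det_colsZ s t (a : R) u : size (s ++ u :: t) = n ->
  \det (cols (s ++ a *: u :: t)) = a * \det (cols (s ++ u :: t)).
Proof. by move=> /(@det_cols_lin s t a 0 u u); rewrite scale0r addr0 mul0r addr0. Qed.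

Lemma det_cols_short l : (size l < n)%N -> \det (cols l) = 0.
Proof.
move=> ln; rewrite (expand_det_col _ (Ordinal ln)) big1 // => i _.
by rewrite mxE nth_default ?mxE ?mul0r /= ?leqnn.
Qed.

(** For a list of length [n] this is n! times the Lebesgue measure of [simplex l]; the absolute
    value makes it independent of the order of the vertices. *)
Definition vol l : R := `|\det (cols l)|.

Lemma vol_perm s t : (size s <= n)%N -> perm_eq s t -> vol s = vol t.
Proof.
move=> sn pst; have st := perm_size pst.
move: sn; rewrite leq_eqVlt => /orP[/eqP sn|sn]; last first.
  by rewrite /vol !det_cols_short // -st.
have : perm_eq (tcast sn (in_tuple s)) (tcast (etrans (esym st) sn) (in_tuple t)).
  by rewrite !val_tcast.
move=> /tuple_permP[p e]; rewrite /vol.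
suff -> : cols s = col_perm p (cols t).
  by rewrite col_permE det_mulmx det_perm normrM normrX normrN1 expr1n mulr1.
apply/matrixP => i j; rewrite !mxE; congr (fun_of_matrix _ i 0).
have := congr1 (fun l => nth 0 l j) e.
rewrite val_tcast -[in X in _ = X -> _]tnth_nth tnth_mktuple (tnth_nth 0) val_tcast.
by [].
Qed.

(** Complete [s] to a basis, make the new vectors orthogonal to [x] by subtracting multiples of
    [v0], and rescale one of them to reach determinant 1. At least one new vector exists because
    [size s < n]. *)
Lemma dotted_extension s x v0 : free s -> (size s < n)%N -> v0 \in s -> dotv x v0 != 0 ->
  exists t, [/\ size (s ++ t) = n, \det (cols (s ++ t)) = 1 &
    forall v, v \in t -> dotv x v = 0].
Proof.
move=> fs sn vs xv0; have [t0 [st ft]] := free_extend fs.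
pose f v := v - (dotv x v / dotv x v0) *: v0.
have st1 : size (s ++ map f t0) = n by rewrite size_cat size_map -size_cat.
have ft1 : free (s ++ map f t0).
  rewrite /free eqn_leq dim_span /= size_cat size_map -size_cat -(eqP ft) dimvS //.
  apply/span_subvP => v; rewrite mem_cat => /orP[vs'|vt].
    by apply: memv_span; rewrite mem_cat vs'.
  rewrite -(subrK ((dotv x v / dotv x v0) *: v0) v); apply: rpredD.
    by apply: memv_span; rewrite mem_cat orbC (map_f f).
  by apply/rpredZ/memv_span; rewrite mem_cat vs.
have xf v : dotv x (f v) = 0 by rewrite dotvDr dotvNr dotvZr divfK // subrr.
have : (0 < size (map f t0))%N.
  by rewrite -(ltn_add2l (size s)) addn0 -size_cat st1.
move: (st1) ft1; rewrite free_det //.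
have : forall v, v \in map f t0 -> dotv x v = 0 by move=> _ /mapP[v _ ->].
case: (map f t0) => [//|w t1] xt sw d0 _.
exists ((\det (cols (s ++ w :: t1)))^-1 *: w :: t1); split.
- by move: sw; rewrite !size_cat.
- by rewrite det_colsZ // mulVf.
- move=> v; rewrite inE => /orP[/eqP ->|vt]; last by apply: xt; rewrite inE vt orbT.
  by rewrite dotvZr xt ?mulr0 ?mem_head.
Qed.

(** The matrix carrying [l] to [l'] is unique; its transpose sends [x'] to [x] because both vectors
    have the same dots with the basis [l]. *)
Lemma same_frame l l' x x' : size l = n -> size l' = n -> free l ->
  \det (cols l) = \det (cols l') -> map (dotv x) l = map (dotv x') l' ->
  exists2 A : 'M[R]_n, \det A = 1 & map (mulmx A) l = l' /\ A^T *m x' = x.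
Proof.
move=> sl sl' fl dll xl; have d0 := fl; rewrite free_det // in d0.
have ul := fl; rewrite free_cols // in ul.
have E : (cols l' *m invmx (cols l)) *m cols l = cols l' by rewrite mulmxKV.
exists (cols l' *m invmx (cols l)); first by rewrite det_mulmx det_inv -dll mulfV.
split.
  apply: (@eq_from_nth _ 0); rewrite size_map ?sl //= => i ilt.
  move: E; rewrite mul_mx_cols => /matrixP E; apply/colP => j.
  by have := E j (Ordinal ilt); rewrite !mxE.
rewrite trmx_mul -mulmxA trmx_inv; rewrite -unitmx_tr in ul.
apply: (can_inj (mulKmx ul)); rewrite mulKVmx //; apply/colP => j.
rewrite !trcols_mul.
have := congr1 (fun r : seq R => nth 0 r j) xl.
by rewrite !(nth_map 0) ?sl ?sl'.
Qed.

(** Below full dimension the determinant is no invariant: both lists extend to frames of determinant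
    1 whose additional dots are all 0, and [same_frame] applies. *)
Lemma same_dots s s' x x' : free s -> free s' -> (size s < n)%N ->
  map (dotv x) s = map (dotv x') s' -> (exists2 v, v \in s & dotv x v != 0) ->
  exists2 A : 'M[R]_n, \det A = 1 & map (mulmx A) s = s' /\ A^T *m x' = x.
Proof.
move=> fs fs' sn e [v vs xv].
have ss : size s = size s' by have := congr1 size e; rewrite !size_map.
have [v' vs' xv'] : exists2 v', v' \in s' & dotv x' v' != 0.
  have : dotv x v \in map (dotv x') s' by rewrite -e map_f.
  by move=> /mapP[v' vs' ev]; exists v'; rewrite -?ev.
have [t [st dt xt]] := dotted_extension fs sn vs xv.
have [t' [st' dt' xt']] : exists t, [/\ size (s' ++ t) = n, \det (cols (s' ++ t)) = 1 &
    forall v, v \in t -> dotv x' v = 0].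
  by apply: dotted_extension vs' xv'; rewrite -?ss.
have tt : size t = size t'.
  by apply/eqP; rewrite -(eqn_add2l (size s)) -size_cat st ss -size_cat st'.
have [|||||A dA [As Ax]] // := @same_frame (s ++ t) (s' ++ t') x x'.
- by rewrite free_det // dt oner_neq0.
- by rewrite dt dt'.
- rewrite !map_cat e; congr (_ ++ _).
  have /all_pred1P -> : all (pred1 0) (map (dotv x) t).
    by apply/allP => _ /mapP[w /xt -> ->] /=.
  have /all_pred1P -> : all (pred1 0) (map (dotv x') t').
    by apply/allP => _ /mapP[w /xt' -> ->] /=.
  by rewrite !size_map tt.
exists A => //; split=> //; move/eqP: As; rewrite map_cat eqseq_cat ?size_map //.
by move=> /andP[/eqP].
Qed.

End Frames.

(** * Functional equations of covariant valuations *)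

Section Cauchy.
Variable R : realType.

(** Cauchy's equation with monotonicity: comparison with integers at large multiples of [V] leaves
    no room for an error at [V]. *)
Lemma nonneg_additive_linear (F : R -> R) :
  (forall V W, 0 < V -> 0 < W -> F (V + W) = F V + F W) ->
  (forall V, 0 < V -> 0 <= F V) -> forall V, 0 < V -> F V = V * F 1.
Proof.
move=> FD F0 V V0.
have Fn m W : 0 < W -> F (m.+1%:R * W) = m.+1%:R * F W.
  move=> W0; elim: m => [|m ih]; first by rewrite !mul1r.
  rewrite -[m.+2]addn1 natrD mulrDl mul1r FD ?ih ?mulr_gt0 // mulrDl mul1r //.
have mono V' W : 0 < V' -> V' < W -> F V' <= F W.
  move=> V0' VW; have -> : W = V' + (W - V') by rewrite addrC subrK.
  by rewrite FD ?subr_gt0 // lerDl F0 // subr_gt0.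
have F1 : 0 <= F 1 by exact: F0.
have key m : m.+1%:R * `|F V - V * F 1| <= F 1.
  set a := m.+1%:R; have a0 : 0 < a :> R by rewrite ltr0n.
  have aV : 0 < a * V by rewrite mulr_gt0.
  pose k := Num.truncn (a * V).
  have /andP[k1 k2] := Num.Theory.truncn_itv (ltW aV).
  have up : F (a * V) <= k.+1%:R * F 1.
    by rewrite -Fn // mulr1 mono.
  have lo : k%:R * F 1 <= F (a * V).
    case E : k => [|k']; first by rewrite mul0r F0.
    rewrite -Fn // mulr1 -E.
    have [->//|ne] := eqVneq (a * V) k%:R.
    by rewrite mono // ?E ?ltr0n // -E lt_neqAle eq_sym ne.
  have -> : a * `|F V - V * F 1| = `|F (a * V) - a * V * F 1|.
    by rewrite /a Fn // -mulrA -mulrBr normrM ger0_norm // ltW.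
  move: k1 k2 up lo; rewrite -/k -natr1 mulrDl mul1r => k1 k2 up lo.
  rewrite ler_norml; apply/andP; split.
    have : a * V * F 1 <= (k%:R + 1) * F 1 by rewrite ler_wpM2r // natr1 ltW // -natr1.
    lra.
  have : k%:R * F 1 <= a * V * F 1 by rewrite ler_wpM2r.
  lra.
apply/eqP; rewrite -subr_eq0 -normr_eq0; apply: contraT => ne.
have d0 : 0 < `|F V - V * F 1| by rewrite lt_neqAle eq_sym ne normr_ge0.
have := key (Num.truncn (F 1 / `|F V - V * F 1|)).
have := Num.Theory.truncnS_gt (F 1 / `|F V - V * F 1|).
by rewrite ltr_pdivrMr // => h1 h2; have := lt_le_trans h1 h2; rewrite ltxx.
Qed.

(** A negative value would fall below [- C] at a large multiple of its argument. *)
Lemma bounded_additive_nonneg (F : R -> R) (C : R) :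
  (forall V W, 0 < V -> 0 < W -> F (V + W) = F V + F W) ->
  (forall V, 0 < V -> - C <= F V) -> forall V, 0 < V -> 0 <= F V.
Proof.
move=> FD FC V V0; rewrite leNgt; apply/negP => FV.
have Fn m W : 0 < W -> F (m.+1%:R * W) = m.+1%:R * F W.
  move=> W0; elim: m => [|m ih]; first by rewrite !mul1r.
  rewrite -[m.+2]addn1 natrD mulrDl mul1r FD ?ih ?mulr_gt0 // mulrDl mul1r //.
have := FC ((Num.truncn (C / - F V)).+1%:R * V); rewrite Fn // mulr_gt0 // => /(_ isT).
have := Num.Theory.truncnS_gt (C / - F V).
rewrite ltr_pdivrMr ?oppr_gt0 // => h1.
by rewrite lerNl -mulrN leNgt h1.
Qed.

Lemma cvg_at_right_powR0 (f : R -> R) (l c q : R) : 0 < q ->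
  f e @[e --> 0^'+] --> l -> (forall e, 0 < e -> f e = powR e q * c) -> l = 0.
Proof.
move=> q0 fl fE.
have f0 : powR e q * c @[e --> 0^'+] --> (0 : R).
  by rewrite -[X in _ --> X](mul0r c); apply: cvgMl; apply: powR_cvg0.
have <- : lim (f e @[e --> 0^'+]) = l by apply/cvg_lim.
apply/cvg_lim => //; apply: cvg_trans f0; apply: near_eq_cvg.
by near=> e; rewrite fE.
Unshelve. all: by end_near.
Qed.

Lemma cvg_at_right_eq0 (f : R -> R) (l d : R) : 0 < d ->
  f e @[e --> 0^'+] --> l -> (forall e, 0 < e -> e < d -> f e = 0) -> l = 0.
Proof.
move=> d0 fl fE; have <- : lim (f e @[e --> 0^'+]) = l by apply/cvg_lim.
apply/cvg_lim => //; apply: cvg_near_cst; near=> e.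
by apply: fE; near: e; [exact: nbhs_right_gt|exact: nbhs_right_lt].
Unshelve. all: by end_near.
Qed.

End Cauchy.

Lemma perm_map_lift (T U : eqType) (f : T -> U) (s : seq T) (t : seq U) :
  perm_eq (map f s) t -> exists2 s', perm_eq s s' & map f s' = t.
Proof.
elim: t s => [|a t ih] s pst.
  by exists [::] => //; have /perm_nilP := pst; case: s {pst}.
have /mapP[v vs av] : a \in map f s by rewrite (perm_mem pst) mem_head.
have pv := perm_to_rem vs.
have [|s' p1 p2] := ih (rem v s).
  by rewrite -(perm_cons a) -(permPr pst) av -map_cons perm_map // perm_sym.
exists (v :: s'); last by rewrite /= p2 av.
by rewrite (permPl pv) perm_cons.
Qed.

Section StandardFrame.
Variables (R : realType) (n : nat).
Implicit Types (x : 'cV[R]_n) (y z : seq R).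

(** Indexed by [nat], so that frames are images of [iota]; it is zero once [n <= k]. *)
Definition basis_vec k : 'cV[R]_n := \col_i (i == k :> nat)%:R.
Definition std_frame d := map basis_vec (iota 0 d).
Definition vec y : 'cV[R]_n := \col_i y`_i.

Lemma size_std_frame d : size (std_frame d) = d.
Proof. by rewrite size_map size_iota. Qed.

Lemma dotv_basis_vec x (k : 'I_n) : dotv x (basis_vec k) = x k 0.
Proof.
rewrite -dotv_delta; congr (dotv _ _); apply/colP => i.
by rewrite !mxE eqxx andbT.
Qed.

Lemma cols_std_frame : cols (std_frame n) = 1%:M.
Proof.
apply/matrixP => i j; rewrite !mxE (nth_map 0%N) ?size_iota // nth_iota // mxE add0n.
by rewrite -val_eqE.
Qed.

Lemma free_std_frame d : (d <= n)%N -> free (std_frame d).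
Proof.
move=> dn; have : free (std_frame n).
  by rewrite free_det ?size_std_frame // cols_std_frame det1 oner_neq0.
have -> : std_frame n = std_frame d ++ map basis_vec (iota d (n - d)).
  by rewrite -map_cat -iotaD subnKC.
exact: catl_free.
Qed.

Lemma dots_vec y : (size y <= n)%N -> map (dotv (vec y)) (std_frame (size y)) = y.
Proof.
move=> yn; apply: (@eq_from_nth _ 0); rewrite !size_map size_iota // => i iy.
rewrite -map_comp (nth_map 0%N) ?size_iota // nth_iota //= add0n.
by rewrite (dotv_basis_vec _ (Ordinal (leq_trans iy yn))) mxE.
Qed.

Lemma vecZ (a : R) y : vec (map ( *%R a) y) = a *: vec y.
Proof.
apply/colP => i; rewrite !mxE; have [lt|ge] := ltnP i (size y).
  by rewrite (nth_map 0).
by rewrite !nth_default ?size_map // mulr0.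
Qed.

End StandardFrame.

Section FunctionalEquation.
Variables (R : realType) (n : nat) (Z : set 'cV[R]_n -> 'cV[R]_n -> R) (p : R).
Implicit Types (x u v w g : 'cV[R]_n) (s t : seq 'cV[R]_n) (y z : seq R).

Definition homogeneous (Z : set 'cV[R]_n -> 'cV[R]_n -> R) := forall P, polytope_o P ->
  forall (l : R) x, 0 <= l -> Z P (l *: x) = powR l p * Z P x.
(** One-sided continuity along rays is all that the limit arguments need; it follows from convexity
    and survives the subtraction of other valuations, which convexity does not. *)
Definition ray_continuous (Z : set 'cV[R]_n -> 'cV[R]_n -> R) := forall P, polytope_o P ->
  forall x u, Z P (x + e *: u) @[e --> 0^'+] --> Z P x.

Hypothesis p0 : 0 < p.
Hypothesis Zval : is_valuation Z.
Hypothesis Zcov : SL_covariant Z.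
Hypothesis Zhom : homogeneous Z.
Hypothesis Zcont : ray_continuous Z.
Hypothesis Zpt : forall x, Z (simplex [::]) x = 0.

Lemma valuation_eq_mem s t x : s =i t -> Z (simplex s) x = Z (simplex t) x.
Proof. by move=> /simplex_eq_mem ->. Qed.

Lemma valuation_perm s t x : perm_eq s t -> Z (simplex s) x = Z (simplex t) x.
Proof. by move=> /perm_mem/valuation_eq_mem. Qed.

Lemma valuation_at0 P : polytope_o P -> Z P 0 = 0.
Proof.
by move=> po; rewrite -(scale0r 0) Zhom // powR0 ?mul0r // gt_eqF.
Qed.

(** The cutting point need only lie in [simplex s]: it is a vertex of [s] in [valuation_cut], and
    the origin for the bipyramid. *)
Lemma valuation_cut_gen s v1 v2 g (l : R) x : 0 < l -> l < 1 ->
  simplex s ((1 - l) *: v1 + l *: v2) ->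
  dotv g v1 < 0 -> 0 < dotv g v2 -> (forall v, v \in s -> dotv g v = 0) ->
  Z (simplex [:: v1, v2 & s]) x + Z (simplex s) x
    = Z (simplex (v1 :: s)) x + Z (simplex (v2 :: s)) x.
Proof.
move=> l0 l1 ws g1 g2 gs.
have U := simplex_cutU l0 l1 ws; have I := simplex_cutI g1 g2 gs.
by rewrite -U -I Zval ?I ?U //; exact: polytope_o_simplex.
Qed.

Lemma valuation_cut s v1 v2 (l : R) x : free [:: v1, v2 & s] -> 0 < l -> l < 1 ->
  let w := (1 - l) *: v1 + l *: v2 in
  Z (simplex [:: v1, v2 & s]) x + Z (simplex (w :: s)) x
    = Z (simplex [:: v1, w & s]) x + Z (simplex [:: w, v2 & s]) x.
Proof.
move=> fs l0 l1 w.
(* These values make the separating functional vanish at [w], as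
   [(1 - l) * (- l) + l * (1 - l) = 0]. *)
pose c i := if i is 0 then - l else if i is 1 then 1 - l else 0.
have [g gE] := dual_functional c fs.
have g1 : dotv g v1 = - l by apply: (gE 0).
have g2 : dotv g v2 = 1 - l by apply: (gE 1).
have gs v : v \in s -> dotv g v = 0.
  move=> vs; have := gE (index v s).+2; rewrite /= !ltnS index_mem => /(_ vs).
  by rewrite nth_index.
have := @valuation_cut_gen (w :: s) v1 v2 g l x l0 l1.
rewrite g1 g2 oppr_lt0 subr_gt0 => /(_ _ l0 l1) h.
rewrite (@valuation_eq_mem [:: w, v2 & s] [:: v2, w & s]); last by move=> v; rewrite !inE orbCA.
rewrite -h.
- congr (_ + _); congr (Z _ x); apply/seteqP; split; apply: simplex_sub => v.
    by rewrite inE => /orP[vs|vs]; apply: simplex_mem; rewrite !inE ?vs ?orbT //;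
      move: vs; rewrite inE => /orP[] ->; rewrite ?orbT.
  rewrite !inE => /orP[vs|/orP[vs|/orP[/eqP ->|vs]]]; try by apply: simplex_mem; rewrite !inE vs ?orbT.
  by apply: conv_hull_convex; rewrite ?ltW //; apply: simplex_mem; rewrite !inE eqxx ?orbT.
- by apply: simplex_mem; rewrite mem_head.
- move=> v; rewrite inE => /orP[/eqP ->|]; last exact: gs.
  by rewrite dotvDr !dotvZr g1 g2; ring.
Qed.

Lemma valuation_map (A : 'M[R]_n) s x : \det A = 1 ->
  Z (simplex (map (mulmx A) s)) x = Z (simplex s) (A^T *m x).
Proof. by move=> dA; rewrite -simplex_image Zcov //; exact: polytope_o_simplex. Qed.

Lemma valuation_same_frame s s' x x' : size s = n -> size s' = n -> free s ->
  \det (cols s) = \det (cols s') -> map (dotv x) s = map (dotv x') s' ->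
  Z (simplex s) x = Z (simplex s') x'.
Proof.
move=> ss ss' fs d e; have [A dA [<- <-]] := same_frame ss ss' fs d e.
by rewrite valuation_map.
Qed.

(** [same_dots] requires a nonzero dot, so perturb: if [u] has all dots 1, then [x + e *: u] and
    [e *: u] have the same dots, and the common value [powR e p * Z (simplex s) u] tends to 0. *)
Lemma valuation_dots0 s x : free s -> (size s < n)%N ->
  (forall v, v \in s -> dotv x v = 0) -> Z (simplex s) x = 0.
Proof.
case: s => [|v s] // fs sn xs.
have [u uE] := dual_functional (fun=> 1) fs.
have us w : w \in v :: s -> dotv u w = 1.
  by move=> ws; rewrite -(nth_index 0 ws) uE ?index_mem.
have po := polytope_o_simplex (v :: s).
apply: (@cvg_at_right_powR0 _ _ _ (Z (simplex (v :: s)) u) _ p0 (@Zcont _ po x u)) => e e0.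
rewrite -Zhom ?ltW //.
have [||A dA [As <-]] := @same_dots _ _ (v :: s) (v :: s) (x + e *: u) (e *: u) fs fs sn.
- by apply/eq_in_map => w ws; rewrite dotvDl xs // add0r.
- exists v; first exact: mem_head.
  by rewrite dotvDl xs ?mem_head // add0r dotvZl us ?mem_head // mulr1 gt_eqF.
- by rewrite -valuation_map // As.
Qed.

(** The function G of the dots, read off on a standard frame; by [valuation_face] the choice of
    frame is immaterial as long as fewer than [n] dots occur. *)
Definition face_val y := Z (simplex (std_frame R n (size y))) (vec n y).
Local Notation G := face_val.

Lemma valuation_face s x : free s -> (size s < n)%N ->
  Z (simplex s) x = G (map (dotv x) s).
Proof.
move=> fs sn; rewrite /G size_map; set y := map _ _.
have ys : size y = size s by rewrite size_map.
have [h|h] := pselect (exists2 v, v \in s & dotv x v != 0).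
  have [|A dA [As <-]] := same_dots fs (free_std_frame R (ltnW sn)) sn _ h (x' := vec n y).
    by rewrite -{1}ys dots_vec // ys ltnW.
  by rewrite -As valuation_map.
have h0 v : v \in s -> dotv x v = 0.
  by move=> vs; apply/eqP; apply: contraT => xv; exfalso; apply: h; exists v.
have v0 : vec n y = 0.
  apply/colP => i; rewrite !mxE; have [lt|ge] := ltnP i (size s).
    by rewrite (nth_map 0) // h0 // mem_nth.
  by rewrite nth_default // ys.
rewrite valuation_dots0 // v0 valuation_at0 //; exact: polytope_o_simplex.
Qed.

Lemma face_valE y : G y = Z (simplex (std_frame R n (size y))) (vec n y).
Proof. by []. Qed.

Lemma face_val_perm y z : (size y < n)%N -> perm_eq y z -> G y = G z.
Proof.
move=> yn pyz; have := pyz; rewrite -{1}(dots_vec (ltnW yn)) => /perm_map_lift[s' ps e].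
rewrite face_valE (valuation_perm _ ps) valuation_face ?e //.
  by rewrite -(perm_free ps) free_std_frame // ltnW.
by rewrite -(perm_size ps) size_std_frame.
Qed.

Lemma face_valZ y (a : R) : 0 <= a -> G (map ( *%R a) y) = powR a p * G y.
Proof. by move=> a0; rewrite /G size_map vecZ Zhom //; exact: polytope_o_simplex. Qed.

Lemma face_val_cut (y1 y2 : R) z (l : R) : (size z + 2 < n)%N -> 0 < l -> l < 1 ->
  let w := (1 - l) * y1 + l * y2 in
  G [:: y1, y2 & z] + G (w :: z) = G [:: y1, w & z] + G [:: w, y2 & z].
Proof.
move=> zn l0 l1 w.
have yn : (size [:: y1, y2 & z] < n)%N by rewrite /= -addn2.
have := dots_vec (ltnW yn); have := free_std_frame R (ltnW yn).
have := size_std_frame R n (size [:: y1, y2 & z]); rewrite (face_valE [:: _, _ & _]).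
case: std_frame => [|v1 [|v2 s]] // [ss] fs [e1 e2 es].
have l0' : 1 - l != 0 by rewrite subr_eq0 eq_sym lt_eqF.
have f1 := free_replace2 (1 - l) fs (lt0r_neq0 l0).
have f2 : free [:: v2, (1 - l) *: v1 + l *: v2 & s].
  rewrite [X in [:: v2, X & s]]addrC; apply: free_replace2 => //.
  by rewrite (perm_free (perm_swap2 _ _ _)).
have xw : dotv (vec n [:: y1, y2 & z]) ((1 - l) *: v1 + l *: v2) = w.
  by rewrite dotvDr !dotvZr e1 e2.
have := valuation_cut (vec n [:: y1, y2 & z]) fs l0 l1; rewrite /= => E.
have sn : ((size s).+2 < n)%N by rewrite ss /= -addn2.
have f3 : free ((1 - l) *: v1 + l *: v2 :: s).
  by move: f1; rewrite free_cons => /andP[].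
have f4 : free [:: (1 - l) *: v1 + l *: v2, v2 & s].
  by rewrite (perm_free (perm_swap2 _ _ _)).
move: E; rewrite !valuation_face //; last exact: ltnW.
by rewrite /= xw e1 e2 es.
Qed.

(** Cutting an edge with equal dots at its midpoint gives two pieces with the same dots as the
    whole. *)
Lemma face_val_eq2 (a : R) z : (size z + 2 < n)%N -> G [:: a, a & z] = G (a :: z).
Proof.
move=> zn; have := face_val_cut a a zn (l := 2^-1); rewrite /= -mulrDl subrK mul1r.
have h : 0 < (2^-1 : R) by rewrite invr_gt0.
have h' : (2^-1 : R) < 1 by lra.
by move=> /(_ h h'); lra.
Qed.

Lemma det_cols_eq2 u s : size [:: u, u & s] = n -> \det (cols [:: u, u & s]) = 0.
Proof.
move=> sz; apply/eqP; rewrite -[_ == 0]negbK -free_det //.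
by rewrite free_cons memv_span ?mem_head.
Qed.

Lemma det_cols_add u v (a : R) s : size [:: u, v & s] = n ->
  \det (cols [:: v + a *: u, v & s]) = a * \det (cols [:: u, v & s]).
Proof.
move=> sz; have := @det_cols_lin _ _ [::] (v :: s) 1 a v u sz.
by rewrite scale1r /= det_cols_eq2 // mulr0 add0r.
Qed.

Lemma det_cols_add2 u v (a : R) s : size [:: u, v & s] = n ->
  \det (cols [:: u, v + a *: u & s]) = \det (cols [:: u, v & s]).
Proof.
move=> sz; have := @det_cols_lin _ _ [:: u] s 1 a v u sz.
by rewrite scale1r /= det_cols_eq2 // mulr0 addr0 mul1r.
Qed.

Lemma det_cols_swap u v s : size [:: u, v & s] = n ->
  \det (cols [:: u, v & s]) = - \det (cols [:: v, u & s]).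
Proof.
move=> sz; have := det_cols_eq2 (u := v + 1 *: u) sz.
have := @det_cols_lin _ _ [::] (v + 1 *: u :: s) 1 1 v u sz; rewrite !scale1r /= => ->.
have := det_cols_add2 1 sz; have := @det_cols_lin _ _ [:: v] s 1 1 v u sz.
rewrite !scale1r /= det_cols_eq2 // => -> ->; lra.
Qed.

Section TopDimension.
Variables (a : R) (z : seq R) (C : R).
Hypothesis zn : (size z + 2)%N = n.
Hypothesis Zbd : forall s x, map (dotv x) s = [:: a, a & z] -> - C <= Z (simplex s) x.

Let kappa := Z (simplex (std_frame R n n)) (vec n [:: a, a & z]) - G (a :: z).

(** The direction [u = v1 - v2] is orthogonal to [x], so replacing [v1] by [v2 + W *: u] keeps the
    dots and turns the determinant into [W * D]. Cutting the first edge splits the parameter [V + W]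
    into [V] and [W]: after subtraction of the value on the cutting face, [F] is additive, and the
    lower bound makes it linear. *)
Lemma top_frame v1 v2 s x : free [:: v1, v2 & s] -> map (dotv x) [:: v1, v2 & s] = [:: a, a & z] ->
  Z (simplex [:: v1, v2 & s]) x = G (a :: z) + vol [:: v1, v2 & s] * kappa /\ 0 <= kappa.
Proof.
move=> fs ds; have [e1 e2 es] := ds.
have sz w1 w2 : size [:: w1, w2 & s] = n.
  by have := congr1 size es; rewrite size_map /= => ->; rewrite -addn2.
pose u := v1 - v2; have xu : dotv x u = 0 by rewrite dotvDr dotvNr e1 e2 subrr.
pose D := \det (cols [:: u, v2 & s]).
have dD W : \det (cols [:: v2 + W *: u, v2 & s]) = W * D by rewrite det_cols_add.
have D0 : D != 0.
  have := dD 1; rewrite scale1r addrC subrK mul1r => <-.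
  by rewrite -free_det.
pose fr W := [:: v2 + W *: u, v2 & s].
have ffr W : 0 < W -> free (fr W).
  by move=> W0; rewrite /fr free_det // dD mulf_neq0 // gt_eqF.
have dfr W : map (dotv x) (fr W) = [:: a, a & z].
  by rewrite /= dotvDr dotvZr xu mulr0 addr0 e2 es.
pose F W := Z (simplex (fr W)) x - G (a :: z).
have FD V W : 0 < V -> 0 < W -> F (V + W) = F V + F W.
  move=> V0 W0; have VW : 0 < V + W by rewrite addr_gt0.
  pose l := V / (V + W).
  have l0 : 0 < l by rewrite divr_gt0.
  have l1 : l < 1 by rewrite ltr_pdivrMr // mul1r ltrDl.
  have := valuation_cut x (ffr _ VW) l0 l1 => /=.
  have -> : (1 - l) *: (v2 + (V + W) *: u) + l *: v2 = v2 + W *: u.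
    apply/colP => i; rewrite !mxE /l; field; exact: lt0r_neq0.
  have fw : free (v2 + W *: u :: s).
    have := ffr _ W0; rewrite /fr (perm_free (perm_swap2 _ _ _)) free_cons.
    by move=> /andP[].
  rewrite (valuation_face x fw); last by have /= := sz v1 v2; lia.
  have -> : map (dotv x) (v2 + W *: u :: s) = a :: z.
    by rewrite /= dotvDr dotvZr xu mulr0 addr0 e2 es.
  have -> : Z (simplex [:: v2 + (V + W) *: u, v2 + W *: u & s]) x = Z (simplex (fr V)) x.
    have dE : \det (cols [:: v2 + (V + W) *: u, v2 + W *: u & s]) = \det (cols (fr V)).
      rewrite /fr dD (_ : v2 + (V + W) *: u = (v2 + W *: u) + V *: u).
        by rewrite det_cols_add ?det_cols_add2.
      by rewrite -addrA -scalerDl (addrC V).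
    apply: valuation_same_frame; rewrite ?sz //.
      by rewrite free_det ?sz // dE -free_det ?sz // ffr.
    by rewrite dfr /= !dotvDr !dotvZr xu !mulr0 !addr0 e2 es.
  by rewrite /F /fr; lra.
have FC V : 0 < V -> - (C + G (a :: z)) <= F V.
  by move=> V0; rewrite opprD lerD2r; apply: Zbd; rewrite dfr.
have F0 := bounded_additive_nonneg FD FC.
have FE := nonneg_additive_linear FD F0.
have D1 : 0 < `|D|^-1 by rewrite invr_gt0 normr_gt0.
(* This parameter makes the determinant 1 or -1. In the first case the frame is equivalent to the
   standard one; in the second, swapping the first two vectors, whose dots agree, corrects the
   sign. *)
have kE : F `|D|^-1 = kappa.
  rewrite /F /kappa; congr (_ - _).
  have dv : map (dotv (vec n [:: a, a & z])) (std_frame R n n) = [:: a, a & z].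
    have yn : size [:: a, a & z] = n by rewrite /= -addn2.
    by have := dots_vec (eq_leq yn); rewrite yn.
  have [Dp|Dn] := ltP 0 D.
    apply: valuation_same_frame; rewrite ?sz ?size_std_frame ?dfr ?dv //; first exact: ffr.
    by rewrite dD cols_std_frame det1 gtr0_norm // mulVf.
  rewrite (valuation_perm _ (perm_swap2 _ _ _)).
  have dd : \det (cols [:: v2, v2 + `|D|^-1 *: u & s]) = 1.
    by rewrite det_cols_swap ?sz // dD ler0_norm // invrN mulNr mulVf // opprK.
  apply: valuation_same_frame; rewrite ?sz ?size_std_frame ?dv //.
  - by rewrite free_det ?sz // dd oner_neq0.
  - by rewrite dd cols_std_frame det1.
  - by rewrite /= dotvDr dotvZr xu mulr0 addr0 e2 es.
have k0 : 0 <= kappa by rewrite -kE F0.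
split=> //.
have volE : vol [:: v1, v2 & s] = `|D|.
  by have := dD 1; rewrite scale1r addrC subrK mul1r /vol => ->.
have F1 : F 1 = `|D| * kappa by rewrite -kE (FE _ D1) mulVKf // normr_eq0.
move: F1; rewrite volE /F /fr scale1r [v2 + u]addrC subrK => <-.
by rewrite addrC subrK.
Qed.

End TopDimension.

(** Unites both dimensions: with fewer than [n] vectors the repeated dot merges and [k = 0]; with
    [n] vectors the linear volume term of [top_frame] remains. *)
Lemma equal_dots (a : R) z (C : R) : (size z + 2 <= n)%N ->
  (forall s x, map (dotv x) s = [:: a, a & z] -> - C <= Z (simplex s) x) ->
  exists2 k : R, 0 <= k & forall s x, free s -> perm_eq (map (dotv x) s) [:: a, a & z] ->
    Z (simplex s) x = G (a :: z) + vol s * k.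
Proof.
rewrite leq_eqVlt => /orP[/eqP zn|zn] Zbd; last first.
  exists 0 => // s x fs ps; have ss : size s = (size z + 2)%N.
    by rewrite addn2 -(size_map (dotv x) s) (perm_size ps).
  rewrite mulr0 addr0 -face_val_eq2 // valuation_face ?ss //.
  by apply: face_val_perm => //; rewrite size_map ss.
pose k := Z (simplex (std_frame R n n)) (vec n [:: a, a & z]) - G (a :: z).
have key s x : free s -> perm_eq (map (dotv x) s) [:: a, a & z] ->
    Z (simplex s) x = G (a :: z) + vol s * k /\ 0 <= k.
  move=> fs /perm_map_lift[[|v1 [|v2 s']] // ps e].
  rewrite (valuation_perm _ ps) (vol_perm (free_size fs) ps).
  by apply: (top_frame zn Zbd); rewrite // -(perm_free ps).
exists k; last by move=> s x fs ps; have [] := key s x fs ps.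
have yn : size [:: a, a & z] = n by rewrite /= -addn2.
have [] // := key (std_frame R n n) (vec n [:: a, a & z]) (free_std_frame R (leqnn n)).
by have := dots_vec (eq_leq yn); rewrite yn => ->.
Qed.

End FunctionalEquation.

(** [H] is an additive function of intervals, and every interval is a sum or difference of two
    intervals with endpoint [b]. *)
Lemma interval_additive_eq0 (R : realType) (H : R -> R -> R) (b : R) :
  (forall t1 t2, H t1 t2 = H t2 t1) -> (forall t, H t t = 0) -> (forall t, H b t = 0) ->
  (forall t1 t2 (l : R), 0 < l -> l < 1 ->
     H t1 t2 = H t1 ((1 - l) * t1 + l * t2) + H ((1 - l) * t1 + l * t2) t2) ->
  forall t1 t2, H t1 t2 = 0.
Proof.
move=> Hsym Hd Hb Hcut.
have cut t1 t t2 : t1 < t -> t < t2 -> H t1 t2 = H t1 t + H t t2.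
  move=> h1 h2; have h12 : t1 < t2 by exact: lt_trans h2.
  have d0 : 0 < t2 - t1 by rewrite subr_gt0.
  have := Hcut t1 t2 ((t - t1) / (t2 - t1)).
  have -> : (1 - (t - t1) / (t2 - t1)) * t1 + (t - t1) / (t2 - t1) * t2 = t.
    by field; exact: lt0r_neq0.
  by apply; rewrite ?divr_gt0 ?subr_gt0 // ltr_pdivrMr // mul1r ltrD2r.
have lt_case t1 t2 : t1 < t2 -> H t1 t2 = 0.
  move=> h12; have [b1|b1|<-//] := ltgtP b t1.
    by have := cut _ _ _ b1 h12; rewrite !Hb add0r.
  have [b2|b2|<-] := ltgtP b t2.
  - by rewrite (cut _ _ _ b1 b2) Hsym !Hb addr0.
  - by have := cut _ _ _ h12 b2; rewrite -!(Hsym b) !Hb addr0.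
  - by rewrite Hsym Hb.
move=> t1 t2; have [h|h|->//] := ltgtP t1 t2; first exact: lt_case.
by rewrite Hsym lt_case.
Qed.

Lemma infinitesimal_le0 (R : realType) (A B : R) : (forall e, 0 < e -> A <= e * B) -> A <= 0.
Proof.
move=> h; rewrite leNgt; apply/negP => A0.
have B0 : 0 < B by have := h 1 ltr01; rewrite mul1r; lra.
have := h (A / B / 2); rewrite !divr_gt0 // => /(_ isT).
have -> : A / B / 2 * B = A / 2 by field; rewrite gt_eqF.
lra.
Qed.

(** * Valuations determined by few values *)

Section Uniqueness.
Variables (R : realType) (n : nat) (Z : set 'cV[R]_n -> 'cV[R]_n -> R) (p : R).
Implicit Types (x u v w g : 'cV[R]_n) (s : seq 'cV[R]_n) (y z : seq R).
Hypothesis p0 : 0 < p.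
Hypothesis Zval : is_valuation Z.
Hypothesis Zcov : SL_covariant Z.
Hypothesis Zhom : homogeneous p Z.
Hypothesis Zcont : ray_continuous Z.

Section LowerDimensions.
Hypothesis Zpt : forall x, Z (simplex [::]) x = 0.
Local Notation G := (face_val Z).
Hypothesis Zseg : forall a : R, G [:: a] = 0.
Hypothesis Z10 : G [:: 1; 0] = 0.
Hypothesis ZN10 : G [:: -1; 0] = 0.

Lemma face_val_pair0 (t : R) : (2 < n)%N -> G [:: 0; t] = 0.
Proof.
move=> n2; rewrite (face_val_perm p0 Zcov Zhom Zcont Zpt (z := [:: t; 0])) //; last exact: perm_swap2.
have [t0|t0|->] := ltgtP t 0.
- have := face_valZ Zhom [:: -1; 0] (a := - t); rewrite ZN10 mulr0 /= mulrN1 opprK mulr0; apply.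
  by rewrite oppr_ge0 ltW.
- by have := face_valZ Zhom [:: 1; 0] (ltW t0); rewrite Z10 mulr0 /= mulr1 mulr0.
- by rewrite (face_val_eq2 p0 Zval Zcov Zhom Zcont Zpt).
Qed.

(** Induction on the number of dots: since shorter lists vanish, the cut equation makes G additive
    in the interval of its first two dots. The base point is 0 for pairs; for longer lists it is a
    dot [b] already present, since a repeated dot merges and shortens the list. *)
Lemma face_val_eq0 y : (size y < n)%N -> G y = 0.
Proof.
have perm := face_val_perm p0 Zcov Zhom Zcont Zpt.
have eq2 := face_val_eq2 p0 Zval Zcov Zhom Zcont Zpt.
have cut := face_val_cut p0 Zval Zcov Zhom Zcont Zpt.
have [k] : {k | (size y <= k)%N} by exists (size y).
elim: k y => [|k ih] [|y1 [|y2 [|b z]]] //= yk yn.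
- exact: Zpt.
- exact: Zpt.
- pose H t1 t2 := G [:: t1; t2]; suff HE : forall t1 t2, H t1 t2 = 0 by exact: HE.
  apply: (@interval_additive_eq0 _ H 0); rewrite /H.
  + by move=> t1 t2; apply: perm => //; exact: perm_swap2.
  + by move=> t; rewrite eq2.
  + by move=> t; apply: face_val_pair0.
  + by move=> t1 t2 l l0 l1; rewrite -cut // Zseg addr0.
- pose H t1 t2 := G [:: t1, t2, b & z]; suff HE : forall t1 t2, H t1 t2 = 0 by exact: HE.
  apply: (@interval_additive_eq0 _ H b); rewrite /H.
  + by move=> t1 t2; apply: perm => //; exact: perm_swap2.
  + by move=> t; rewrite eq2 ?ih /= ?addn2 //; lia.
  + move=> t; have -> : G [:: b, t, b & z] = G [:: b, b, t & z].
      by apply: perm => //; rewrite perm_cons; exact: perm_swap2.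
    by rewrite eq2 ?ih /= ?addn2 //; lia.
  + move=> t1 t2 l l0 l1; rewrite -cut //= ?addn2 //.
    by rewrite (ih [:: _, b & z]) ?addr0 //=; lia.
Qed.

Lemma valuation_simple s x : free s -> (size s < n)%N -> Z (simplex s) x = 0.
Proof.
move=> fs sn; rewrite (valuation_face p0 Zcov Zhom Zcont Zpt) // face_val_eq0 //.
by rewrite size_map.
Qed.

End LowerDimensions.

Section TopSimplices.
Hypothesis Zsimple : forall s x, free s -> (size s < n)%N -> Z (simplex s) x = 0.
Hypothesis Zbase : forall s x, free s -> size s = n ->
  (count (fun v => dotv x v != 0%R) s <= 1)%N -> Z (simplex s) x = 0.

Lemma top_cut s v1 v2 (l : R) x : free [:: v1, v2 & s] -> 0 < l -> l < 1 ->
  Z (simplex [:: v1, v2 & s]) x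
    = Z (simplex [:: v1, (1 - l) *: v1 + l *: v2 & s]) x
    + Z (simplex [:: (1 - l) *: v1 + l *: v2, v2 & s]) x.
Proof.
move=> fs l0 l1; rewrite -(valuation_cut Zval) // (Zsimple (s := _ :: s)) ?addr0 //.
  have := free_replace2 (1 - l) fs (lt0r_neq0 l0).
  by rewrite free_cons => /andP[].
by have /= := free_size fs; lia.
Qed.

(** Induction on the number of nonzero dots: two distinct nonzero dots are traded for a point with
    dot 0 on the line through their vertices, and equal ones are reached as a limit. *)
Lemma top_simplices_eq0 s x : free s -> size s = n -> Z (simplex s) x = 0.
Proof.
pose nz x s := count (fun v => dotv x v != 0) s.
have [k] : {k | (nz x s <= k)%N} by exists (nz x s).
elim: k s x => [|k ih] s x sk fs sn.
  by apply: Zbase => //; apply: leq_trans sk _.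
have [le1|gt1] := leqP (nz x s) 1; first exact: Zbase.
have [v1 [v2 [s' [ps v1x v2x]]]] : exists v1 v2 s',
    [/\ perm_eq s [:: v1, v2 & s'], dotv x v1 != 0 & dotv x v2 != 0].
  have : has (fun v => dotv x v != 0) s by rewrite has_count (ltn_trans _ gt1).
  move=> /hasP[v1 v1s v1x]; have p1 := perm_to_rem v1s.
  have : has (fun v => dotv x v != 0) (rem v1 s).
    by rewrite has_count; move: gt1; rewrite /nz (seq.permP p1) /= v1x; lia.
  move=> /hasP[v2 v2s v2x]; have p2 := perm_to_rem v2s.
  exists v1, v2, (rem v2 (rem v1 s)); split=> //.
  by apply: perm_trans p1 _; rewrite perm_cons.
rewrite (valuation_perm _ _ ps); rewrite (perm_free ps) in fs.
rewrite (perm_size ps) in sn; rewrite /nz (seq.permP ps) in sk.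
have ss : (count (fun v => dotv x v != 0%R) s' <= k.-1)%N.
  by move: sk; rewrite /= v1x v2x; lia.
have k1 : (0 < k)%N by move: sk; rewrite /= v1x v2x; lia.
move: s' v1 v2 x v1x v2x fs sn ss {s sk gt1 ps} => s v1 v2 x.
have distinct : forall v1 v2 x, dotv x v1 != 0 -> dotv x v2 != 0 -> free [:: v1, v2 & s] ->
    size [:: v1, v2 & s] = n -> (count (fun v => dotv x v != 0%R) s <= k.-1)%N ->
    dotv x v1 != dotv x v2 -> Z (simplex [:: v1, v2 & s]) x = 0.
  move=> {v1 v2 x} v1 v2 x v1x v2x fs sn ss ne.
  have ss1 : ((count (fun v => dotv x v != 0%R) s).+1 <= k)%N by rewrite -(prednK k1) ltnS.
  (* Dots of the same sign: the point [w] of dot 0 lies outside the edge, beyond [v1]. Cutting the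
     longer edge from [w] to [v2] at [v1] expresses the value through two simplices with one nonzero
     dot fewer. *)
  have same : forall v1 v2, dotv x v1 != 0 -> dotv x v2 != 0 -> free [:: v1, v2 & s] ->
      size [:: v1, v2 & s] = n -> 0 < dotv x v1 / dotv x v2 -> dotv x v1 / dotv x v2 < 1 ->
      Z (simplex [:: v1, v2 & s]) x = 0.
    move=> {v1 v2 v1x v2x fs sn ne} v1 v2 v1x v2x fs sn; set l := _ / _ => l0 l1.
    have l1' : 1 - l != 0 by rewrite subr_eq0 eq_sym lt_eqF.
    pose w := (1 - l)^-1 *: v1 + (- (l / (1 - l))) *: v2.
    have wE : (1 - l) *: w + l *: v2 = v1.
      by apply/colP => i; rewrite !mxE; field.
    have xw : dotv x w = 0.
      have lE : dotv x v1 = l * dotv x v2 by rewrite divfK.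
      by rewrite dotvDr !dotvZr lE; field.
    have fw : free [:: w, v2 & s].
      rewrite (perm_free (perm_swap2 _ _ _)) /w addrC; apply: free_replace2.
        by rewrite (perm_free (perm_swap2 _ _ _)).
      by rewrite invr_eq0.
    have fw1 : free [:: w, v1 & s].
      by rewrite -wE; apply: free_replace2 => //; exact: lt0r_neq0.
    have := top_cut x fw l0 l1; rewrite wE.
    have -> : Z (simplex [:: w, v2 & s]) x = 0.
      by apply: ih => //; rewrite /nz /= xw eqxx v2x; exact: ss1.
    have -> : Z (simplex [:: w, v1 & s]) x = 0.
      by apply: ih => //; rewrite /nz /= xw eqxx v1x; exact: ss1.
    by rewrite add0r.
  have fs' : free [:: v2, v1 & s] by rewrite (perm_free (perm_swap2 _ _ _)).
  have r0 : dotv x v1 / dotv x v2 != 0 by rewrite mulf_neq0 ?invr_eq0.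
  have r1 : dotv x v1 / dotv x v2 != 1.
    by apply: contra ne => /eqP e; rewrite -(divfK v2x (dotv x v1)) e mul1r.
  have [rneg|rpos|req] := ltgtP (dotv x v1 / dotv x v2) 0; last by rewrite req eqxx in r0.
    (* Dots of opposite signs: the edge itself contains a point of dot 0. *)
    pose l := dotv x v1 / (dotv x v1 - dotv x v2).
    have d0 : dotv x v1 - dotv x v2 != 0 by rewrite subr_eq0.
    have lE : l = (- (dotv x v1 / dotv x v2)) / (1 - dotv x v1 / dotv x v2).
      by rewrite /l; field; rewrite v2x d0 -opprB oppr_eq0 d0.
    have r1' : 0 < 1 - dotv x v1 / dotv x v2 by rewrite subr_gt0 (lt_trans rneg).
    have l0 : 0 < l by rewrite lE divr_gt0 // oppr_gt0.
    have l1 : l < 1 by rewrite lE ltr_pdivrMr // mul1r ltrDr.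
    have l1' : 1 - l != 0 by rewrite subr_eq0 eq_sym lt_eqF.
    set w := (1 - l) *: v1 + l *: v2.
    have xw : dotv x w = 0.
      by rewrite dotvDr !dotvZr /l; field.
    have fw1 : free [:: v1, w & s] by apply: free_replace2 => //; exact: lt0r_neq0.
    have fw2 : free [:: w, v2 & s].
      by rewrite (perm_free (perm_swap2 _ _ _)) /w addrC; apply: free_replace2.
    rewrite (top_cut x fs l0 l1) -/w.
    have -> : Z (simplex [:: v1, w & s]) x = 0.
      by apply: ih => //; rewrite /nz /= xw eqxx v1x; exact: ss1.
    have -> : Z (simplex [:: w, v2 & s]) x = 0.
      by apply: ih => //; rewrite /nz /= xw eqxx v2x; exact: ss1.
    by rewrite addr0.
  have [rl|rg|req] := ltgtP (dotv x v1 / dotv x v2) 1; last by rewrite req eqxx in r1.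
    exact: same.
  rewrite (valuation_perm _ _ (perm_swap2 _ _ _)); apply: same => //.
    by rewrite -invf_div invr_gt0.
  by rewrite -invf_div invf_lt1.
move=> v1x v2x fs sn ss.
have [e|] := eqVneq (dotv x v1) (dotv x v2); last exact: distinct.
(* Moving [x] along [u] changes only the first dot; a step shorter than [|dotv x v1|] keeps it
   nonzero. *)
have [u uE] := dual_functional (fun i => (i == 0)%:R) fs.
have u1 : dotv u v1 = 1 by apply: (uE 0).
have u2 : dotv u v2 = 0 by apply: (uE 1).
have us v : v \in s -> dotv u v = 0.
  by move=> vs; rewrite -(nth_index 0 vs); apply: (uE (index v s).+2); rewrite /= !ltnS index_mem.
have po := polytope_o_simplex [:: v1, v2 & s].
have d0 : 0 < `|dotv x v1| by rewrite normr_gt0.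
apply: (cvg_at_right_eq0 d0 (@Zcont _ po x u)) => t t0 tl.
apply: distinct => //.
- rewrite dotvDl dotvZl u1 mulr1 addr_eq0; apply/eqP => e'.
  by move: tl; rewrite e' normrN gtr0_norm // ltxx.
- by rewrite dotvDl dotvZl u2 mulr0 addr0.
- rewrite (@eq_in_count _ _ (fun v => dotv x v != 0)) // => v vs.
  by rewrite dotvDl dotvZl us // mulr0 addr0.
- by rewrite !dotvDl !dotvZl u1 u2 mulr1 mulr0 addr0 e addrC -subr_eq0 addrK gt_eqF.
Qed.

Theorem valuation_eq0 P x : polytope_o P -> Z P x = 0.
Proof.
move=> po; apply: (@Z_polytope R n (fun P => Z P x)) po => [{}P g po h1 h2 h3|s fs].
  have U : (P `&` halfspace g) `|` (P `&` halfspace (- g)) = P.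
    apply/seteqP; split=> y; first by case=> -[].
    move=> Py; have [h|/ltW h] := leP (dotv g y) 0; [left|right]; split=> //.
    by rewrite /halfspace /= dotvNl oppr_le0.
  have I : (P `&` halfspace g) `&` (P `&` halfspace (- g)) = P `&` halfspace g `&` halfspace (- g).
    by apply/seteqP; split=> y [[h4 h5] h6]; split=> //; case: h6.
  have := @Zval _ _ (polytope_o_half g po) (polytope_o_half (- g) po).
  rewrite U I => /(_ po (polytope_o_half (- g) (polytope_o_half g po)) x).
  by rewrite h1 h2 h3 !addr0.
have := free_size fs; rewrite leq_eqVlt => /orP[/eqP sn|sn].
  exact: top_simplices_eq0.
exact: Zsimple.
Qed.

End TopSimplices.
End Uniqueness.

(** * Vanishing of the planar coefficients *)

Section MaxSeq.
Variable R : realType.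
Implicit Type y : seq R.

Definition max0 y : R := \big[Num.max/0]_(t <- y) t.

Lemma max0_ge0 y : 0 <= max0 y.
Proof. by rewrite /max0; elim/big_rec: _ => // t u _ u0; rewrite le_max u0 orbT. Qed.

Lemma max0_ge y t : t \in y -> t <= max0 y.
Proof.
rewrite /max0; elim: y => // u y ih; rewrite inE big_cons le_max => /orP[/eqP ->|/ih ->].
  by rewrite lexx.
by rewrite orbT.
Qed.

Lemma max0_le y (M : R) : 0 <= M -> (forall t, t \in y -> t <= M) -> max0 y <= M.
Proof.
move=> M0 h; rewrite /max0 big_seq; elim/big_rec: _ => // t u ty uM.
by rewrite ge_max uM h.
Qed.

Lemma max0_unit y : all (fun t => 0 <= t <= 1) y -> 1 \in y -> max0 y = 1.
Proof.
move=> /allP h y1; apply/eqP; rewrite eq_le max0_ge // andbT.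
by apply: max0_le => // t /h /andP[].
Qed.

Lemma max0_opp y : all (fun t => 0 <= t <= 1) y -> max0 (map -%R y) = 0.
Proof.
move=> /allP h; apply/eqP; rewrite eq_le max0_ge0 andbT.
by apply: max0_le => // _ /mapP[t /h /andP[t0 _] ->]; rewrite oppr_le0.
Qed.

End MaxSeq.

(** At [p = 1] the two sides agree, which is why that case calls for a different convexity test. *)
Lemma powR_half_lt (R : realType) (p : R) : 1 < p -> powR 2^-1 p < 2^-1.
Proof.
move=> p1; have p0 : 0 < p by lra.
rewrite -(mulr_powRB1 _ p0) ?invr_ge0 // -[X in _ < X]mulr1 ltr_pM2l ?invr_gt0 //.
have : powR 2^-1 (p - 1) < powR 1 (p - 1).
  by rewrite gt0_ltr_powR ?subr_gt0 ?nnegrE ?invr_ge0 ?invf_lt1 // ltr1n.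
by rewrite powR1.
Qed.

Local Ltac perm_concrete := apply/seq.permP => ? /=; ring.

Section Coefficients.
Variables (R : realType) (n : nat) (Phi Z : set 'cV[R]_n -> 'cV[R]_n -> R) (p a b : R).
Implicit Types (x u v w g : 'cV[R]_n) (s : seq 'cV[R]_n) (y z : seq R).
Hypothesis p0 : 0 < p.
Hypothesis Zval : is_valuation Z.
Hypothesis Zcov : SL_covariant Z.
Hypothesis Zhom : homogeneous p Z.
Hypothesis Zcont : ray_continuous Z.
Hypothesis Zpt : forall x, Z (simplex [::]) x = 0.
Local Notation G := (face_val Z).
Hypothesis Zseg : forall a : R, G [:: a] = 0.
Hypothesis PhiE : forall s x, Phi (simplex s) x = Z (simplex s) x +
  a * powR (max0 (map (dotv x) s)) p + b * powR (max0 (map -%R (map (dotv x) s))) p.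
Hypothesis Phi_ge0 : forall s x, 0 <= Phi (simplex s) x.
Hypothesis Phi_convex : forall s x x',
  Phi (simplex s) (2^-1 *: (x + x')) <= 2^-1 * (Phi (simplex s) x + Phi (simplex s) x').

Local Notation c := (G [:: 1; 0]).
Local Notation q := (powR (2^-1 : R) p).

(** For such dots the support terms reduce to the constant [a], so the convexity of [Phi] between
    such points is a condition on [Z] alone. *)
Lemma Phi_unit_dots s x : all (fun t => 0 <= t <= 1) (map (dotv x) s) ->
  1 \in map (dotv x) s -> Phi (simplex s) x = Z (simplex s) x + a.
Proof.
move=> h1 h2; rewrite PhiE max0_unit // max0_opp // powR1 powR0 ?gt_eqF //.
by rewrite mulr1 mulr0 addr0.
Qed.

Lemma lower_bound y s x : map (dotv x) s = y ->
  - (a * powR (max0 y) p + b * powR (max0 (map -%R y)) p) <= Z (simplex s) x.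
Proof. by move=> <-; have := Phi_ge0 s x; rewrite PhiE; lra. Qed.

Let perm := face_val_perm p0 Zcov Zhom Zcont Zpt.
Let eq2 := face_val_eq2 p0 Zval Zcov Zhom Zcont Zpt.
Let cut := face_val_cut p0 Zval Zcov Zhom Zcont Zpt.

Let half0 : 0 < (2^-1 : R). Proof. by rewrite invr_gt0. Qed.
Let half1 : (2^-1 : R) < 1. Proof. by rewrite invf_lt1 // ltr1n. Qed.
Lemma face_val_half0 : G [:: 2^-1; 0] = q * c.
Proof. by rewrite -(face_valZ Zhom) ?(ltW half0) //= mulr1 mulr0. Qed.

(** Cut the dots (1, 0) at their midpoint; the cutting face is a segment and contributes 0. *)
Lemma face_val_1half : (2 < n)%N -> G [:: 1; 2^-1] = (1 - q) * c.
Proof.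
move=> n2; have := cut 1 0 (z := [::]) n2 half0 half1.
rewrite /= !mulr1 !mulr0 addr0 (_ : 1 - 2^-1 = 2^-1 :> R); last by field.
rewrite Zseg face_val_half0; lra.
Qed.

Lemma vec_mid y z : size y = size z ->
  2^-1 *: (vec n y + vec n z) = vec n [seq 2^-1 * (t.1 + t.2) | t <- zip y z].
Proof.
move=> e; apply/colP => i; rewrite !mxE; have [lt|ge] := ltnP i (size y).
  by rewrite (nth_map (0, 0)) ?size_zip -?e ?minnn // nth_zip.
by rewrite !nth_default ?size_map ?size_zip -?e ?minnn // addr0 mulr0.
Qed.

(* Convexity of Phi along the dots (1, 0), (1, 1/2), (1, 1) reads (1/2 - 2^-p) c <= 0. *)
Lemma coeff_le0_gt1 : (2 < n)%N -> 1 < p -> c <= 0.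
Proof.
move=> n2 p1.
have dots (y1 y2 : R) : map (dotv (vec n [:: y1; y2])) (std_frame R n 2) = [:: y1; y2].
  by apply: (dots_vec (y := [:: y1; y2])); exact: ltnW.
have Phi2 (t : R) : 0 <= t -> t <= 1 -> Phi (simplex (std_frame R n 2)) (vec n [:: 1; t]) = G [:: 1; t] + a.
  by move=> t0 t1; rewrite Phi_unit_dots ?dots //= ?mem_head // t0 t1 ler01 lexx.
have := Phi_convex (std_frame R n 2) (vec n [:: 1; 0]) (vec n [:: 1; 1]).
rewrite vec_mid //= add0r mulr1 (_ : 2^-1 * (1 + 1) = 1); last by field.
rewrite (Phi2 0 (lexx _) ler01) (Phi2 1 ler01 (lexx _)) (Phi2 _ (ltW half0) (ltW half1)).
rewrite face_val_1half // eq2 // Zseg.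
have := powR_half_lt p1 => hq h; rewrite leNgt; apply/negP => c0.
nra.
Qed.

Lemma vol_scale (e : R) v s : (size (v :: s) <= n)%N ->
  vol (e *: v :: s) = `|e| * vol (v :: s).
Proof.
move=> sn; move: sn; rewrite leq_eqVlt => /orP[/eqP sn|sn]; last first.
  by rewrite /vol !det_cols_short // normr0 mulr0.
by have := det_colsZ (s := [::]) e sn; rewrite /vol /= => ->; rewrite normrM.
Qed.

Lemma free_scale (e : R) v s : free (v :: s) -> e != 0 -> free (e *: v :: s).
Proof. by move=> fs e0; apply: (free_replace fs (r := 0) (c := e)); rewrite ?mem0v ?addr0. Qed.

(** Shrinking the first vector multiplies the volume by [|e|], while dividing the first coordinate
    of the point by [e] keeps the dots; letting [e] tend to 0 then removes the volume terms. *)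
Let frame (e : R) d := e *: basis_vec R n 0 :: map (basis_vec R n) (iota 1 d).

Let dots_frame e (y0 : R) y : e != 0 -> (size y < n)%N ->
  map (dotv (vec n (y0 / e :: y))) (frame e (size y)) = y0 :: y.
Proof.
move=> e0 yn; have := dots_vec (y := y0 / e :: y) yn.
by rewrite /frame /= dotvZr => -[-> ->]; rewrite mulrC divfK.
Qed.

Let free_frame e d : e != 0 -> (d < n)%N -> free (frame e d).
Proof. by move=> e0 dn; apply: free_scale => //; have := free_std_frame R dn. Qed.

Let vol_frame e d : (d < n)%N -> vol (frame e d) = `|e| * vol (frame 1 d).
Proof.
by move=> dn; rewrite /frame !vol_scale ?normr1 ?mul1r //= size_map size_iota.
Qed.

Lemma equal_dots_frame (t : R) z (y0 : R) y : (size y < n)%N -> perm_eq (y0 :: y) [:: t, t & z] ->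
  exists k, forall e, e != 0 ->
    Z (simplex (frame e (size y))) (vec n (y0 / e :: y)) = G (t :: z) + `|e| * k.
Proof.
move=> yn pyz; have zn : (size z + 2 <= n)%N.
  by have := perm_size pyz; rewrite /= addn2 => <-.
have [k _ kE] := equal_dots p0 Zval Zcov Zhom Zcont Zpt zn (@lower_bound [:: t, t & z]).
exists (vol (frame 1 (size y)) * k) => e e0.
by rewrite kE ?free_frame ?dots_frame // vol_frame // mulrA.
Qed.

(** Midpoint convexity from the dots (1, 1, 0) and (1, 0, 1) to (1, 1/2, 1/2). Each list repeats a
    dot, so up to multiples of [e] the values are [c], [c] and [(1 - q) * c], and [(1 - q) * c <= c]
    remains in the limit. *)
Lemma coeff_ge0 : (2 < n)%N -> 0 <= c.
Proof.
move=> n2; pose h : R := 2^-1.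
have [k1 E1] := @equal_dots_frame 1 [:: 0] 1 [:: 1; 0] n2 (perm_refl _).
have p2 : perm_eq [:: 1; 0; 1] [:: 1; 1; 0 : R] by perm_concrete.
have [k2 E2] := @equal_dots_frame 1 [:: 0] 1 [:: 0; 1] n2 p2.
have p3 : perm_eq [:: 1; h; h] [:: h; h; 1] by perm_concrete.
have [k3 E3] := @equal_dots_frame h [:: 1] 1 [:: h; h] n2 p3.
have hE : G [:: h; 1] = (1 - q) * c.
  by rewrite -face_val_1half //; apply: perm => //; exact: perm_swap2.
have h01 : 0 <= h <= 1 by rewrite !ltW.
suff : - (q * c) <= 0 by rewrite oppr_le0 pmulr_rge0.
apply: (@infinitesimal_le0 _ _ (2^-1 * (k1 + k2) - k3)) => e e0.
have en0 := lt0r_neq0 e0.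
have := Phi_convex (frame e 2) (vec n [:: 1 / e; 1; 0]) (vec n [:: 1 / e; 0; 1]).
rewrite vec_mid //= !addr0 !add0r !mulr1 -/h (_ : 2^-1 * (1 / e + 1 / e) = 1 / e); last first.
  by field.
have d (y1 y2 : R) : map (dotv (vec n [:: 1 / e; y1; y2])) (frame e 2) = [:: 1; y1; y2].
  exact: (@dots_frame e 1 [:: y1; y2]).
rewrite !Phi_unit_dots ?d ?mem_head //= ?h01 ?lexx ?ler01 //.
rewrite (E1 _ en0) (E2 _ en0) (E3 _ en0) hE (gtr0_norm e0) /h; lra.
Qed.

(* The bipyramid conv(-v, v, w1, w2, w3) sees the minimum of the dots of the w's,
   which is not convex. *)
Lemma coeff_le0_gt3 : (3 < n)%N -> c <= 0.
Proof.
move=> n3; have n2 : (2 < n)%N by exact: ltnW.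
pose h : R := 2^-1.
have h01 : 0 <= h <= 1 by rewrite !ltW.
have hE : G [:: h; 1] = (1 - q) * c.
  by rewrite -face_val_1half //; apply: perm => //; exact: perm_swap2.
have G01 : G [:: 0; 1] = c by apply: perm => //; exact: perm_swap2.
(* Cutting the dots (1, 0) beside a third dot 1/2 leaves only lists with repeated dots, of values
   [(1 - q) * c] and [q * c]. *)
have G3 : G [:: h; 0; 1] = c.
  have -> : G [:: h; 0; 1] = G [:: 1; 0; h] by apply: perm => //; perm_concrete.
  have := cut 1 0 (z := [:: h]) n3 half0 half1.
  rewrite /= !mulr1 !mulr0 addr0 (_ : 1 - 2^-1 = h); last by rewrite /h; field.
  rewrite eq2 // Zseg addr0 => ->.
  have -> : G [:: 1; h; h] = G [:: h; h; 1] by apply: perm => //; perm_concrete.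
  have -> : G [:: h; 0; h] = G [:: h; h; 0] by apply: perm => //; perm_concrete.
  rewrite !eq2 // hE face_val_half0; lra.
have [k1 E1] := @equal_dots_frame 1 [:: 0; 0] 0 [:: 1; 1; 0] n3 ltac:(perm_concrete).
have [k2 E2] := @equal_dots_frame 1 [:: 0; 0] 0 [:: 1; 0; 1] n3 ltac:(perm_concrete).
have [k3 E3] := @equal_dots_frame h [:: 0; 1] 0 [:: 1; h; h] n3 ltac:(perm_concrete).
have G11 : G [:: 1; 1; 0] = c by rewrite eq2.
have G12 : G [:: 1; 0; 1] = c by rewrite -G11; apply: perm => //; perm_concrete.
have G13 : G [:: 1; h; h] = (1 - q) * c.
  by rewrite -hE -eq2 //; apply: perm => //; perm_concrete.
have G100 : G [:: 1; 0; 0] = c.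
  by rewrite (perm (z := [:: 0; 0; 1])) ?eq2 //; perm_concrete.
suff : q * c <= 0 by rewrite pmulr_rle0.
apply: (@infinitesimal_le0 _ _ (k1 + k2 - 2 * k3)) => e e0.
pose b0 := basis_vec R n 0; pose bs := map (basis_vec R n) (iota 1 3).
have en0 := lt0r_neq0 e0.
have n0 : (0 < n)%N by exact: leq_ltn_trans n3.
have b00 : dotv b0 b0 = 1 by rewrite (dotv_basis_vec _ (Ordinal n0)) mxE.
have b0s v : v \in bs -> dotv b0 v = 0.
  move=> /mapP[i]; rewrite mem_iota => /andP[i1 i4] ->.
  have i_n : (i < n)%N by exact: leq_trans i4 _.
  by rewrite (dotv_basis_vec _ (Ordinal i_n)) mxE /= gtn_eqF.
have fbs : free bs by have := free_std_frame R n3; rewrite free_cons => /andP[].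
have dbs (y0 y1 y2 y3 : R) : map (dotv (vec n [:: y0; y1; y2; y3])) bs = [:: y1; y2; y3].
  by have := dots_vec (y := [:: y0; y1; y2; y3]) n3; rewrite /bs /= => -[_ -> -> ->].
have dP (e' y1 y2 y3 : R) : dotv (vec n [:: 0; y1; y2; y3]) (e' *: b0) = 0.
  by rewrite dotvZr (dotv_basis_vec _ (Ordinal n0)) mxE mulr0.
(* The hyperplane orthogonal to [b0] splits the bipyramid into two frames, so its value is their sum
   minus that of the common face. At (1, 1, 0), (1, 0, 1) and (1, 1/2, 1/2) this is [c], [c] and
   [(1 + q) * c] up to multiples of [e]. *)
pose P := [:: - e *: b0, e *: b0 & bs].
have ZP (y1 y2 y3 : R) x : x = vec n [:: 0; y1; y2; y3] ->
    Z (simplex P) x + G [:: y1; y2; y3]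
      = Z (simplex (frame (- e) 3)) (vec n [:: 0 / - e; y1; y2; y3])
      + Z (simplex (frame e 3)) (vec n [:: 0 / e; y1; y2; y3]).
  move=> ->; rewrite !mul0r.
  rewrite -(@valuation_cut_gen _ _ _ Zval bs (- e *: b0) (e *: b0) b0 2^-1) //.
  - by congr (_ + _); rewrite (valuation_face p0 Zcov Zhom Zcont Zpt) ?dbs.
  - rewrite (_ : _ + _ = 0); first exact: simplex0.
    by apply/colP => i; rewrite !mxE; field.
  - by rewrite dotvZr b00 mulr1 oppr_lt0.
  - by rewrite dotvZr b00 mulr1.
have PhiP (y1 y2 y3 : R) : all (fun t => 0 <= t <= 1) [:: y1; y2; y3] -> 1 \in [:: y1; y2; y3] ->
    Phi (simplex P) (vec n [:: 0; y1; y2; y3]) = Z (simplex P) (vec n [:: 0; y1; y2; y3]) + a.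
  move=> ya y1in; apply: Phi_unit_dots; rewrite /P 2!map_cons !dP dbs.
    by move: ya; rewrite /= lexx ler01.
  by rewrite in_cons in_cons y1in !orbT.
have := Phi_convex P (vec n [:: 0; 1; 1; 0]) (vec n [:: 0; 1; 0; 1]).
rewrite vec_mid //= !addr0 !add0r !mulr1 mulr0 (_ : 2^-1 * (1 + 1) = 1); last by field.
rewrite -/h !PhiP ?mem_head //= ?h01 ?lexx ?ler01 //.
have eN0 : - e != 0 by rewrite oppr_eq0.
have := ZP 1 1 0 _ erefl; have := ZP 1 0 1 _ erefl; have := ZP 1 h h _ erefl.
rewrite (E1 _ en0) (E1 _ eN0) (E2 _ en0) (E2 _ eN0) (E3 _ en0) (E3 _ eN0).
rewrite normrN (gtr0_norm e0) G3 G100 G11 G12 G13 /h; lra.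
Qed.

End Coefficients.

(** * Support functions *)

Section ConvexFunctions.
Variables (R : realType) (n : nat).
Implicit Types (x u y : 'cV[R]_n).

Definition convex_fun (f : 'cV[R]_n -> R) := forall x y (t : R), 0 <= t -> t <= 1 ->
  f ((1 - t) *: x + t *: y) <= (1 - t) * f x + t * f y.

Lemma powR_convex (p a b t : R) : 1 <= p -> 0 <= a -> 0 <= b -> 0 <= t -> t <= 1 ->
  powR ((1 - t) * a + t * b) p <= (1 - t) * powR a p + t * powR b p.
Proof.
move=> p1 a0 b0 t0 t1.
have := convex_powR p1 (Itv01 t0 t1) (x := b) (y := a).
rewrite !inE /= !in_itv /= !andbT => /(_ b0 a0).
by rewrite addrC [X in _ <= X]addrC.
Qed.

Lemma powR_convex_fun (p : R) (f : 'cV[R]_n -> R) : 1 <= p ->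
  (forall x, 0 <= f x) -> convex_fun f -> convex_fun (fun x => powR (f x) p).
Proof.
move=> p1 f0 cf x y t t0 t1; apply: le_trans (powR_convex p1 (f0 x) (f0 y) t0 t1).
have t1' : 0 <= 1 - t by rewrite subr_ge0.
apply: ge0_ler_powR; rewrite ?nnegrE ?f0 //; last exact: cf.
  by rewrite (le_trans ler01).
by rewrite addr_ge0 // mulr_ge0.
Qed.

(** Squeeze: the upper bound is convexity between [x] and [x + u]; the lower one comes from writing
    [x] as a combination of [x + e *: u] and [x - u] with weight [e / (1 + e)] on the latter. *)
Lemma convex_fun_cvg (f : 'cV[R]_n -> R) x u : convex_fun f ->
  f (x + e *: u) @[e --> 0^'+] --> f x.
Proof.
move=> cf.
apply: (@squeeze_cvgr _ _ _ _ (fun e => (1 + e) * f x - e * f (x - u))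
  (fun e => (1 - e) * f x + e * f (x + u))).
- near=> e; have e0 : 0 < e by near: e; exact: nbhs_right_gt.
  have e1 : e <= 1 by near: e; apply: nbhs_right_le.
  have e1' : 1 + e != 0 by rewrite gt_eqF // addr_gt0.
  apply/andP; split; last first.
    have -> : x + e *: u = (1 - e) *: x + e *: (x + u).
      by apply/colP => i; rewrite !mxE; ring.
    by apply: cf => //; exact: ltW.
  have := cf (x + e *: u) (x - u) (e / (1 + e)).
  have -> : (1 - e / (1 + e)) *: (x + e *: u) + (e / (1 + e)) *: (x - u) = x.
    by apply/colP => i; rewrite !mxE; field.
  have -> : 1 - e / (1 + e) = (1 + e)^-1 by field.
  have e2 : 0 < 1 + e by rewrite addr_gt0.
  have d0 : 0 <= e / (1 + e) by rewrite divr_ge0 // ltW.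
  have d1 : e / (1 + e) <= 1 by rewrite ler_pdivrMr // mul1r lerDr.
  move=> /(_ d0 d1); set F := f (x + e *: u); set B := f (x - u).
  have -> : (1 + e)^-1 * F + e / (1 + e) * B = (F + e * B) / (1 + e) by field.
  by rewrite ler_pdivlMr //; lra.
- have : (1 + e) * f x - e * f (x - u) @[e --> 0^'+] --> (1 + 0) * f x - 0 * f (x - u).
    apply: cvg_at_right_filter; apply: cvgB; apply: cvgMl; last exact: cvg_id.
    by apply: cvgD; [exact: cvg_cst|exact: cvg_id].
  by rewrite addr0 mul1r mul0r subr0.
- have : (1 - e) * f x + e * f (x + u) @[e --> 0^'+] --> (1 - 0) * f x + 0 * f (x + u).
    apply: cvg_at_right_filter; apply: cvgD; apply: cvgMl; last exact: cvg_id.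
    by apply: cvgB; [exact: cvg_cst|exact: cvg_id].
  by rewrite subr0 mul1r mul0r addr0.
Unshelve. all: by end_near.
Qed.

End ConvexFunctions.

Section SupportFunction.
Variables (R : realType) (n : nat).
Implicit Types (x u y : 'cV[R]_n) (s : seq 'cV[R]_n) (K L : set 'cV[R]_n).

Lemma supp_fun_eq K x y : K y -> (forall z, K z -> dotv x z <= dotv x y) ->
  supp_fun K x = dotv x y.
Proof.
move=> Ky h; apply/eqP; rewrite eq_le; apply/andP; split.
  by apply: ge_sup; [exists (dotv x y), y|move=> _ [z Kz <-]; exact: h].
by apply: ub_le_sup; [exists (dotv x y) => _ [z Kz <-]; exact: h|exists y].
Qed.

Lemma supp_fun_attained K x : polytope_o K ->
  exists y, [/\ K y, supp_fun K x = dotv x y & forall z, K z -> dotv x z <= dotv x y].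
Proof.
move=> [[s ->] s0].
have sn : s != [::].
  apply/eqP => sn; move: s0; rewrite sn => -[w [_ [+ _]]]; rewrite big_ord0 => /eqP.
  by rewrite eq_sym oner_eq0.
have [y ys ymax] : exists2 y, y \in s & forall z, z \in s -> dotv x z <= dotv x y.
  elim: s sn {s0} => // v s ih _; have [->|sn] := eqVneq s [::].
    by exists v; rewrite ?mem_head // => z; rewrite mem_seq1 => /eqP ->.
  have [y ys h] := ih sn; have [le|lt] := leP (dotv x v) (dotv x y).
    by exists y => [|z]; rewrite inE ?ys ?orbT // => /orP[/eqP ->|/h].
  exists v => [|z]; rewrite ?mem_head // inE => /orP[/eqP ->//|/h le].
  exact: le_trans le (ltW lt).
have h : forall z, conv_hull s z -> dotv x z <= dotv x y.
  exact: (conv_hull_min (@convex_halfspace _ _ _ _)).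
by exists y; split=> //; [exact: conv_hull_mem|apply: supp_fun_eq => //; exact: conv_hull_mem].
Qed.

Lemma supp_fun_ge K x y : polytope_o K -> K y -> dotv x y <= supp_fun K x.
Proof. by move=> po Ky; have [z [_ -> h]] := supp_fun_attained x po; exact: h. Qed.

Lemma supp_fun_le K x (M : R) : polytope_o K -> (forall y, K y -> dotv x y <= M) -> supp_fun K x <= M.
Proof. by move=> po h; have [z [Kz -> _]] := supp_fun_attained x po; exact: h. Qed.

Lemma supp_fun_ge0 K x : polytope_o K -> 0 <= supp_fun K x.
Proof. by move=> po; rewrite -(dotv0r x) supp_fun_ge //; case: po. Qed.

Lemma supp_funZ K (a : R) x : polytope_o K -> 0 <= a -> supp_fun K (a *: x) = a * supp_fun K x.
Proof.
move=> po a0; have [y [Ky -> h]] := supp_fun_attained x po.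
rewrite -dotvZl; apply: supp_fun_eq => // z /h; rewrite !dotvZl; exact: ler_wpM2l.
Qed.

Lemma supp_fun_convex K : polytope_o K -> convex_fun (supp_fun K).
Proof.
move=> po x y t t0 t1; apply: supp_fun_le => // z Kz.
rewrite dotvDl !dotvZl lerD // ler_wpM2l ?subr_ge0 //; exact: supp_fun_ge.
Qed.

Lemma supp_fun_image (A : 'M[R]_n) K x :
  supp_fun ((fun y => A *m y) @` K) x = supp_fun K (A^T *m x).
Proof.
rewrite /supp_fun; congr sup; apply/seteqP; split=> r [y].
  by move=> [z Kz <-] <-; exists z; rewrite // dotv_mul.
by move=> Ky <-; exists (A *m y); [exists y|rewrite dotv_mul].
Qed.

Lemma supp_fun_opp K x : supp_fun [set - y | y in K] x = supp_fun K (- x).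
Proof.
rewrite /supp_fun; congr sup; apply/seteqP; split=> r [y].
  by move=> [z Kz <-] <-; exists z; rewrite // dotvNl dotvNr.
by move=> Ky <-; exists (- y); [exists y|rewrite dotvNl dotvNr].
Qed.

Lemma supp_fun_simplex s x : supp_fun (simplex s) x = \big[Num.max/0]_(t <- map (dotv x) s) t.
Proof.
have po := polytope_o_simplex s; apply/eqP; rewrite eq_le; apply/andP; split.
  set M := \big[Num.max/0]_(t <- _) t.
  apply: supp_fun_le => //; apply: (@simplex_min _ _ s [set y | dotv x y <= M]).
      exact: convex_halfspace.
    by rewrite /= dotv0r /M; elim/big_rec: _ => // t u _ u0; rewrite le_max u0 orbT.
  move=> v /=; rewrite /M; elim: s {po M} => // w s ih; rewrite inE big_cons le_max => /orP[/eqP ->|/ih ->].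
    by rewrite lexx.
  by rewrite orbT.
rewrite big_map big_seq; elim/big_rec: _ => [|v M vs hM]; first exact: supp_fun_ge0.
by rewrite ge_max hM andbT supp_fun_ge //; exact: simplex_mem.
Qed.

(* A segment joining maximizers of [dotv x] in K and L meets [K `&` L]. *)
Lemma supp_fun_setI K L x : polytope_o K -> polytope_o L -> polytope_o (K `|` L) ->
  polytope_o (K `&` L) -> supp_fun K x <= supp_fun L x -> supp_fun (K `&` L) x = supp_fun K x.
Proof.
move=> poK poL poU poI le; apply/eqP; rewrite eq_le; apply/andP; split.
  by apply: supp_fun_le => // y [Ky _]; exact: supp_fun_ge.
have [k [Kk kE kmax]] := supp_fun_attained x poK.
have [l [Ll lE lmax]] := supp_fun_attained x poL.
rewrite kE lE in le.
pose pt (t : R) := (1 - t) *: k + t *: l.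
(* By [le], the functional never drops below its value at [k] on the segment, so any point common to
   [K] and [L] gives the missing inequality. *)
have dpt t : 0 <= t -> t <= 1 -> dotv x k <= dotv x (pt t).
  by move=> t0 t1; rewrite dotvDr !dotvZr; nra.
have inU t : 0 <= t -> t <= 1 -> K (pt t) \/ L (pt t).
  move=> t0 t1; have [[s e] _] := poU.
  have : (K `|` L) (pt t); last by [].
  rewrite e; apply: conv_hull_convex => //; rewrite -e; [by left|by right].
rewrite kE.
suff [t [t0 t1 Kt Lt]] : exists t, [/\ 0 <= t, t <= 1, K (pt t) & L (pt t)].
  exact: le_trans (dpt t t0 t1) (supp_fun_ge _ poI (conj Kt Lt)).
pose T := [set t : R | [/\ 0 <= t, t <= 1 & K (pt t)]].
have T0 : T 0 by split=> //; rewrite /pt subr0 scale1r scale0r addr0.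
have Tub : ubound T 1 by move=> t [].
have T_sup : has_sup T by split; [exists 0|exists 1].
pose m := sup T.
have m0 : 0 <= m by apply: ub_le_sup; first by exists 1.
have m1 : m <= 1 by apply: ge_sup; first by exists 0.
(* A polytope is closed along the segment: each defining functional is Lipschitz in the parameter,
   and the added 1 keeps the constant [M] positive. *)
have closed_pt (C : set 'cV[R]_n) : polytope_o C ->
    (forall e, 0 < e -> exists t, [/\ `|t - m| < e & C (pt t)]) -> C (pt m).
  move=> poC h; have [hs _ CE] := polytope_o_halfspaces poC.
  rewrite CE => f fh; rewrite leNgt; apply/negP => fm.
  pose M := `|dotv f.1 l - dotv f.1 k| + 1.
  have M0 : 0 < M by rewrite ltr_wpDl.
  have d0 : 0 < dotv f.1 (pt m) - f.2 by rewrite subr_gt0.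
  have [t [tm Ct]] := h ((dotv f.1 (pt m) - f.2) / M) (divr_gt0 d0 M0).
  rewrite CE in Ct; have := Ct _ fh => ft.
  have e : dotv f.1 (pt m) - dotv f.1 (pt t) = (m - t) * (dotv f.1 l - dotv f.1 k).
    by rewrite !dotvDr !dotvZr; ring.
  have : (m - t) * (dotv f.1 l - dotv f.1 k) <= `|t - m| * M.
    apply: le_trans (ler_norm _) _; rewrite normrM distrC ler_wpM2l // /M; lra.
  move: tm; rewrite ltr_pdivlMr // => tm; lra.
have Km : K (pt m).
  apply: closed_pt => // e e0; have [t [t0 t1 Kt] tm] := sup_adherent e0 T_sup.
  exists t; split=> //; rewrite ltr_norml; apply/andP; split; first by rewrite ltrBrDr addrC.
  have : t <= m by apply: ub_le_sup; [exists 1|].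
  lra.
have [e1|m1'] := eqVneq m 1.
  by exists 1; split=> //; [rewrite -e1|rewrite /pt subrr scale0r scale1r add0r].
have {}m1' : m < 1 by rewrite lt_neqAle m1'.
exists m; split=> //; apply: closed_pt => // e e0.
(* A parameter just beyond the supremum: its point is not in [K], hence in [L] because the union is
   convex. *)
pose t := Num.min 1 (m + e / 2).
have mt : m < t by rewrite lt_min m1' ltrDl divr_gt0.
have t1 : t <= 1 by rewrite ge_min lexx.
have te : t <= m + e / 2 by rewrite ge_min lexx orbT.
have t0 : 0 <= t by rewrite (le_trans m0) // ltW.
exists t; split; first by rewrite ger0_norm ?subr_ge0 ?ltW //; lra.
case: (inU t t0 t1) => // Kt.
have : t <= m by apply: ub_le_sup; [exists 1|].
by rewrite leNgt mt.
Qed.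

Lemma supp_fun_setU K L x : polytope_o K -> polytope_o L -> polytope_o (K `|` L) ->
  supp_fun (K `|` L) x = Num.max (supp_fun K x) (supp_fun L x).
Proof.
move=> poK poL poU; apply/eqP; rewrite eq_le; apply/andP; split.
  apply: supp_fun_le => // y [Ky|Ly]; rewrite le_max; apply/orP; [left|right].
    exact: supp_fun_ge.
  exact: supp_fun_ge.
rewrite ge_max; apply/andP; split; apply: supp_fun_le => // y hy; apply: supp_fun_ge => //.
  by left.
by right.
Qed.

Lemma supp_fun_valuation (f : R -> R) : is_valuation (fun K x => f (supp_fun K x)).
Proof.
move=> K L poK poL poU poI x; rewrite supp_fun_setU //.
have [le|/ltW le] := leP (supp_fun K x) (supp_fun L x).
  by rewrite (supp_fun_setI poK poL) // addrC.
rewrite setIC in poI *; rewrite setUC in poU.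
by rewrite (supp_fun_setI poL poK).
Qed.

End SupportFunction.

(** * The iterated integral and linear substitutions *)

Section JointMeasurability.
Variable R : realType.
Local Notation mR := (measurableTypeR R).

(* [jmeas f] is measurability of f : X x R^n -> T, phrased by recursion on n so as
   to match the iterated integral. *)
Fixpoint jmeas (n : nat) : forall (d : measure_display) (X : measurableType d)
    (d' : measure_display) (T : measurableType d'), (X -> 'cV[R]_n -> T) -> Prop :=
  match n with
  | 0 => fun d X d' T f => measurable_fun [set: X] (fun x => f x 0)
  | n'.+1 => fun d X d' T f =>
      @jmeas n' _ (X * mR)%type _ T (fun x y => f x.1 (cons_cV x.2 y))
  end.

Lemma jmeas_comp n (d : measure_display) (X : measurableType d)
  (d1 : measure_display) (T1 : measurableType d1) (d2 : measure_display) (T2 : measurableType d2)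
  (h : T1 -> T2) (f : X -> 'cV[R]_n -> T1) :
  measurable_fun setT h -> jmeas f -> jmeas (fun x y => h (f x y)).
Proof.
move=> mh; elim: n d X f => [|n ih] d X f /=; first exact: measurableT_comp.
exact: ih.
Qed.

Lemma jmeas_pair n (d : measure_display) (X : measurableType d)
  (d1 : measure_display) (T1 : measurableType d1) (d2 : measure_display) (T2 : measurableType d2)
  (f : X -> 'cV[R]_n -> T1) (g : X -> 'cV[R]_n -> T2) :
  jmeas f -> jmeas g -> @jmeas n _ X _ (T1 * T2)%type (fun x y => (f x y, g x y)).
Proof.
elim: n d X f g => [|n ih] d X f g /=; first exact: measurable_fun_pair.
exact: ih.
Qed.

Lemma jmeas_fst n (d : measure_display) (X : measurableType d) (d' : measure_display)
  (T : measurableType d') (g : X -> T) : measurable_fun setT g ->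
  jmeas (fun x (_ : 'cV[R]_n) => g x).
Proof.
elim: n d X g => [|n ih] d X g mg //=.
by apply: (ih _ (X * mR)%type (fun x => g x.1)); apply: measurableT_comp.
Qed.

Lemma eq_jmeas n (d : measure_display) (X : measurableType d) (d' : measure_display)
  (T : measurableType d') (f g : X -> 'cV[R]_n -> T) :
  (forall x y, f x y = g x y) -> jmeas f -> jmeas g.
Proof. by move=> fg; have -> : f = g by apply/funext => x; apply/funext => y. Qed.

Lemma jmeas_coord n (d : measure_display) (X : measurableType d) (i : 'I_n) :
  @jmeas n _ X _ mR (fun _ y => y i 0).
Proof.
elim: n d X i => [|n ih] d X i; first by case: i.
rewrite /=; case: (unliftP ord0 i) => [j ->|->].
  by apply: eq_jmeas (ih _ _ j) => x y; rewrite cons_cV_lift.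
apply: (@eq_jmeas _ _ _ _ _ (fun x _ => x.2)); first by move=> x y; rewrite cons_cV0.
by apply: jmeas_fst; exact: measurable_snd.
Qed.

(** Peeling the first coordinate of [g] moves it into the parameter of [f], so the induction has to
    range over all parameter spaces. *)
Lemma jmeas_subst n m (d : measure_display) (X : measurableType d) (d' : measure_display)
  (X' : measurableType d') (d'' : measure_display) (T : measurableType d'')
  (f : X -> 'cV[R]_n -> T) (phi : X' -> 'cV[R]_m -> X) (g : X' -> 'cV[R]_m -> 'cV[R]_n) :
  jmeas f -> jmeas phi -> (forall i, @jmeas m _ X' _ mR (fun x y => g x y i 0)) ->
  jmeas (fun x y => f (phi x y) (g x y)).
Proof.
elim: n d X f phi g => [|n ih] d X f phi g /= mf mphi mg.
  apply: (@eq_jmeas _ _ _ _ _ (fun x y => f (phi x y) 0)).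
    by move=> x y; rewrite (flatmx0 (g x y)).
  exact: (jmeas_comp mf mphi).
apply: (@eq_jmeas _ _ _ _ _ (fun x y =>
    (fun xt z => f xt.1 (cons_cV xt.2 z)) (phi x y, g x y 0 0) (tail_cV (g x y)))).
  by move=> x y /=; rewrite cons_cV_tail.
apply: (ih _ (X * mR)%type (fun xt z => f xt.1 (cons_cV xt.2 z)) _ _ mf).
  exact: jmeas_pair.
by move=> i; apply: eq_jmeas (mg (lift ord0 i)) => x y; rewrite mxE.
Qed.

Lemma lebesgue_int_n_ge0 n (f : 'cV[R]_n -> \bar R) : (forall y, 0 <= f y)%E ->
  (0 <= lebesgue_int_n f)%E.
Proof. by elim: n f => [|n ih] f f0 //=; apply: integral_ge0 => t _; exact: ih. Qed.

Lemma measurable_lebesgue_int_n n (d : measure_display) (X : measurableType d)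
  (f : X -> 'cV[R]_n -> \bar R) : (forall x y, 0 <= f x y)%E -> jmeas f ->
  measurable_fun setT (fun x => lebesgue_int_n (f x)).
Proof.
elim: n d X f => [|n ih] d X f f0 mf //=.
apply: (measurable_fun_fubini_tonelli_F (m2 := @lebesgue_measure R)
  (fun xt : X * mR => lebesgue_int_n (fun y => f xt.1 (cons_cV xt.2 y)))).
  by apply: (ih _ (X * mR)%type (fun xt y => f xt.1 (cons_cV xt.2 y))).
by move=> xt; apply: lebesgue_int_n_ge0.
Qed.

Definition cV_meas n (f : 'cV[R]_n -> \bar R) : Prop :=
  jmeas (fun (_ : unit) (y : 'cV[R]_n) => f y).

Lemma cV_meas_subst n m (d : measure_display) (X : measurableType d) (f : 'cV[R]_n -> \bar R)
  (g : X -> 'cV[R]_m -> 'cV[R]_n) : cV_meas f ->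
  (forall i, @jmeas m _ X _ mR (fun x y => g x y i 0)) ->
  jmeas (fun x y => f (g x y)).
Proof.
move=> mf mg; apply: (jmeas_subst (phi := fun _ _ => tt) mf _ mg).
by apply: (@jmeas_fst _ _ _ _ unit (fun=> tt)); exact: measurable_cst.
Qed.

Lemma jmeas_add n (d : measure_display) (X : measurableType d) (f g : X -> 'cV[R]_n -> R) :
  @jmeas n _ X _ mR f -> @jmeas n _ X _ mR g -> @jmeas n _ X _ mR (fun x y => f x y + g x y).
Proof.
move=> mf mg; apply: (jmeas_comp (h := fun ab : mR * mR => ab.1 + ab.2 : mR)) (jmeas_pair mf mg).
by apply: measurable_funD; [exact: measurable_fst|exact: measurable_snd].
Qed.

Lemma jmeas_mul n (d : measure_display) (X : measurableType d) (f g : X -> 'cV[R]_n -> R) :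
  @jmeas n _ X _ mR f -> @jmeas n _ X _ mR g -> @jmeas n _ X _ mR (fun x y => f x y * g x y).
Proof.
move=> mf mg; apply: (jmeas_comp (h := fun ab : mR * mR => ab.1 * ab.2 : mR)) (jmeas_pair mf mg).
by apply: measurable_funM; [exact: measurable_fst|exact: measurable_snd].
Qed.

Lemma jmeas_cst n (d : measure_display) (X : measurableType d) (a : R) :
  @jmeas n _ X _ mR (fun _ _ => a).
Proof. by apply: (@jmeas_fst _ _ _ _ mR (fun=> a)); exact: measurable_cst. Qed.

Lemma jmeas_affine n m (d : measure_display) (X : measurableType d)
  (A : 'M[R]_(n, m)) (b : X -> 'cV[R]_n) i :
  measurable_fun setT (fun x => b x i 0 : mR) ->
  @jmeas m _ X _ mR (fun x y => (b x + A *m y) i 0).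
Proof.
move=> mb; apply: (@eq_jmeas _ _ _ _ mR (fun x y => b x i 0 + \sum_j A i j * y j 0)).
  by move=> x y; rewrite !mxE.
apply: jmeas_add; first exact: jmeas_fst.
elim: (index_enum _) => [|j r ih].
  by apply: eq_jmeas (@jmeas_cst _ _ _ 0) => x y; rewrite big_nil.
apply: (@eq_jmeas _ _ _ _ mR (fun x y => A i j * y j 0 + \sum_(j <- r) A i j * y j 0)).
  by move=> x y; rewrite big_cons.
by apply: jmeas_add => //; apply: jmeas_mul; [exact: jmeas_cst|exact: jmeas_coord].
Qed.

Lemma cV_meas_affine n m (f : 'cV[R]_n -> \bar R) (A : 'M[R]_(n, m)) (b : 'cV[R]_n) :
  cV_meas f -> cV_meas (fun y => f (b + A *m y)).
Proof.
move=> mf; apply: (cV_meas_subst (g := fun _ y => b + A *m y) mf) => i.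
by apply: (@jmeas_affine n m _ unit A (fun=> b)); exact: measurable_cst.
Qed.

Lemma jmeas_cons n m (d : measure_display) (X : measurableType d) (t : X -> R)
  (g : X -> 'cV[R]_m -> 'cV[R]_n) i : measurable_fun setT (t : X -> mR) ->
  (forall j, @jmeas m _ X _ mR (fun x y => g x y j 0)) ->
  @jmeas m _ X _ mR (fun x y => cons_cV (t x) (g x y) i 0).
Proof.
move=> mt mg; case: (unliftP ord0 i) => [j ->|->].
  by apply: eq_jmeas (mg j) => x y; rewrite cons_cV_lift.
apply: (@eq_jmeas _ _ _ _ mR (fun x _ => t x)); first by move=> x y; rewrite cons_cV0.
exact: jmeas_fst.
Qed.

Lemma cV_meas_cons n (f : 'cV[R]_n.+1 -> \bar R) : cV_meas f ->
  @jmeas n _ mR _ _ (fun t y => f (cons_cV t y)).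
Proof.
move=> mf; apply: (cV_meas_subst mf) => i.
by apply: (@jmeas_cons n n _ mR id (fun _ y => y)) => // j; exact: jmeas_coord.
Qed.

Lemma cV_meas_cons1 n (f : 'cV[R]_n.+1 -> \bar R) t : cV_meas f ->
  cV_meas (fun y => f (cons_cV t y)).
Proof.
move=> mf; apply: (cV_meas_subst (g := fun _ y => cons_cV t y) mf) => i.
by apply: (@jmeas_cons n n _ unit (fun=> t) (fun _ y => y)) => // j; exact: jmeas_coord.
Qed.

Lemma measurable_slice n (f : 'cV[R]_n.+1 -> \bar R) : (forall y, 0 <= f y)%E -> cV_meas f ->
  measurable_fun setT (fun t : mR => lebesgue_int_n (fun y => f (cons_cV t y))).
Proof. by move=> f0 mf; apply: measurable_lebesgue_int_n => //; exact: cV_meas_cons. Qed.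

End JointMeasurability.

Section AffineSubstitution.
Variable R : realType.
Local Notation mR := (measurableTypeR R).
Local Notation mu := (@lebesgue_measure R).
Local Open Scope ereal_scope.

(** Uniqueness of Lebesgue measure: [|a|] times the image measure has the right value on the
    intervals []c, d]]. For negative [a] their preimages are closed on the left instead, with the
    same length. *)
Lemma lebesgue_measure_affine (a b : R) (A : set R) : a != 0%R -> measurable A ->
  mu ((fun t : R => a * t + b)%R @^-1` A) = (`|a|^-1)%:E * mu A.
Proof.
move=> a0 mA; pose phi : mR -> mR := fun t => (a * t + b)%R.
have mphi : measurable_fun setT phi.
  apply: measurable_funD; last exact: measurable_cst.
  by apply: measurable_funM; [exact: measurable_cst|exact: measurable_id].
pose r : {nonneg R} := NngNum (normr_ge0 a).
have := @lebesgue_measure_unique R (mscale r (pushforward mu phi)).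
move=> /(_ mphi _ A mA) ->; last first.
  move=> _ [[c d]] _ <-; transitivity ((`|a|)%:E * mu (phi @^-1` `]c, d]%classic)); last by [].
  have [an|ap|e] := ltgtP a 0%R; last by rewrite e eqxx in a0.
    rewrite [X in _ * lebesgue_measure X](_ : _ = `[((d - b) / a)%R, ((c - b) / a)%R[%classic); last first.
      apply/seteqP; split=> t; rewrite /phi /= !in_itv /= => /andP[h1 h2]; apply/andP; split.
      + by rewrite ler_ndivrMr // mulrC; lra.
      + by rewrite ltr_ndivlMr // mulrC; lra.
      + by move: h2; rewrite ltr_ndivlMr // mulrC; lra.
      + by move: h1; rewrite ler_ndivrMr // mulrC; lra.
    rewrite !lebesgue_measure_itv /= !lte_fin.
    rewrite ltr_ndivrMr // divfK // ltrD2r.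
    case: ifP => _; last by rewrite mule0.
    rewrite -!EFinB -EFinM; congr EFin; rewrite ltr0_norm //; field.
    exact: a0.
  rewrite [X in _ * lebesgue_measure X](_ : _ = `]((c - b) / a)%R, ((d - b) / a)%R]%classic); last first.
    apply/seteqP; split=> t; rewrite /phi /= !in_itv /= => /andP[h1 h2]; apply/andP; split.
    + by rewrite ltr_pdivrMr // mulrC; lra.
    + by rewrite ler_pdivlMr // mulrC; lra.
    + by move: h1; rewrite ltr_pdivrMr // mulrC; lra.
    + by move: h2; rewrite ler_pdivlMr // mulrC; lra.
  rewrite !lebesgue_measure_itv /= !lte_fin.
  rewrite ltr_pdivrMr // divfK // ltrD2r.
  case: ifP => _; last by rewrite mule0.
  rewrite -!EFinB -EFinM; congr EFin; rewrite gtr0_norm //; field.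
  exact: a0.
rewrite /mscale /= muleA -EFinM mulVf ?normr_eq0 // mul1e.
by [].
Qed.

Lemma integral_affine (g : R -> \bar R) (a b : R) : a != 0%R ->
  measurable_fun setT (g : mR -> \bar R) -> (forall t, 0 <= g t) ->
  \int[mu]_t g (a * t + b)%R = (`|a|^-1)%:E * \int[mu]_t g t.
Proof.
move=> a0 mg g0; pose phi : mR -> mR := fun t => (a * t + b)%R.
have mphi : measurable_fun setT phi.
  apply: measurable_funD; last exact: measurable_cst.
  by apply: measurable_funM; [exact: measurable_cst|exact: measurable_id].
have := @ge0_integral_pushforward _ _ _ _ R phi mphi mu setT g measurableT mg (fun y _ => g0 y).
rewrite preimage_setT => <-.
pose r : {nonneg R} := NngNum (normr_ge0 (a^-1)%R).
rewrite -normfV -[(`|a^-1|)%R]/(r%:num)%R -ge0_integral_mscale //.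
apply: eq_measure_integral => A mA _.
by have := lebesgue_measure_affine b a0 mA; rewrite -normfV.
Qed.

End AffineSubstitution.

Section IteratedIntegral.
Variable R : realType.
Local Notation mR := (measurableTypeR R).
Local Notation mu := (@lebesgue_measure R).
Local Open Scope ereal_scope.

Lemma lebesgue_int_nD n (f g : 'cV[R]_n -> \bar R) : (forall y, 0 <= f y) -> (forall y, 0 <= g y) ->
  cV_meas f -> cV_meas g ->
  lebesgue_int_n (fun y => f y + g y) = lebesgue_int_n f + lebesgue_int_n g.
Proof.
elim: n f g => [|n ih] f g f0 g0 mf mg //=.
rewrite -ge0_integralD //; try by move=> *; apply: lebesgue_int_n_ge0.
- by apply: eq_integral => t _; apply: ih => //; exact: cV_meas_cons1.
- exact: measurable_slice.
- exact: measurable_slice.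
Qed.

Lemma lebesgue_int_nZ n (c : R) (f : 'cV[R]_n -> \bar R) : (0 <= c)%R -> (forall y, 0 <= f y) ->
  cV_meas f -> lebesgue_int_n (fun y => c%:E * f y) = c%:E * lebesgue_int_n f.
Proof.
move=> c0; elim: n f => [|n ih] f f0 mf //=.
rewrite -ge0_integralZl //; try by move=> *; apply: lebesgue_int_n_ge0.
- by apply: eq_integral => t _; apply: ih => //; exact: cV_meas_cons1.
- exact: measurable_slice.
Qed.

Lemma le_lebesgue_int_n n (f g : 'cV[R]_n -> \bar R) : (forall y, 0 <= f y) ->
  (forall y, f y <= g y) -> cV_meas f -> cV_meas g -> lebesgue_int_n f <= lebesgue_int_n g.
Proof.
elim: n f g => [|n ih] f g f0 fg mf mg //=.
have g0 y : 0 <= g y by exact: le_trans (f0 y) (fg y).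
apply: ge0_le_integral => //.
- by move=> t _; exact: lebesgue_int_n_ge0.
- exact: measurable_slice.
- exact: measurable_slice.
- by move=> t _; apply: ih => //; exact: cV_meas_cons1.
Qed.

Lemma eq_lebesgue_int_n n (f g : 'cV[R]_n -> \bar R) : f =1 g ->
  lebesgue_int_n f = lebesgue_int_n g.
Proof. by move=> /funext ->. Qed.

Lemma lebesgue_int_n0 n : lebesgue_int_n (fun _ : 'cV[R]_n => 0) = 0.
Proof.
elim: n => [|n ih] //=; under eq_integral do rewrite ih.
exact: integral0.
Qed.

Lemma lebesgue_int_n_hyperplane n (f : 'cV[R]_n.+1 -> \bar R) :
  (forall y, 0 <= f y) -> cV_meas f ->
  (forall t y, t != 0%R -> f (cons_cV t y) = 0) -> lebesgue_int_n f = 0.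
Proof.
move=> f0 mf fz /=.
rewrite (_ : [set: R] = [set 0%R] `|` [set~ 0%R]); last by rewrite setUv.
rewrite ge0_integral_setU //.
- rewrite integral_set1 add0e; apply: integral0_eq => t /eqP t0.
  by under eq_lebesgue_int_n do rewrite (fz _ _ t0); exact: lebesgue_int_n0.
- exact: measurableC.
- by rewrite setUv; exact: measurable_slice.
- by move=> t _; exact: lebesgue_int_n_ge0.
- by apply/disj_setPS => t [] /=.
Qed.

(** Tonelli, moving the first coordinate past the others one at a time. An upper triangular
    substitution shifts this coordinate by the remaining ones, so it must be integrated
    innermost. *)
Lemma lebesgue_int_n_inner0 n (f : 'cV[R]_n.+1 -> \bar R) : (forall y, 0 <= f y) -> cV_meas f ->
  lebesgue_int_n f = lebesgue_int_n (fun y => \int[mu]_t f (cons_cV t y)).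
Proof.
elim: n f => [//|n ih] f f0 mf.
have mf2 : jmeas (fun (ts : mR * mR) y => f (cons_cV ts.1 (cons_cV ts.2 y))).
  apply: (cV_meas_subst (g := fun (ts : mR * mR) y => cons_cV ts.1 (cons_cV ts.2 y)) mf) => i.
  apply: (@jmeas_cons R _ _ _ (mR * mR)%type fst (fun ts y => cons_cV ts.2 y)) => [|j].
    exact: measurable_fst.
  apply: (@jmeas_cons R _ _ _ (mR * mR)%type snd (fun _ y => y)) => [|k].
    exact: measurable_snd.
  exact: jmeas_coord.
transitivity (\int[mu]_t \int[mu]_s lebesgue_int_n (fun y => f (cons_cV t (cons_cV s y)))).
  by [].
rewrite (fubini_tonelli (m1 := mu) (m2 := mu)
  (fun ts : mR * mR => lebesgue_int_n (fun y => f (cons_cV ts.1 (cons_cV ts.2 y))))).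
- rewrite [RHS]/=; apply: eq_integral => s _.
  pose g (z : 'cV[R]_n.+1) := f (cons_cV (z 0%R 0%R) (cons_cV s (tail_cV z))).
  have mg : cV_meas g.
    apply: (cV_meas_subst (g := fun (_ : unit) (z : 'cV[R]_n.+1) => cons_cV (z 0%R 0%R) (cons_cV s (tail_cV z))) mf) => i.
    case: (unliftP ord0 i) => [j ->|->].
      apply: (@eq_jmeas R _ _ _ _ mR (fun _ (z : 'cV[R]_n.+1) => cons_cV s (tail_cV z) j 0%R)).
        by move=> x y; rewrite cons_cV_lift.
      apply: (@jmeas_cons R _ _ _ unit (fun=> s) (fun _ (z : 'cV[R]_n.+1) => tail_cV z)); first exact: measurable_cst.
      move=> k; apply: eq_jmeas (@jmeas_coord R _ _ unit (lift ord0 k)) => x y.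
      by rewrite mxE.
    by apply: eq_jmeas (@jmeas_coord R _ _ unit 0%R) => x y; rewrite cons_cV0.
  have := ih g (fun _ => f0 _) mg; rewrite /= /g.
  under eq_integral => t _ do under eq_lebesgue_int_n => y do rewrite cons_cV0 tail_cons_cV.
  move=> ->; apply: eq_lebesgue_int_n => y; apply: eq_integral => t _.
  by rewrite cons_cV0 tail_cons_cV.
- by apply: (measurable_lebesgue_int_n _ mf2).
- by move=> ts; exact: lebesgue_int_n_ge0.
Qed.

End IteratedIntegral.

(** * Change of variables for the iterated integral *)

Section LinearSubstitution.
Variable R : realType.
Local Notation mR := (measurableTypeR R).
Local Notation mu := (@lebesgue_measure R).

Definition drop0 n (A : 'M[R]_n.+1) : 'M[R]_n := \matrix_(i, j) A (lift ord0 i) (lift ord0 j).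

Lemma drop0E n (A : 'M[R]_n.+1) i j : drop0 A i j = A (lift ord0 i) (lift ord0 j).
Proof. by rewrite mxE. Qed.

Lemma mul_cons_cV n (A : 'M[R]_n.+1) t y : A *m cons_cV t y =
  cons_cV (A 0 0 * t + \sum_j A 0 (lift ord0 j) * y j 0)
          (t *: (\col_i A (lift ord0 i) 0) + drop0 A *m y).
Proof.
apply/colP => i; rewrite !mxE big_ord_recl cons_cV0.
under eq_bigr => j _ do rewrite cons_cV_lift.
case: unliftP => [j ->|->] //; rewrite !mxE mulrC; congr (_ + _).
by apply: eq_bigr => k _; rewrite mxE.
Qed.

(** The outermost variable is transformed by itself and translates the inner ones; the translation
    [b] in the statement lets the induction absorb this. *)
Lemma lebesgue_int_n_lower n (f : 'cV[R]_n -> \bar R) (L : 'M[R]_n) (b : 'cV[R]_n) :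
  (forall y, 0 <= f y)%E -> cV_meas f ->
  (forall i j : 'I_n, (i < j)%N -> L i j = 0) -> (forall i, L i i != 0) ->
  lebesgue_int_n (fun y => f (b + L *m y)) = ((`|\prod_i L i i|^-1)%:E * lebesgue_int_n f)%E.
Proof.
elim: n f L b => [|n ih] f L b f0 mf Ltrig Ldiag.
  by rewrite big_ord0 normr1 invr1 mul1e /= (flatmx0 (_ + _)).
have LE t y : b + L *m cons_cV t y = cons_cV (L 0 0 * t + b 0 0)
    ((tail_cV b + t *: (\col_i L (lift ord0 i) 0)) + drop0 L *m y).
  rewrite mul_cons_cV big1 ?addr0 => [|j _]; last by rewrite Ltrig // mul0r.
  by rewrite -{1}(cons_cV_tail b) cons_cVD addrA addrC [b 0 0 + _]addrC.
have L0 : L 0 0 != 0 by [].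
have d1 : forall i, drop0 L i i != 0 by move=> i; rewrite mxE.
rewrite [LHS]/=.
under eq_integral => t _.
  under eq_lebesgue_int_n => y do rewrite LE.
  rewrite (ih (fun z => f (cons_cV (L 0 0 * t + b 0 0) z))) //; last 2 first.
  - exact: cV_meas_cons1.
  - by move=> i j ij; rewrite mxE Ltrig.
  over.
pose h t := lebesgue_int_n (fun y => f (cons_cV t y)).
have h0 t : (0 <= h t)%E by exact: lebesgue_int_n_ge0.
have mh : measurable_fun setT (h : mR -> \bar R) by exact: measurable_slice.
have mphi : measurable_fun setT (fun t : mR => L 0 0 * t + b 0 0 : mR).
  apply: measurable_funD; last exact: measurable_cst.
  by apply: measurable_funM; [exact: measurable_cst|exact: measurable_id].
have c0 : (0 <= (`|\prod_i drop0 L i i|^-1)%:E)%E by rewrite lee_fin invr_ge0.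
rewrite (ge0_integralZl mu measurableT (measurableT_comp mh mphi) (fun t _ => h0 _) c0).
rewrite (integral_affine (b 0 0) L0 mh h0) muleA -EFinM; congr (_%:E * _)%E.
rewrite big_ord_recl normrM invfM mulrC; congr (_ * (`|_|)^-1).
by apply: eq_bigr => i _; rewrite mxE.
Qed.

Lemma cV_meas_linear n (f : 'cV[R]_n -> \bar R) (A : 'M[R]_n) :
  cV_meas f -> cV_meas (fun y => f (A *m y)).
Proof.
by move=> /(cV_meas_affine A 0); apply: eq_jmeas => x y; rewrite add0r.
Qed.

Lemma jmeas_integral n (d : measure_display) (X : measurableType d)
  (F : X -> R -> 'cV[R]_n -> \bar R) : (forall x t y, 0 <= F x t y)%E ->
  jmeas (fun (xt : X * mR) y => F xt.1 xt.2 y) ->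
  jmeas (fun x y => \int[mu]_t F x t y)%E.
Proof.
elim: n d X F => [|n ih] d X F F0 /= mF.
  exact: (measurable_fun_fubini_tonelli_F (m2 := mu) (fun xt : X * mR => F xt.1 xt.2 0)).
apply: (ih _ (X * mR)%type (fun xs t y => F xs.1 t (cons_cV xs.2 y))) => //.
pose swap (z : (X * mR) * mR) : (X * mR) * mR := ((z.1.1, z.2), z.1.2).
apply: (jmeas_subst (phi := fun z _ => swap z) (g := fun _ y => y) mF).
  apply: jmeas_fst; apply: measurable_fun_pair; first apply: measurable_fun_pair.
  - by apply: measurableT_comp; [exact: measurable_fst|exact: measurable_fst].
  - exact: measurable_snd.
  - by apply: measurableT_comp; [exact: measurable_snd|exact: measurable_fst].
by move=> i; exact: jmeas_coord.
Qed.

(** With the first variable innermost, its shift by the other coordinates is constant during that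
    integration and disappears. *)
Lemma lebesgue_int_n_upper n (f : 'cV[R]_n -> \bar R) (U : 'M[R]_n) :
  (forall y, 0 <= f y)%E -> cV_meas f ->
  (forall i j : 'I_n, (j < i)%N -> U i j = 0) -> (forall i, U i i != 0) ->
  lebesgue_int_n (fun y => f (U *m y)) = ((`|\prod_i U i i|^-1)%:E * lebesgue_int_n f)%E.
Proof.
elim: n f U => [|n ih] f U f0 mf Utrig Udiag.
  by rewrite big_ord0 normr1 invr1 mul1e /= (flatmx0 (_ *m _)).
have UE t y : U *m cons_cV t y
    = cons_cV (U 0 0 * t + \sum_j U 0 (lift ord0 j) * y j 0) (drop0 U *m y).
  rewrite mul_cons_cV (_ : \col_i U (lift ord0 i) 0 = 0) ?scaler0 ?add0r //.
  by apply/colP => i; rewrite !mxE Utrig.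
have U0 : U 0 0 != 0 by [].
rewrite lebesgue_int_n_inner0 //; last exact: cV_meas_linear.
pose g (y : 'cV[R]_n) := (\int[mu]_t f (cons_cV t y))%E.
have g0 y : (0 <= g y)%E by exact: integral_ge0.
have mslice y : measurable_fun setT (fun t : mR => f (cons_cV t y)).
  have := @cV_meas_subst R n.+1 0 _ mR f (fun t _ => cons_cV t y) mf; apply=> i.
  apply: (@jmeas_cons R _ _ _ mR id (fun _ _ => y)) => // j; exact: jmeas_cst.
have mg : cV_meas g by exact: (@jmeas_integral _ _ unit (fun _ t y => f (cons_cV t y))).
transitivity (lebesgue_int_n (fun y => (`|U 0 0|^-1)%:E * g (drop0 U *m y))%E).
  apply: eq_lebesgue_int_n => y; rewrite -(integral_affine (\sum_j U 0 (lift ord0 j) * y j 0) U0 (mslice _)) //.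
  by apply: eq_integral => t _; rewrite UE.
have c0 : 0 <= `|U 0 0|^-1 by rewrite invr_ge0.
rewrite (lebesgue_int_nZ c0 (fun y => g0 _) (cV_meas_linear (drop0 U) mg)).
rewrite ih //; last 2 first.
- by move=> i j ij; rewrite mxE Utrig.
- by move=> i; rewrite mxE.
rewrite muleA -EFinM lebesgue_int_n_inner0 //; congr (_%:E * _)%E.
rewrite big_ord_recl normrM invfM; congr (_ * (`|_|)^-1).
by apply: eq_bigr => i _; rewrite mxE.
Qed.

Definition linear_subst n (A : 'M[R]_n) := forall f : 'cV[R]_n -> \bar R,
  (forall y, 0 <= f y)%E -> cV_meas f ->
  lebesgue_int_n (fun y => f (A *m y)) = ((`|\det A|^-1)%:E * lebesgue_int_n f)%E.

Lemma linear_subst_lower n (L : 'M[R]_n) : (forall i j : 'I_n, (i < j)%N -> L i j = 0) ->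
  (forall i, L i i != 0) -> linear_subst L.
Proof.
move=> Lt Ld f f0 mf.
under eq_lebesgue_int_n => y do rewrite -(add0r (L *m y)).
by rewrite lebesgue_int_n_lower // det_trig //; apply/is_trig_mxP.
Qed.

Lemma linear_subst_upper n (U : 'M[R]_n) : (forall i j : 'I_n, (j < i)%N -> U i j = 0) ->
  (forall i, U i i != 0) -> linear_subst U.
Proof.
move=> Ut Ud f f0 mf; rewrite lebesgue_int_n_upper // -[in RHS]det_tr det_trig.
  by congr ((`|_|^-1)%:E * _)%E; apply: eq_bigr => i _; rewrite mxE.
by apply/is_trig_mxP => i j ij; rewrite mxE Ut.
Qed.

Lemma linear_subst_mul n (A B : 'M[R]_n) : linear_subst A -> linear_subst B -> linear_subst (A *m B).
Proof.
move=> gA gB f f0 mf; under eq_lebesgue_int_n => y do rewrite -mulmxA.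
rewrite (gB (fun y => f (A *m y))) //; last exact: cV_meas_linear.
by rewrite gA // muleA -EFinM det_mulmx normrM invfM [X in X%:E]mulrC.
Qed.

Lemma linear_subst_inv n (A : 'M[R]_n) : A \in unitmx -> linear_subst A -> linear_subst (invmx A).
Proof.
move=> uA gA f f0 mf.
have := gA (fun y => f (invmx A *m y)) (fun y => f0 _) (cV_meas_linear (invmx A) mf).
under eq_lebesgue_int_n => y do rewrite mulKmx //.
move=> ->; rewrite muleA -EFinM det_inv normfV invrK mulfV ?mul1e //.
by rewrite normr_eq0 -unitfE -unitmxE.
Qed.

Lemma linear_subst_drop0 n (D : 'M[R]_n.+1) : D 0 0 = 1 -> (forall j, D 0 (lift ord0 j) = 0) ->
  (forall j, D (lift ord0 j) 0 = 0) -> \det D = \det (drop0 D) -> linear_subst (drop0 D) ->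
  linear_subst D.
Proof.
move=> D00 D0 D1 dD gD f f0 mf.
have DE t y : D *m cons_cV t y = cons_cV t (drop0 D *m y).
  rewrite mul_cons_cV big1 => [|j _]; last by rewrite D0 mul0r.
  rewrite D00 mul1r addr0 (_ : \col_i _ = 0) ?scaler0 ?add0r //.
  by apply/colP => i; rewrite !mxE D1.
rewrite [LHS]/=.
under eq_integral => t _.
  under eq_lebesgue_int_n => y do rewrite DE.
  rewrite (gD (fun z => f (cons_cV t z))) //; last exact: cV_meas_cons1.
  over.
have c0 : (0 <= (`|\det (drop0 D)|^-1)%:E)%E by rewrite lee_fin invr_ge0.
rewrite (ge0_integralZl mu measurableT (measurable_slice f0 mf) _ c0) ?dD // => t _.
exact: lebesgue_int_n_ge0.
Qed.

(** A row operation [U] makes the corner entry 1; block elimination then factors the matrix as lower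
    triangular, block diagonal, upper triangular, and induction handles the remaining block. *)
Theorem lebesgue_int_n_linear n (A : 'M[R]_n) : A \in unitmx -> linear_subst A.
Proof.
elim: n A => [|n ih] A uA.
  by apply: linear_subst_lower => -[].
have [i0 Ai0] : exists i, A i 0 != 0.
  apply/existsP; apply: contraT; rewrite negb_exists => /forallP A0.
  move: uA; rewrite unitmxE (expand_det_col _ 0) big1 ?unitr0 // => i _.
  by have := A0 i; rewrite negbK => /eqP ->; rewrite mul0r.
pose v (j : 'I_n.+1) : R := if A 0 0 == 0 then (j == 0)%:R + (j == i0)%:R / A i0 0
  else (j == 0)%:R / A 0 0.
have v0 : v 0 != 0.
  rewrite /v; case: (eqVneq (A 0 0) 0) => [A00|A00].
    rewrite eqxx (_ : (0 == i0) = false) ?mul0r ?addr0 ?oner_neq0 //.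
    by apply/eqP => i00; move: Ai0; rewrite -i00 A00 eqxx.
  by rewrite eqxx mul1r invr_eq0.
pose U : 'M[R]_n.+1 := \matrix_(k, j) if k == 0 then v j else (k == j)%:R.
have Ut (i j : 'I_n.+1) : (j < i)%N -> U i j = 0.
  move=> ji; rewrite mxE ifF; last by apply/eqP => i0'; move: ji; rewrite i0'.
  by rewrite -val_eqE gtn_eqF.
have Ud i : U i i != 0 by rewrite mxE; case: (eqVneq i 0) => [->//|_]; rewrite eqxx oner_neq0.
have uU : U \in unitmx.
  rewrite unitmxE unitfE -det_tr det_trig; last first.
    by apply/is_trig_mxP => i j ij; rewrite mxE Ut.
  by apply/prodf_neq0 => i _; rewrite mxE.
pose A' : 'M[R]_(1 + n) := U *m A.
have uA' : A' \in unitmx by rewrite unitmx_mul uU.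
have A'00 : A' 0 0 = 1.
  rewrite mxE; under eq_bigr => j _ do rewrite mxE eqxx.
  rewrite /v; case: (eqVneq (A 0 0) 0) => [A00|A00].
    under eq_bigr => j _ do rewrite mulrDl.
    rewrite big_split /= (bigD1 0) //= ?eqxx ?mulr1n mul1r A00 add0r big1; last first.
      by move=> j /negbTE ->; rewrite mul0r.
    rewrite add0r (bigD1 i0) //= ?eqxx ?mulr1n mul1r mulVf // big1 ?addr0 // => j /negbTE ->.
    by rewrite !mul0r.
  rewrite (bigD1 0) //= ?eqxx ?mulr1n mul1r mulVf // big1 ?addr0 // => j /negbTE ->.
  by rewrite !mul0r.
have eA : U *m A = A' by [].
clearbody A'.
(* The Schur complement of the corner entry 1. *)
pose B : 'M[R]_n := drsubmx A' - dlsubmx A' *m ursubmx A'.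
pose L : 'M[R]_(1 + n) := block_mx 1%:M 0 (dlsubmx A') 1%:M.
pose D : 'M[R]_(1 + n) := block_mx 1%:M 0 0 B.
pose T : 'M[R]_(1 + n) := block_mx 1%:M (ursubmx A') 0 1%:M.
have ul : ulsubmx A' = 1%:M.
  by rewrite [LHS]mx11_scalar !mxE lshift0 A'00.
have A'E : A' = L *m D *m T.
  rewrite !mulmx_block !(mul1mx, mulmx1, mul0mx, mulmx0, add0r, addr0) addrC subrK.
  by rewrite -ul submxK.
have dL : \det L = 1 by rewrite det_lblock !det1 mulr1.
have dT : \det T = 1 by rewrite det_ublock !det1 mulr1.
have dD : \det D = \det B by rewrite det_lblock det1 mul1r.
have gL : linear_subst L.
  apply: linear_subst_lower => [i j ij|i].
    suff /is_trig_mxP : is_trig_mx L by apply.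
    by rewrite is_trig_block_mx // eqxx !scalar_mx_is_trig.
  case: (split_ordP i) => j ->.
    by rewrite block_mxEul mxE eqxx oner_neq0.
  by rewrite block_mxEdr mxE eqxx oner_neq0.
have gT : linear_subst T.
  apply: linear_subst_upper => [i j ij|i].
    suff /is_trig_mxP/(_ j i ij) : is_trig_mx T^T by rewrite mxE.
    by rewrite tr_block_mx is_trig_block_mx // trmx0 eqxx !tr_scalar_mx !scalar_mx_is_trig.
  case: (split_ordP i) => j ->.
    by rewrite block_mxEul mxE eqxx oner_neq0.
  by rewrite block_mxEdr mxE eqxx oner_neq0.
have uB : B \in unitmx.
  have := uA'; rewrite !unitmxE !unitfE A'E !det_mulmx dL dT dD; by rewrite mul1r mulr1.
have dropD : drop0 D = B.
  by apply/matrixP => i j; rewrite drop0E -!rshift1; exact: block_mxEdr.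
have gD : linear_subst D.
  apply: linear_subst_drop0; rewrite ?dropD //; last exact: ih.
  - by rewrite -(lshift0 n 0); apply: etrans (block_mxEul _ _ _ _ _ _) _; rewrite mxE.
  - move=> j; rewrite -(lshift0 n 0) -rshift1.
    by apply: etrans (block_mxEur _ _ _ _ _ _) _; rewrite mxE.
  - move=> j; rewrite -(lshift0 n 0) -rshift1.
    by apply: etrans (block_mxEdl _ _ _ _ _ _) _; rewrite mxE.
have gA' : linear_subst A' by rewrite A'E; apply: linear_subst_mul gT; apply: linear_subst_mul.
rewrite -(mulKmx uU A) eA; apply: linear_subst_mul => //.
by apply: linear_subst_inv => //; exact: linear_subst_upper.
Qed.

End LinearSubstitution.

(** * Moment functions *)

Section Boxes.
Variable R : realType.
Local Notation mR := (measurableTypeR R).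
Local Notation mu := (@lebesgue_measure R).

Definition box n (a b : R) : set 'cV[R]_n := [set y | forall i, a <= y i 0 <= b].
Arguments box n a b : clear implicits.

Lemma indic_box_cons n (a b : R) t (y : 'cV[R]_n) :
  \1_(box n.+1 a b) (cons_cV t y) = \1_(`[a, b]%classic) t * \1_(box n a b) y :> R.
Proof.
rewrite !indicE -natrM mulnb; congr (_%:R); congr nat_of_bool.
apply/idP/idP => [/set_mem h|/andP[/set_mem h1 /set_mem h2]].
  apply/andP; split; apply: mem_set; first by rewrite /= in_itv; have := h ord0; rewrite cons_cV0.
  by move=> i; have := h (lift ord0 i); rewrite cons_cV_lift.
apply: mem_set => i; rewrite /= in_itv /= in h1.
by case: (unliftP ord0 i) => [j ->|->]; rewrite ?cons_cV_lift ?cons_cV0.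
Qed.

Lemma jmeas_dotv n (d : measure_display) (X : measurableType d) (g : 'cV[R]_n) :
  @jmeas R n _ X _ mR (fun _ y => dotv g y).
Proof.
apply: (@eq_jmeas _ _ _ _ _ mR (fun _ y => (0 + g^T *m y) 0 0)).
  by move=> x y; rewrite add0r mxE; apply: eq_bigr => i _; rewrite mxE.
by apply: (@jmeas_affine R _ _ _ X g^T (fun=> 0)); exact: measurable_cst.
Qed.

Lemma jmeas_halfspace n (d : measure_display) (X : measurableType d) (g : 'cV[R]_n) (b : R) :
  @jmeas R n _ X _ mR (fun _ y => \1_[set z | dotv g z <= b] y).
Proof.
apply: (@eq_jmeas _ _ _ _ _ mR (fun _ y => \1_(`]-oo, b]%classic) (dotv g y))).
  by move=> x y; rewrite !indicE; congr ((nat_of_bool _)%:R).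
apply: (@jmeas_comp _ _ _ _ _ mR _ mR); first exact: measurable_indic.
exact: jmeas_dotv.
Qed.

Lemma jmeas_halfspaces n (d : measure_display) (X : measurableType d) (hs : seq ('cV[R]_n * R)) :
  @jmeas R n _ X _ mR (fun _ y => \1_[set z | forall h, h \in hs -> dotv h.1 z <= h.2] y).
Proof.
elim: hs => [|h hs ih].
  apply: (@eq_jmeas _ _ _ _ _ mR (fun _ _ => 1)); last exact: jmeas_cst.
  by move=> x y; rewrite indicE mem_set.
apply: (@eq_jmeas _ _ _ _ _ mR (fun _ y => \1_[set z | dotv h.1 z <= h.2] y *
    \1_[set z | forall h, h \in hs -> dotv h.1 z <= h.2] y)).
  move=> x y; rewrite !indicE -natrM mulnb; congr (_%:R); congr nat_of_bool.
  apply/idP/idP => [/andP[/set_mem h1 /set_mem h2]|/set_mem H].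
    by apply: mem_set => k; rewrite inE => /orP[/eqP ->//|]; exact: h2.
  apply/andP; split; apply: mem_set; first by apply: H; rewrite mem_head.
  by move=> k kh; apply: H; rewrite inE kh orbT.
by apply: jmeas_mul => //; exact: jmeas_halfspace.
Qed.

Lemma jmeas_box n (d : measure_display) (X : measurableType d) (a b : R) :
  @jmeas R n _ X _ mR (fun _ y => \1_(box n a b) y).
Proof.
have -> : box n a b = [set z | forall h, h \in [seq (delta_mx i 0, b) | i : 'I_n] ++
    [seq (- delta_mx i 0, - a) | i : 'I_n] -> dotv h.1 z <= h.2].
  apply/seteqP; split=> z /= h.
    move=> k; rewrite mem_cat => /orP[|] /mapP[i _ ->] /=; have /andP[h1 h2] := h i.
      by rewrite dotvC dotv_delta.
    by rewrite dotvC dotvNr dotv_delta lerN2.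
  move=> i; apply/andP; split.
    have := h (- delta_mx i 0, - a); rewrite /= dotvC dotvNr dotv_delta lerN2; apply.
    by rewrite mem_cat; apply/orP; right; apply/mapP; exists i; rewrite ?mem_enum.
  have := h (delta_mx i 0, b); rewrite /= dotvC dotv_delta; apply.
  by rewrite mem_cat; apply/orP; left; apply/mapP; exists i; rewrite ?mem_enum.
exact: jmeas_halfspaces.
Qed.

Lemma cV_meas_EFin n (f : 'cV[R]_n -> R) :
  @jmeas R n _ unit _ mR (fun _ y => f y) -> cV_meas (fun y => (f y)%:E).
Proof. by apply: jmeas_comp; exact: EFin_measurable. Qed.

Lemma lebesgue_int_n_box n (c a b : R) : 0 <= c -> a <= b ->
  lebesgue_int_n (fun y => (c * \1_(box n a b) y)%:E) = (c * (b - a) ^+ n)%:E.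
Proof.
move=> c0 ab; elim: n => [|n ih] /=.
  by rewrite indicE mem_set ?expr0 // => -[].
under eq_integral => t _.
  under eq_lebesgue_int_n => y do rewrite indic_box_cons mulrCA EFinM.
  rewrite lebesgue_int_nZ ?ih //.
  - over.
  - by move=> y; rewrite lee_fin mulr_ge0.
  - by apply: cV_meas_EFin; apply: jmeas_mul; [exact: jmeas_cst|exact: jmeas_box].
under eq_integral => t _ do rewrite muleC.
rewrite ge0_integralZl //; last 2 first.
- exact/measurable_EFinP/measurable_indic.
- by rewrite lee_fin mulr_ge0 // exprn_ge0 // subr_ge0.
have muab : mu `[a, b]%classic = (b - a)%:E.
  rewrite lebesgue_measure_itv /= lte_fin; case: ltP => // ba.
  by have -> : a = b; [apply/eqP; rewrite eq_le ab|rewrite subrr].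
rewrite integral_indic // setIT; transitivity ((c * (b - a) ^+ n)%:E * (b - a)%:E)%E.
  by rewrite -muab.
by rewrite -EFinM exprS mulrA [in LHS]mulrAC -mulrA.
Qed.

End Boxes.
Arguments box {R} n a b.

Section Moments.
Variables (R : realType) (n : nat) (p : R).
Hypothesis p1 : 1 <= p.
Local Notation mR := (measurableTypeR R).
Implicit Types (x y : 'cV[R]_n) (K L : set 'cV[R]_n) (s : seq 'cV[R]_n).

Definition moment_density K x y : R := \1_K y * powR (Num.max (dotv x y) 0) p.
Definition moment K x : R := fine (lebesgue_int_n (fun y => (moment_density K x y)%:E)).

Let p0 : 0 < p := lt_le_trans ltr01 p1.

Let maxr_ge0 (t : R) : 0 <= Num.max t 0. Proof. by rewrite le_max lexx orbT. Qed.

Lemma moment_density_ge0 K x y : (0 <= (moment_density K x y)%:E)%E.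
Proof. by rewrite lee_fin mulr_ge0 ?powR_ge0 // indicE. Qed.

Lemma jmeas_moment_density K x : polytope_o K ->
  @jmeas R n _ unit _ mR (fun _ y => moment_density K x y).
Proof.
move=> /polytope_o_halfspaces[hs _ ->]; apply: jmeas_mul; first exact: jmeas_halfspaces.
apply: (@jmeas_comp _ _ _ _ _ mR _ mR (fun t => powR (Num.max t 0) p)); last exact: jmeas_dotv.
apply: (measurableT_comp (f := @powR R ^~ p) (measurable_powR p)).
by apply: (measurable_maxr (f := id) (g := cst 0)); [exact: measurable_id|exact: measurable_cst].
Qed.

Lemma cV_meas_moment_density K x : polytope_o K ->
  cV_meas (fun y => (moment_density K x y)%:E).
Proof. by move=> po; apply: cV_meas_EFin; exact: jmeas_moment_density. Qed.

Lemma polytope_o_box K : polytope_o K -> exists2 B : R, 0 <= B & K `<=` box n (- B) B.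
Proof.
move=> po; have h0 v : 0 <= supp_fun K v by exact: supp_fun_ge0.
pose F (i : 'I_n) := supp_fun K (delta_mx i 0) + supp_fun K (- delta_mx i 0).
have F0 i : 0 <= F i by rewrite addr_ge0.
exists (\sum_i F i); first by apply: sumr_ge0 => i _.
move=> y Ky i; have Fi : F i <= \sum_j F j.
  by rewrite (bigD1 i) //= lerDl; apply: sumr_ge0.
have := supp_fun_ge (delta_mx i 0) po Ky; have := supp_fun_ge (- delta_mx i 0) po Ky.
rewrite dotvNl dotvC dotv_delta; move: Fi; rewrite /F.
have := h0 (delta_mx i 0); have := h0 (- delta_mx i 0); move=> *; apply/andP; split; lra.
Qed.

(** Finiteness, which makes [fine] harmless: on a box containing [K] the density is at most the p-th
    power of the support function at [x]. *)
Lemma momentE K x : polytope_o K ->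
  lebesgue_int_n (fun y => (moment_density K x y)%:E) = (moment K x)%:E.
Proof.
move=> po; rewrite /moment fineK // ge0_fin_numE; last first.
  by apply: lebesgue_int_n_ge0 => y; exact: moment_density_ge0.
have [B B0 KB] := polytope_o_box po; pose M := powR (supp_fun K x) p.
have M0 : 0 <= M by exact: powR_ge0.
apply: (@le_lt_trans _ _ (lebesgue_int_n (fun y => (M * \1_(box n (- B) B) y)%:E))).
  apply: le_lebesgue_int_n => [y|y||]; first exact: moment_density_ge0.
  - rewrite lee_fin /moment_density !indicE; have [Ky|_] := boolP (y \in K); last first.
      by rewrite mul0r mulr_ge0.
    move/set_mem: Ky => Ky; rewrite mem_set; last exact: KB.
    rewrite mul1r mulr1; apply: ge0_ler_powR; rewrite ?nnegrE ?(ltW p0) ?supp_fun_ge0 ?maxr_ge0 //.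
    by rewrite ge_max supp_fun_ge ?supp_fun_ge0.
  - exact: cV_meas_moment_density.
  - by apply: cV_meas_EFin; apply: jmeas_mul; [exact: jmeas_cst|exact: jmeas_box].
by rewrite lebesgue_int_n_box ?ltry //; lra.
Qed.

Lemma moment_ge0 K x : 0 <= moment K x.
Proof.
by apply: fine_ge0; apply: lebesgue_int_n_ge0 => y; exact: moment_density_ge0.
Qed.

Lemma moment_valuation : is_valuation moment.
Proof.
move=> K L poK poL poU poI x; apply: EFin_inj; rewrite !EFinD -!momentE //.
rewrite -!lebesgue_int_nD; try by [move=> y; exact: moment_density_ge0|exact: cV_meas_moment_density].
apply: eq_lebesgue_int_n => y; rewrite -!EFinD; congr EFin; rewrite /moment_density -!mulrDl.
congr (_ * _); rewrite !indicE in_setU in_setI.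
by case: (y \in K); case: (y \in L); rewrite /= ?addr0 ?add0r.
Qed.

Lemma moment_covariant : SL_covariant moment.
Proof.
move=> A dA K po x; apply: EFin_inj; rewrite -!momentE //; last exact: polytope_o_image.
have uA : A \in unitmx by rewrite unitmxE dA unitr1.
have := lebesgue_int_n_linear uA (f := fun y => (moment_density ((fun y => A *m y) @` K) x y)%:E).
rewrite dA normr1 invr1 mul1e => <-.
- apply: eq_lebesgue_int_n => y; congr EFin; rewrite /moment_density dotv_mul; congr (_ * _).
  rewrite !indicE; congr ((nat_of_bool _)%:R).
  apply/idP/idP => /set_mem h; apply: mem_set; last by exists y.
  by case: h => z Kz /(can_inj (mulKmx uA)) <-.
- by move=> y; exact: moment_density_ge0.
- by apply: cV_meas_moment_density; exact: polytope_o_image.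
Qed.

Lemma moment_homogeneous : homogeneous p moment.
Proof.
move=> K po l x l0; apply: EFin_inj; rewrite EFinM -!momentE //.
rewrite -lebesgue_int_nZ ?powR_ge0 //.
- apply: eq_lebesgue_int_n => y; rewrite -EFinM; congr EFin.
  rewrite /moment_density dotvZl mulrCA -powRM ?maxr_ge0 // maxr_pMr // mulr0 //.
- by move=> y; exact: moment_density_ge0.
- exact: cV_meas_moment_density.
Qed.

Lemma moment_convex K : polytope_o K -> convex_fun (moment K).
Proof.
move=> po x x' t t0 t1; have t1' : 0 <= 1 - t by rewrite subr_ge0.
rewrite -lee_fin EFinD !EFinM -!momentE // -!lebesgue_int_nZ //;
  try by [move=> y; exact: moment_density_ge0|exact: cV_meas_moment_density].
have mZ (r : R) z : cV_meas (fun y => (r%:E * (moment_density K z y)%:E)%E).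
  apply: (@eq_jmeas _ _ _ _ _ _ (fun _ y => (r * moment_density K z y)%:E)).
    by move=> u y; rewrite EFinM.
  by apply: cV_meas_EFin; apply: jmeas_mul; [exact: jmeas_cst|exact: jmeas_moment_density].
have Z0 (r : R) z y : 0 <= r -> (0 <= r%:E * (moment_density K z y)%:E)%E.
  by move=> r0; apply: mule_ge0; rewrite ?lee_fin //; exact: moment_density_ge0.
rewrite -lebesgue_int_nD; try by [move=> y; exact: Z0|exact: mZ].
apply: le_lebesgue_int_n => [y|y||]; first exact: moment_density_ge0.
- rewrite -!EFinM -EFinD lee_fin /moment_density !(mulrCA _ (\1_K y)) -mulrDr.
  apply: ler_wpM2l; first by rewrite indicE.
  apply: le_trans (powR_convex p1 _ _ t0 t1); rewrite ?maxr_ge0 //.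
  apply: ge0_ler_powR; rewrite ?nnegrE ?(ltW p0) ?maxr_ge0 //.
    by rewrite addr_ge0 // mulr_ge0 // maxr_ge0.
  rewrite ge_max dotvDl !dotvZl; apply/andP; split.
    by apply: lerD; apply: ler_wpM2l => //; rewrite le_max lexx.
  by rewrite addr_ge0 // mulr_ge0 // maxr_ge0.
- exact: cV_meas_moment_density.
- apply: (@eq_jmeas _ _ _ _ _ _ (fun _ y => ((1 - t) * moment_density K x y + t * moment_density K x' y)%:E)).
    by move=> u y; rewrite EFinD !EFinM.
  by apply: cV_meas_EFin; apply: jmeas_add; apply: jmeas_mul;
    [exact: jmeas_cst|exact: jmeas_moment_density|exact: jmeas_cst|exact: jmeas_moment_density].
Qed.

Lemma moment_ray_continuous : ray_continuous moment.
Proof. by move=> K po x u; apply: convex_fun_cvg; exact: moment_convex. Qed.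

Lemma moment_eq0 K x : (forall y, K y -> dotv x y <= 0) -> moment K x = 0.
Proof.
move=> h; rewrite /moment (eq_lebesgue_int_n (g := fun=> 0%E)) ?lebesgue_int_n0 // => y.
congr EFin; rewrite /moment_density indicE; have [/set_mem Ky|_] := boolP (y \in K).
  by rewrite mul1r; move/max_idPr: (h y Ky) => ->; rewrite powR0 // gt_eqF.
by rewrite mul0r.
Qed.

End Moments.

Section MomentValues.
Variables (R : realType) (p : R).
Hypothesis p1 : 1 <= p.
Let p0 : 0 < p := lt_le_trans ltr01 p1.

Lemma powR_supp_Mp_plus n K (x : 'cV[R]_n) : powR (supp_Mp_plus p K x) p = moment p K x.
Proof. by rewrite /supp_Mp_plus -powRrM mulVf ?gt_eqF // powRr1 // moment_ge0. Qed.

Lemma powR_supp_Mp_minus n K (x : 'cV[R]_n) : powR (supp_Mp_minus p K x) p = moment p K (- x).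
Proof.
rewrite /supp_Mp_minus -powRrM mulVf ?gt_eqF // (_ : fine _ = moment p K (- x)).
  by rewrite powRr1 // moment_ge0.
by congr fine; apply: eq_lebesgue_int_n => y; rewrite /moment_density dotvNl.
Qed.

Lemma simplex_le n (g : 'cV[R]_n) s y : (forall v, v \in s -> dotv g v <= 0) -> simplex s y ->
  dotv g y <= 0.
Proof.
by move=> gs; apply: (simplex_min (C := halfspace g)) => //; [exact: convex_halfspace|rewrite /halfspace /= dotv0r].
Qed.

(** If some dot is nonzero, covariance moves the simplex into a coordinate hyperplane, a null set;
    otherwise the density vanishes on it. *)
Lemma moment_simple n (s : seq 'cV[R]_n) x : free s -> (size s < n)%N -> moment p (simplex s) x = 0.
Proof.
case: n s x => [//|n] s x fs sn.
have [h|h] := pselect (exists2 v, v \in s & dotv x v != 0); last first.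
  apply: moment_eq0 => // y; apply: simplex_le => v vs.
  by rewrite leNgt; apply/negP => xv; apply: h; exists v; rewrite // gt_eqF.
(* The leading 0 reserves the first coordinate, so that the target frame [s'] consists of the basis
   vectors with indices 1 to [d] and lies in the hyperplane where that coordinate is 0. *)
pose d := size s; pose y := 0 :: map (dotv x) s.
have ysz : size y = d.+1 by rewrite /= size_map.
have yn : (size y <= n.+1)%N by rewrite ysz.
have dy := dots_vec yn; rewrite ysz in dy.
pose s' := map (@basis_vec R n.+1) (iota 1 d).
have fE : std_frame R n.+1 d.+1 = basis_vec R n.+1 0 :: s' by [].
have fs' : free s'.
  by have := free_std_frame R (sn : (d.+1 <= n.+1)%N); rewrite fE free_cons => /andP[].
have [|A dA [As Ax]] := same_dots fs fs' sn (x' := vec n.+1 y) _ h.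
  by move: dy; rewrite fE /= => -[_ ->].
rewrite -Ax -(moment_covariant p1 dA); last exact: polytope_o_simplex.
rewrite simplex_image As; apply: EFin_inj; rewrite -(momentE p1); last exact: polytope_o_simplex.
apply: lebesgue_int_n_hyperplane.
- by move=> z; exact: moment_density_ge0.
- by apply: cV_meas_moment_density => //; exact: polytope_o_simplex.
move=> t z t0; congr EFin; rewrite /moment_density indicE memNset ?mul0r // => sz.
have s'0 (v : 'cV[R]_n.+1) : v \in s' -> v 0 0 = 0.
  by move=> /mapP[k]; rewrite mem_iota => /andP[k0 _] ->; rewrite mxE /=; case: k k0.
have : t <= 0.
  have := @simplex_le _ (basis_vec R n.+1 0) s' (cons_cV t z).
  rewrite (dotvC _ (cons_cV t z)) (dotv_basis_vec _ 0) cons_cV0; apply=> // v vs.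
  by rewrite dotvC (dotv_basis_vec v 0) s'0.
have : 0 <= t.
  have := @simplex_le _ (- basis_vec R n.+1 0) s' (cons_cV t z).
  rewrite (dotvC _ (cons_cV t z)) dotvNr (dotv_basis_vec _ 0) cons_cV0 oppr_le0; apply=> // v vs.
  by rewrite dotvC dotvNr (dotv_basis_vec v 0) s'0 ?oppr0.
by move=> h1 h2; move: t0; rewrite eq_le h1 h2.
Qed.

Lemma simplex_std_frame n (y : 'cV[R]_n) : (forall i, 0 <= y i 0) -> \sum_i y i 0 <= 1 ->
  simplex (std_frame R n n) y.
Proof.
move=> y0 y1; apply/simplexE.
have -> : cons_cV 1 y = (1 - \sum_i y i 0) *: cons_cV 1 0
    + \sum_i y i 0 *: cons_cV 1 (basis_vec R n i).
  apply/colP => i; transitivity ((1 - \sum_i y i 0) * cons_cV 1 0 i 0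
      + \sum_j y j 0 * cons_cV 1 (basis_vec R n j) i 0); last first.
    rewrite [RHS]mxE summxE [in RHS]mxE; congr (_ + _).
    by apply: eq_bigr => j _; rewrite [RHS]mxE.
  case: (unliftP ord0 i) => [j ->|->].
    rewrite !cons_cV_lift mxE mulr0 add0r (bigD1 j) //= big1 => [|k kj].
      by rewrite cons_cV_lift mxE eqxx mulr1 addr0.
    by rewrite cons_cV_lift mxE eq_sym (negbTE (kj : (k != j :> nat))) mulr0.
  rewrite !cons_cV0 mulr1.
  by under [X in _ = _ + X]eq_bigr => j _ do rewrite cons_cV0 mulr1; rewrite subrK.
apply: coneD; first by apply: coneZ; [rewrite subr_ge0|apply: cone_mem; rewrite mem_head].
elim/big_ind: _ => [|u v|i _]; [exact: cone0|exact: coneD|].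
apply: coneZ => //; apply: cone_mem; rewrite inE; apply/orP; right; apply: map_f; apply: map_f.
by rewrite mem_iota add0n ltn_ord.
Qed.

Lemma moment_std_gt0 n : 0 < moment p (simplex (std_frame R n.+1 n.+1)) (basis_vec R n.+1 0).
Proof.
(* The box with all coordinates in [[a, 2 * a]] lies in the simplex, as their sum is at most 1, and
   the density there is at least [powR a p]. *)
pose a : R := (2 * n.+1%:R)^-1.
have a0 : 0 < a by rewrite invr_gt0 mulr_gt0.
have po := polytope_o_simplex (std_frame R n.+1 n.+1).
apply: (@lt_le_trans _ _ (powR a p * (2 * a - a) ^+ n.+1)).
  by rewrite mulr_gt0 ?powR_gt0 // exprn_gt0 //; lra.
rewrite -lee_fin -(momentE p1) // -lebesgue_int_n_box ?powR_ge0 //; last by lra.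
apply: le_lebesgue_int_n => [y|y||].
- by rewrite lee_fin mulr_ge0 ?powR_ge0 // indicE.
- rewrite lee_fin /moment_density mulrC !indicE.
  have [/set_mem yb|_] := boolP (y \in box _ _ _); last by rewrite mul0r mulr_ge0 ?powR_ge0.
  rewrite mem_set; last first.
    apply: simplex_std_frame => [i|]; first by have /andP[h _] := yb i; lra.
    apply: (@le_trans _ _ (\sum_(i < n.+1) (2 * a))).
      by apply: ler_sum => i _; have /andP[] := yb i.
    rewrite sumr_const card_ord -[_ *+ n.+1]mulr_natr mulrAC /a divff //.
  rewrite !mul1r dotvC (dotv_basis_vec y 0); have /andP[h1 h2] := yb 0.
  apply: ge0_ler_powR; rewrite ?nnegrE ?(ltW p0) ?(ltW a0) // ?le_max ?lexx ?orbT //.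
  by rewrite h1.
- by apply: cV_meas_EFin; apply: jmeas_mul; [exact: jmeas_cst|exact: jmeas_box].
- exact: cV_meas_moment_density.
Qed.

Lemma moment_std_opp n : moment p (simplex (std_frame R n.+1 n.+1)) (- basis_vec R n.+1 0) = 0.
Proof.
apply: moment_eq0 => // y; apply: simplex_le => v /mapP[k _ ->].
by rewrite dotvNl dotvC (dotv_basis_vec _ 0) mxE oppr_le0.
Qed.

End MomentValues.

(** * Classification *)

Section LinearCombinations.
Variables (R : realType) (n : nat) (p : R) (Z Z' : set 'cV[R]_n -> 'cV[R]_n -> R) (a : R).

Lemma is_valuation_comb : is_valuation Z -> is_valuation Z' ->
  is_valuation (fun P x => Z P x + a * Z' P x).
Proof.
move=> vZ vZ' K L poK poL poU poI x.
by rewrite addrACA -mulrDr vZ // vZ' // mulrDr addrACA.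
Qed.

Lemma SL_covariant_comb : SL_covariant Z -> SL_covariant Z' ->
  SL_covariant (fun P x => Z P x + a * Z' P x).
Proof. by move=> cZ cZ' A dA K po x; rewrite cZ // cZ'. Qed.

Lemma homogeneous_comb : homogeneous p Z -> homogeneous p Z' ->
  homogeneous p (fun P x => Z P x + a * Z' P x).
Proof. by move=> hZ hZ' K po l x l0; rewrite hZ // hZ' // mulrDr mulrCA. Qed.

Lemma ray_continuous_comb : ray_continuous Z -> ray_continuous Z' ->
  ray_continuous (fun P x => Z P x + a * Z' P x).
Proof.
by move=> hZ hZ' K po x u; apply: cvgD; [exact: hZ|apply: cvgMr; exact: hZ'].
Qed.

Lemma is_valuation_opp : is_valuation Z -> is_valuation (fun P x => Z P (- x)).
Proof. by move=> vZ K L poK poL poU poI x; exact: vZ. Qed.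

Lemma SL_covariant_opp : SL_covariant Z -> SL_covariant (fun P x => Z P (- x)).
Proof. by move=> cZ A dA K po x; rewrite cZ // mulmxN. Qed.

Lemma homogeneous_opp : homogeneous p Z -> homogeneous p (fun P x => Z P (- x)).
Proof. by move=> hZ K po l x l0; rewrite -scalerN hZ. Qed.

Lemma ray_continuous_opp : ray_continuous Z -> ray_continuous (fun P x => Z P (- x)).
Proof.
move=> hZ K po x u; have := @hZ _ po (- x) (- u).
by under eq_cvg => e do rewrite scalerN -opprD.
Qed.

End LinearCombinations.

Lemma perm_eq_count1 (R : realType) (y : seq R) k : size y = k.+1 ->
  (count (fun t => t != 0%R) y <= 1)%N -> perm_eq y ((\sum_(t <- y) t) :: nseq k 0).
Proof.
have all0 (z : seq R) : count (fun t => t != 0) z = 0%N -> z = nseq (size z) 0.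
  move=> /eqP; rewrite -leqn0 leqNgt -has_count -all_predC => /allP h.
  by apply/all_pred1P/allP => t /h; rewrite /= negbK.
move=> yk y1; have [/hasP[t ty t0]|] := boolP (has (fun t => t != 0) y).
  have pt := perm_to_rem ty; have := y1; rewrite (seq.permP pt) /= t0 add1n ltnS leqn0.
  move=> /eqP/all0 e; have sr : size (rem t y) = k by rewrite size_rem // yk.
  rewrite (perm_big _ pt) big_cons /= e big_nseq sr.
  by rewrite iter_addr_0 mul0rn addr0 -{1}sr -e.
rewrite has_count -leqNgt leqn0 => /eqP/all0 ->.
by rewrite big_nseq iter_addr_0 mul0rn yk.
Qed.

Section SimpleValuations.
Variables (R : realType) (n : nat) (Z : set 'cV[R]_n -> 'cV[R]_n -> R) (p : R).
Hypothesis p0 : 0 < p.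
Hypothesis n2 : (2 < n)%N.
Hypothesis Zval : is_valuation Z.
Hypothesis Zcov : SL_covariant Z.
Hypothesis Zhom : homogeneous p Z.
Hypothesis Zcont : ray_continuous Z.
Hypothesis Zsimple : forall (s : seq 'cV[R]_n) x, free s -> (size s < n)%N -> Z (simplex s) x = 0.
Hypothesis Zbd : forall y : seq R, exists C : R, forall s x, map (dotv x) s = y -> - C <= Z (simplex s) x.
Local Notation T := (simplex (std_frame R n n)).
Local Notation e0 := (basis_vec R n 0).

(** As [n >= 3], at most one nonzero dot leaves two dots equal to 0, so [equal_dots] applies; its
    lower-dimensional term vanishes by simplicity, and the volume factor is read off on the standard
    simplex. *)
Lemma simple_value (t : R) : 0 <= Z T (t *: e0) /\ forall s x, free s -> size s = n ->
  (count (fun v => dotv x v != 0%R) s <= 1)%N -> \sum_(v <- s) dotv x v = t ->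
  Z (simplex s) x = vol s * Z T (t *: e0).
Proof.
have Zpt x : Z (simplex [::]) x = 0 by apply: Zsimple; rewrite ?nil_free // (leq_trans _ n2).
pose m := (n - 3)%N; have nE : n = m.+3 by rewrite /m; lia.
pose z := t :: nseq m 0.
have zn : (size z + 2 <= n)%N by rewrite /= size_nseq nE addn2.
have [C ZC] := Zbd [:: 0, 0 & z].
have [k k0 kE] := equal_dots p0 Zval Zcov Zhom Zcont Zpt zn ZC.
have G0 : face_val Z (0 :: z) = 0.
  have zs : size (0 :: z) = m.+2 by rewrite /= size_nseq.
  have mn : (m.+2 < n)%N by rewrite /m; lia.
  apply: Zsimple; first by apply: free_std_frame; rewrite zs ltnW.
  by rewrite size_std_frame zs.
have pz : perm_eq (t :: nseq m.+2 0) [:: 0, 0 & z].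
  by apply/seq.permP => f /=; ring.
have kT : Z T (t *: e0) = k.
  have := kE (std_frame R n n) (t *: e0) (free_std_frame R (leqnn n)).
  have -> : map (dotv (t *: e0)) (std_frame R n n) = t :: nseq m.+2 0.
    have <- : vec n (t :: nseq m.+2 0) = t *: e0.
      apply/colP => i; rewrite !mxE; case: (val i) => [|j] /=; first by rewrite mulr1.
      by rewrite mulr0; case: j => [|[|j]] /=; rewrite ?nth_nseq ?if_same.
    have sz : size (t :: nseq m.+2 0) = n by rewrite /= size_nseq nE.
    by rewrite -[X in std_frame R n X]sz dots_vec // sz.
  by move=> /(_ pz) ->; rewrite G0 add0r /vol cols_std_frame det1 normr1 mul1r.
rewrite kT; split=> // s x fs sn cs st; rewrite kE // ?G0 ?add0r //.
apply: perm_trans pz; rewrite -st -(big_map (dotv x) xpredT id); apply: perm_eq_count1.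
  by rewrite size_map sn nE.
by rewrite count_map.
Qed.

End SimpleValuations.

Section Classification.
Variables (R : realType) (n : nat) (Z : set 'cV[R]_n -> 'cV[R]_n -> R) (p : R).
Hypothesis p1 : 1 <= p.
Hypothesis n2 : (2 < n)%N.
Hypothesis Zval : is_valuation Z.
Hypothesis Zcov : SL_covariant Z.
Hypothesis Zhom : homogeneous p Z.
Hypothesis Zcont : ray_continuous Z.
Hypothesis Zsimple : forall (s : seq 'cV[R]_n) x, free s -> (size s < n)%N -> Z (simplex s) x = 0.
Hypothesis Zbd : forall y : seq R, exists C : R, forall s x, map (dotv x) s = y -> - C <= Z (simplex s) x.
Local Notation T := (simplex (std_frame R n n)).
Local Notation e0 := (basis_vec R n 0).

Lemma simple_valuation_moment : exists c1 c2 : R, [/\ 0 <= c1, 0 <= c2 &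
  forall P, polytope_o P -> forall x, Z P x = c1 * moment p P x + c2 * moment p P (- x)].
Proof.
have p0 : 0 < p by exact: lt_le_trans ltr01 p1.
have poT : polytope_o T by exact: polytope_o_simplex.
have [M0 MN] : 0 < moment p T e0 /\ moment p T (- e0) = 0.
  by move: n2; case: (n) => // m _; split; [exact: moment_std_gt0|exact: moment_std_opp].
have Zv := simple_value p0 n2 Zval Zcov Zhom Zcont Zsimple Zbd.
have Mbd (y : seq R) : exists C : R, forall s (x : 'cV[R]_n), map (dotv x) s = y ->
    - C <= moment p (simplex s) x.
  by exists 0 => s x _; rewrite oppr0 moment_ge0.
have Mv := simple_value p0 n2 (moment_valuation p1) (moment_covariant p1)
  (moment_homogeneous p1) (moment_ray_continuous p1) (fun s x => @moment_simple R p p1 n s x) Mbd.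
(* The moment of [T] is positive at [e0] and 0 at [- e0], so the values of [Z] at these two points
   determine the coefficients separately. *)
pose c1 := Z T e0 / moment p T e0; pose c2 := Z T (- e0) / moment p T e0.
have c1E : c1 * moment p T e0 = Z T e0 by rewrite /c1 divfK // gt_eqF.
have c2E : c2 * moment p T e0 = Z T (- e0) by rewrite /c2 divfK // gt_eqF.
exists c1, c2; split.
- by apply: divr_ge0 (ltW M0); have := (Zv 1).1; rewrite scale1r.
- by apply: divr_ge0 (ltW M0); have := (Zv (-1)).1; rewrite scaleN1r.
pose W P x := Z P x + - c1 * moment p P x + - c2 * moment p P (- x).
have W0 : forall P, polytope_o P -> forall x, W P x = 0.
  move=> P po x; apply: (@valuation_eq0 R n W p p0) => //.
  - apply: is_valuation_comb; last by apply: is_valuation_opp; exact: moment_valuation.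
    by apply: is_valuation_comb => //; exact: moment_valuation.
  - apply: ray_continuous_comb; last by apply: ray_continuous_opp; exact: moment_ray_continuous.
    by apply: ray_continuous_comb => //; exact: moment_ray_continuous.
  - by move=> s z fs sn; rewrite /W Zsimple // !moment_simple // !mulr0 !addr0.
  move=> s z fs sn cs; set t := \sum_(v <- s) dotv z v.
  have csN : (count (fun v => dotv (- z)%R v != 0%R) s <= 1)%N.
    by rewrite (eq_count (a2 := fun v => dotv z v != 0)) // => v; rewrite dotvNl oppr_eq0.
  have tN : \sum_(v <- s) dotv (- z) v = - t.
    by rewrite /t -sumrN; apply: eq_bigr => v _; rewrite dotvNl.
  rewrite /W ((Zv t).2 s z) // ((Mv t).2 s z) // ((Mv (- t)).2 s (- z)) //.
  suff : Z T (t *: e0) + - c1 * moment p T (t *: e0) + - c2 * moment p T (- t *: e0) = 0.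
    by move=> e; rewrite -[RHS](mulr0 (vol s)) -e; ring.
  have [t0|/ltW t0] := leP 0 t.
    rewrite scaleNr -scalerN Zhom // !(moment_homogeneous p1) // MN !mulr0 addr0.
    by rewrite mulNr mulrCA c1E subrr.
  rewrite -[t in t *: e0]opprK !(scaleNr (- t)) -!(scalerN (- t) e0).
  rewrite Zhom ?oppr_ge0 // !(moment_homogeneous p1) ?oppr_ge0 // MN !mulr0 addr0.
  by rewrite mulNr mulrCA c2E subrr.
move=> P po x; have := W0 P po x; rewrite /W; lra.
Qed.

End Classification.

Section SupportPowers.
Variables (R : realType) (n : nat) (p : R).
Hypothesis p1 : 1 <= p.
Let p0 : 0 < p := lt_le_trans ltr01 p1.

Definition supp_pow (P : set 'cV[R]_n) x := powR (supp_fun P x) p.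

Lemma supp_pow_valuation : is_valuation supp_pow.
Proof. exact: (supp_fun_valuation (fun t => powR t p)). Qed.

Lemma supp_pow_covariant : SL_covariant supp_pow.
Proof. by move=> A dA P po x; rewrite /supp_pow supp_fun_image. Qed.

Lemma supp_pow_homogeneous : homogeneous p supp_pow.
Proof. by move=> P po l x l0; rewrite /supp_pow supp_funZ // powRM // supp_fun_ge0. Qed.

Lemma supp_pow_ray_continuous : ray_continuous supp_pow.
Proof.
move=> P po x u; apply: convex_fun_cvg; apply: powR_convex_fun => //.
  by move=> z; exact: supp_fun_ge0.
exact: supp_fun_convex.
Qed.

Lemma supp_pow_simplex s x : supp_pow (simplex s) x = powR (max0 (map (dotv x) s)) p.
Proof. by rewrite /supp_pow supp_fun_simplex. Qed.

Lemma supp_pow_simplex_opp s x :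
  supp_pow (simplex s) (- x) = powR (max0 (map -%R (map (dotv x) s))) p.
Proof.
rewrite supp_pow_simplex -map_comp; congr (powR (max0 _) p).
by apply: eq_map => v; rewrite /= dotvNl.
Qed.

End SupportPowers.

(** * Reduction to simple valuations *)

Section Reduction.
Variables (R : realType) (n : nat) (p : R).
Hypothesis p1 : 1 <= p.
Hypothesis n2 : (2 < n)%N.
Let p0 : 0 < p := lt_le_trans ltr01 p1.
Local Notation e0 := (basis_vec R n 0).
Local Notation segment := (simplex (std_frame R n 1)).
Local Notation h := (@supp_pow R n p).
Implicit Type Phi : set 'cV[R]_n -> 'cV[R]_n -> R.

(** The hypotheses in a form stable under [x] to [- x], so that a statement on positive dots also
    yields the one on negative dots. *)
Definition admissible Phi :=
  [/\ is_valuation Phi, SL_covariant Phi, homogeneous p Phi,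
      forall P, polytope_o P -> forall x, 0 <= Phi P x &
      forall P, polytope_o P -> convex_fun (Phi P)].

Lemma admissible_opp Phi : admissible Phi -> admissible (fun P x => Phi P (- x)).
Proof.
move=> [v c hm g cv]; split.
- exact: is_valuation_opp.
- exact: SL_covariant_opp.
- exact: homogeneous_opp.
- by move=> P po x; exact: g.
- by move=> P po x y t t0 t1; rewrite opprD -!scalerN; exact: cv.
Qed.

(** The support function of the segment is 1 at [e0] and 0 at [- e0], so these coefficients cancel
    [Phi] on it; [h P (- x)] is the power of the support function of the reflected body. *)
Definition reduced Phi : set 'cV[R]_n -> 'cV[R]_n -> R := fun P x =>
  Phi P x + - Phi segment e0 * h P x + - Phi segment (- e0) * h P (- x).

Lemma reduced_opp Phi P x :
  reduced (fun P x => Phi P (- x)) P x = reduced Phi P (- x).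
Proof. by rewrite /reduced !opprK addrAC. Qed.

Section Admissible.
Variable Phi : set 'cV[R]_n -> 'cV[R]_n -> R.
Hypothesis Phi_adm : admissible Phi.
Local Notation Z := (reduced Phi).

Lemma reduced_valuation : is_valuation Z.
Proof.
have [v _ _ _ _] := Phi_adm; apply: is_valuation_comb.
  by apply: is_valuation_comb => //; exact: supp_pow_valuation.
by apply: is_valuation_opp; exact: supp_pow_valuation.
Qed.

Lemma reduced_covariant : SL_covariant Z.
Proof.
have [_ v _ _ _] := Phi_adm; apply: SL_covariant_comb.
  by apply: SL_covariant_comb => //; exact: supp_pow_covariant.
by apply: SL_covariant_opp; exact: supp_pow_covariant.
Qed.

Lemma reduced_homogeneous : homogeneous p Z.
Proof.
have [_ _ v _ _] := Phi_adm; apply: homogeneous_comb.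
  by apply: homogeneous_comb => //; exact: supp_pow_homogeneous.
by apply: homogeneous_opp; exact: supp_pow_homogeneous.
Qed.

Lemma reduced_ray_continuous : ray_continuous Z.
Proof.
have [_ _ _ _ v] := Phi_adm; apply: ray_continuous_comb; last first.
  by apply: ray_continuous_opp; exact: supp_pow_ray_continuous.
apply: ray_continuous_comb => //; last exact: supp_pow_ray_continuous.
by move=> P po x u; apply: convex_fun_cvg; exact: v.
Qed.

(* An element of SL(n) whose transpose halves x fixes the polytope {0}, so
   homogeneity forces Phi {0} = 0. *)
Lemma admissible_point x : Phi (simplex [::]) x = 0.
Proof.
have [_ cov hom _ _] := Phi_adm; have po := polytope_o_simplex ([::] : seq 'cV[R]_n).
have [->|x0] := eqVneq x 0; first by rewrite (valuation_at0 p0 hom).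
have xx0 : dotv x x != 0 by apply: contra_neq x0; exact: dotv_self_eq0.
pose v := (dotv x x)^-1 *: x.
have xv : dotv x v = 1 by rewrite /v dotvZr mulVf.
have v0 : v != 0 by rewrite scaler_eq0 negb_or invr_eq0 xx0.
have h2 : (2^-1 : R) != 0 by rewrite invr_eq0 pnatr_eq0.
have [|||||A dA [_ Ax]] := @same_dots _ _ [:: v] [:: 2^-1 *: v] x (2 *: x).
- by rewrite seq1_free.
- by rewrite seq1_free scaler_eq0 negb_or h2.
- exact: ltnW.
- by rewrite /= (dotvZl 2 x) (dotvZr _ x v) mulrA mulfV ?pnatr_eq0 // mul1r.
- by exists v; rewrite ?mem_head // xv oner_eq0.
have := valuation_map cov [::] (2 *: x) dA; rewrite Ax /= hom //.
have : powR 1 p < powR 2 p :> R by rewrite gt0_ltr_powR ?nnegrE // ltr1n.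
by rewrite powR1; nra.
Qed.

Lemma reduced_point x : Z (simplex [::]) x = 0.
Proof.
rewrite /reduced admissible_point !supp_pow_simplex /= /max0 big_nil powR0 ?gt_eqF //.
by rewrite !mulr0 !addr0.
Qed.

Lemma reduced_segment t : face_val Z [:: t] = 0.
Proof.
have po := polytope_o_simplex (std_frame R n 1).
have k0 : (0 < n)%N by exact: ltn_trans n2.
have e00 : dotv e0 e0 = 1 by rewrite (dotv_basis_vec _ (Ordinal k0)) mxE.
have he : h segment e0 = 1.
  by rewrite supp_pow_simplex /= e00 /max0 big_cons big_nil max_l // powR1.
have hN : h segment (- e0) = 0.
  by rewrite supp_pow_simplex /= dotvNl e00 /max0 big_cons big_nil max_r ?lerN10 // powR0 ?gt_eqF.
rewrite /face_val /= (_ : vec n [:: t] = t *: e0); last first.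
  by apply/colP => i; rewrite !mxE; case: (val i) => [|j] /=; rewrite ?mulr1 ?mulr0 ?nth_nil.
have [t0|/ltW t0] := leP 0 t.
  by rewrite reduced_homogeneous // /reduced he hN !mulr0 addr0 mulr1 subrr mulr0.
rewrite -[t]opprK scaleNr -scalerN reduced_homogeneous ?oppr_ge0 // /reduced opprK he hN.
by rewrite mulr0 addr0 mulr1 subrr mulr0.
Qed.

Lemma reducedE s x : Phi (simplex s) x = Z (simplex s) x +
  Phi segment e0 * powR (max0 (map (dotv x) s)) p +
  Phi segment (- e0) * powR (max0 (map -%R (map (dotv x) s))) p.
Proof. by rewrite /reduced -supp_pow_simplex_opp -supp_pow_simplex; ring. Qed.

Lemma reduced_coeff_eq0 : 1 < p \/ (3 < n)%N -> face_val Z [:: 1; 0] = 0.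
Proof.
have [_ _ _ Phi0 cv] := Phi_adm.
have Phi_ge0 s x : 0 <= Phi (simplex s) x by apply: Phi0; exact: polytope_o_simplex.
have Phi_convex s x x' : Phi (simplex s) (2^-1 *: (x + x'))
    <= 2^-1 * (Phi (simplex s) x + Phi (simplex s) x').
  have := cv _ (polytope_o_simplex s) x x' 2^-1; rewrite (_ : 1 - 2^-1 = 2^-1); last by field.
  by rewrite -scalerDr -mulrDr invr_ge0 invf_le1 ?ler0n ?ler1n ?ltr0n //; apply.
move=> hn; apply/eqP; rewrite eq_le; apply/andP; split; last first.
  by apply: (coeff_ge0 p0 reduced_valuation reduced_covariant reduced_homogeneous
    reduced_ray_continuous reduced_point reduced_segment reducedE).
case: hn => hn.
  by apply: (coeff_le0_gt1 p0 reduced_valuation reduced_covariant reduced_homogeneous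
    reduced_ray_continuous reduced_point reduced_segment reducedE).
by apply: (coeff_le0_gt3 p0 reduced_valuation reduced_covariant reduced_homogeneous
    reduced_ray_continuous reduced_point reduced_segment reducedE).
Qed.

End Admissible.

Lemma admissible_classification Phi : 1 < p \/ (3 < n)%N -> admissible Phi ->
  exists a b c1 c2 : R, [/\ 0 <= a, 0 <= b, 0 <= c1 & 0 <= c2] /\
  forall P, polytope_o P -> forall x, Phi P x =
    c1 * moment p P x + c2 * moment p P (- x) + a * h P x + b * h P (- x).
Proof.
move=> hn adm; have [_ _ _ Phi0 _] := adm; have poS := polytope_o_simplex (std_frame R n 1).
have Z10 := reduced_coeff_eq0 adm hn.
(* The coefficient G(1, 0) of the reflected valuation. *)
have ZN10 : face_val (reduced Phi) [:: -1; 0] = 0.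
  have := reduced_coeff_eq0 (admissible_opp adm) hn; rewrite /face_val reduced_opp /=.
  rewrite (_ : vec n [:: -1; 0] = - vec n [:: 1; 0]) //.
  by apply/colP => i; rewrite !mxE; case: (val i) => [|[|j]] /=; rewrite ?nth_nil ?oppr0.
have Zsimple := valuation_simple p0 (reduced_valuation adm) (reduced_covariant adm)
  (reduced_homogeneous adm) (reduced_ray_continuous adm) (reduced_point adm)
  (reduced_segment adm) Z10 ZN10.
have [||c1 [c2 [c10 c20 ZE]]] := simple_valuation_moment p1 n2 (reduced_valuation adm)
  (reduced_covariant adm) (reduced_homogeneous adm) (reduced_ray_continuous adm).
- by move=> s x; exact: Zsimple.
(* Nonnegativity of [Phi] bounds [Z] below by minus the support terms, which depend on the dots
   only. *)
- move=> y; pose a := Phi segment e0; pose b := Phi segment (- e0).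
  exists (a * powR (max0 y) p + b * powR (max0 (map -%R y)) p) => s x ys.
  by have := Phi0 _ (polytope_o_simplex s) x; rewrite reducedE ys -/a -/b -addrA -lerBlDr sub0r.
exists (Phi segment e0), (Phi segment (- e0)), c1, c2.
split; first by split=> //; exact: Phi0.
by move=> P po x; rewrite -ZE // /reduced; ring.
Qed.

End Reduction.

(** [f] is the p-th power, convex and increasing on nonnegative numbers, of a nonnegative sublinear
    function. *)
Lemma sublinear_powR_convex (R : realType) (n : nat) (p : R) (f : 'cV[R]_n -> R) : 1 <= p ->
  (forall x, 0 <= f x) -> sublinear (fun x => powR (f x) p^-1) -> convex_fun f.
Proof.
move=> p1 f0 [gZ gD]; have p0 : 0 < p by exact: lt_le_trans ltr01 p1.
have -> : f = fun x => powR (powR (f x) p^-1) p.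
  by apply/funext => x; rewrite -powRrM mulVf ?gt_eqF // powRr1.
apply: powR_convex_fun => // [x|x y t t0 t1]; first exact: powR_ge0.
by apply: le_trans (gD _ _) _; rewrite !gZ // subr_ge0.
Qed.

Section Converse.
Variables (R : realType) (n : nat) (p a1 b1 c1 c2 : R).
Hypothesis p1 : 1 <= p.

Definition moment_supp (P : set 'cV[R]_n) x := c1 * moment p P x + c2 * moment p P (- x)
  + a1 * supp_pow p P x + b1 * supp_pow p P (- x).

(** The leading 0 presents the sum as four successive uses of the combination lemmas, starting from
    the zero valuation. *)
Let combE : moment_supp = fun P x => 0 + c1 * moment p P x + c2 * moment p P (- x)
  + a1 * supp_pow p P x + b1 * supp_pow p P (- x).
Proof. by apply/funext => P; apply/funext => x; rewrite add0r. Qed.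

Lemma moment_suppE P x : c1 * powR (supp_Mp_plus p P x) p + c2 * powR (supp_Mp_minus p P x) p
  + a1 * powR (supp_fun P x) p + b1 * powR (supp_fun [set - y | y in P] x) p = moment_supp P x.
Proof.
have eP := powR_supp_Mp_plus p1 P x; have eM := powR_supp_Mp_minus p1 P x.
have eN := supp_fun_opp P x.
by congr (_ * _ + _ * _ + _ + _ * _); rewrite /supp_pow -?eN.
Qed.

Lemma moment_supp_valuation : is_valuation moment_supp.
Proof.
rewrite combE; apply: is_valuation_comb; last first.
  by apply: is_valuation_opp; exact: supp_pow_valuation.
apply: is_valuation_comb; last exact: supp_pow_valuation.
apply: is_valuation_comb; last by apply: is_valuation_opp; exact: moment_valuation.
by apply: (is_valuation_comb (Z := fun _ _ => 0)) => [K L *|]; [rewrite addr0|exact: moment_valuation].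
Qed.

Lemma moment_supp_covariant : SL_covariant moment_supp.
Proof.
rewrite combE; apply: SL_covariant_comb; last first.
  by apply: SL_covariant_opp; exact: supp_pow_covariant.
apply: SL_covariant_comb; last exact: supp_pow_covariant.
apply: SL_covariant_comb; last by apply: SL_covariant_opp; exact: moment_covariant.
by apply: (SL_covariant_comb (Z := fun _ _ => 0)) => //; exact: moment_covariant.
Qed.

End Converse.

Theorem theorem5p3 (R : realType) (n : nat) (p : R)
  (Phi : set 'cV[R]_n -> 'cV[R]_n -> R) :
  ((3 <= n)%N /\ 1 < p \/ (4 <= n)%N /\ p = 1) ->
  (forall P, polytope_o P -> Cp p (Phi P)) ->
  (forall P, polytope_o P -> forall x, 0 <= Phi P x) ->
  (forall P, polytope_o P -> sublinear (fun x => powR (Phi P x) p^-1)) ->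
  ((is_valuation Phi /\ SL_covariant Phi) <->
   exists a1 b1 c1 c2 : R, [/\ 0 <= a1, 0 <= b1, 0 <= c1 & 0 <= c2] /\
     forall P, polytope_o P -> forall x,
       Phi P x = c1 * powR (supp_Mp_plus p P x) p
               + c2 * powR (supp_Mp_minus p P x) p
               + a1 * powR (supp_fun P x) p
               + b1 * powR (supp_fun [set - y | y in P] x) p).
Proof.
move=> hnp PhiC Phi0 Phi_sub.
have p1 : 1 <= p by case: hnp => [[_ /ltW]|[_ ->]].
have n2 : (2 < n)%N by case: hnp => [[]|[/ltnW]].
have hn : 1 < p \/ (3 < n)%N by case: hnp => [[_ h]|[h _]]; [left|right].
split=> [[Pval Pcov]|[a1 [b1 [c1 [c2 [_ PhiE]]]]]].
  have adm : admissible p Phi.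
    split=> // [P po l x l0|P po]; first by have [_] := PhiC P po; apply.
    by apply: (sublinear_powR_convex p1); [exact: Phi0|exact: Phi_sub].
  have [a [b [c1 [c2 [h PhiE]]]]] := admissible_classification p1 n2 hn adm.
  exists a, b, c1, c2; split; first exact: h.
  move=> P po x; rewrite moment_suppE //; exact: PhiE.
have {}PhiE P : polytope_o P -> Phi P = moment_supp p a1 b1 c1 c2 P.
  by move=> po; apply/funext => x; rewrite -moment_suppE //; exact: PhiE.
split=> [K L poK poL poU poI x|A dA K po x].
  by rewrite (PhiE _ poK) (PhiE _ poL) (PhiE _ poU) (PhiE _ poI); exact: moment_supp_valuation.
by rewrite (PhiE _ (polytope_o_image A po)) (PhiE _ po) moment_supp_covariant.
Qed.
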